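(* There is an absolute constant $c>0$ such that the following holds. Let $n\ge 2$, $m,T\ge 1$ be integers and let $(X,Y),(X_1,Y_1),\dots,(X_n,Y_n)$ be i.i.d. random variables with values in $\mathcal M_{m,T}\times\mathbb R$ satisfying Assumptions (X) and (Y) of the context. Let $x>0$ and set $$\lambda_{n,x}=c_{X,Y}\,\frac{(x+\log n)\log n}{\sqrt n},\qquad c_{X,Y}:=c\,\bigl(1+b_{X,2}^2+b_Yb_{X,2}+b_{Y,\psi_2}^2+b_{Y,\infty}^2+b_{Y,2}^2+b_{X,\infty}^2\bigr).$$ Consider any $$\hat A_n\in\operatorname*{argmin}_{A\in\mathcal M_{m,T}}\bigl\{R_n(A)+\lambda_{n,x}\|A\|_{S_1}\bigr\}.$$ Then, with probability larger than $1-5e^{-x}$, $$R(\hat A_n)\le\inf_{A\in\mathcal M_{m,T}}\bigl\{R(A)+\lambda_{n,x}(1+\|A\|_{S_1})\bigr\}.$$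
   Context: $\mathcal M_{m,T}$ is the set of real $m\times T$ matrices, with inner product $\langle A,B\rangle=\operatorname{tr}(A^\top B)$. For $p\in[1,\infty]$, $\|A\|_{S_p}$ is the Schatten norm, i.e. the $\ell_p$ norm of the sequence of singular values of $A$ ($S_1$: nuclear norm, $S_2$: Frobenius norm, $S_\infty$: operator norm). $\|A\|_\infty=\max_{p,q}|A_{p,q}|$. $\operatorname{vec}(A)\in\mathbb R^{mT}$ stacks the columns of $A$. For a real random variable $Z$, $\|Z\|_{\psi_2}=\inf\{c>0:\mathbb E\exp(|Z|^2/c^2)\le 2\}$. Data: $D_n=(X_i,Y_i)_{i=1}^n$. The risk is $R(A)=\mathbb E[(Y-\langle X,A\rangle)^2]$ for $A \in \mathcal M_{m,T}$; for a statistic $\hat A_n$ built from $D_n$, $R(\hat A_n)=\mathbb E[(Y-\langle X,\hat A_n\rangle)^2\mid D_n]$. The empirical risk is $R_n(A)=\frac1n\sum_{i=1}^n(Y_i-\langle X_i,A\rangle)^2$. Assumption (X): there are positive constants $b_{X,\infty},b_{X,\ell_\infty},b_{X,2}$ with $\|X\|_{S_\infty}\le b_{X,\infty}$, $\|X\|_\infty\le b_{X,\ell_\infty}$, $\|X\|_{S_2}\le b_{X,2}$ almost surely, and $\Sigma=\mathbb E[\operatorname{vec}X(\operatorname{vec}X)^\top]$ is invertible. Assumption (Y): there are positive constants $b_Y,b_{Y,\infty},b_{Y,\psi_2},b_{Y,2}$ with $\|Y-\mathbb E(Y|X)\|_{\psi_2}\le b_{Y,\psi_2}$, $\|\mathbb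 E(Y|X)\|_{L_\infty}\le b_{Y,\infty}$, $\mathbb E[(Y-\mathbb E(Y|X))^2|X]\le b_{Y,2}^2$ almost surely, and $\mathbb E Y^2\le b_Y^2$. *)

(* Defs.v *)
From HB Require Import structures.
From mathcomp Require Import all_boot all_order all_algebra.
From mathcomp Require Import all_classical all_reals all_analysis.
From mathcomp Require Import complex.

Set Implicit Arguments.
Unset Strict Implicit.
Unset Printing Implicit Defensive.

Import Order.TTheory GRing.Theory Num.Theory.
Import numFieldNormedType.Exports.

Local Open Scope classical_set_scope.
Local Open Scope ring_scope.

(* 'M[R]_(m, T) with its Borel sigma-algebra, so that
   random matrices are elements of {mfun Omega >-> borel_mx R m T}. *)
Definition borel_mx (R : realType) (m T : nat) :=
  g_sigma_algebraType (@open 'M[R]_(m, T)).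

Section Matrices.
Variables (R : realType) (m T : nat).

Definition mx_inner (A B : 'M[R]_(m, T)) : R := \tr (A^T *m B).

(* The eigenvalues, with multiplicity, of the symmetric positive semidefinite
   matrix A^T A: by gram_eigenvaluesP its characteristic polynomial splits over
   R, so the default value of xget is never taken. The order of the
   list is irrelevant below. *)
Definition gram_eigenvalues (A : 'M[R]_(m, T)) : seq R :=
  xget [::] [set s : seq R |
    char_poly (A^T *m A) = \prod_(a <- s) ('X - a%:P)].

Lemma gram_eigenvaluesP (A : 'M[R]_(m, T)) :
  char_poly (A^T *m A) = \prod_(a <- gram_eigenvalues A) ('X - a%:P) /\
  {in gram_eigenvalues A, forall a, 0 <= a}.
Proof.
pose C : numClosedFieldType := complex.complex R.
pose f : {rmorphism R -> C} := complex.real_complex R.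
pose A' := map_mx f A.
have [r Er] := closed_field_poly_normal (map_poly f (char_poly (A^T *m A))).
have {}Er : map_poly f (char_poly (A^T *m A)) = \prod_(z <- r) ('X - z%:P).
  rewrite Er (_ : lead_coef _ = 1) ?scale1r //.
  by apply/monicP; rewrite map_char_poly char_poly_monic.
have norm2 k (u : 'rV[C]_k) :
    (u *m (map_mx Num.conj u)^T) 0 0 = \sum_i `|u 0 i| ^+ 2.
  by rewrite mxE; apply: eq_bigr => i _; rewrite !mxE normCK.
have norm2_ge0 k (u : 'rV[C]_k) : 0 <= (u *m (map_mx Num.conj u)^T) 0 0.
  by rewrite norm2; apply: sumr_ge0 => i _; rewrite exprn_ge0.
have r_ge0 z : z \in r -> 0 <= z.
  rewrite -root_prod_XsubC -Er map_char_poly -eigenvalue_root_char.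
  case/eigenvalueP=> v Ev v_neq0.
  have v2_gt0 : 0 < (v *m (map_mx Num.conj v)^T) 0 0.
    rewrite lt_def norm2_ge0 andbT norm2; apply: contra v_neq0.
    rewrite psumr_eq0 => [/allP v0|i _]; last by rewrite exprn_ge0.
    apply/eqP/rowP=> i; have := v0 i (mem_index_enum _).
    by rewrite /= expf_eq0 /= normr_eq0 mxE => /eqP.
  rewrite -(pmulr_lge0 _ v2_gt0).
  suff -> : z * (v *m (map_mx Num.conj v)^T) 0 0 =
      (v *m A'^T *m (map_mx Num.conj (v *m A'^T))^T) 0 0 by exact: norm2_ge0.
  have -> : map_mx Num.conj (v *m A'^T) = map_mx Num.conj v *m A'^T.
    rewrite map_mxM; congr (_ *m _); apply/matrixP=> i j; rewrite !mxE.
    apply/CrealP/complex.complex_realP; by eexists.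
  rewrite trmx_mul trmxK mulmxA.
  move: Ev; rewrite map_mxM -map_trmx mulmxA => Ev.
  rewrite /A' Ev.
  by rewrite -scalemxAl [RHS]mxE.
have [s Es] : exists s : seq R, r = map f s.
  exists (map (@complex.Re R) r); rewrite -map_comp -[LHS]map_id.
  apply/eq_in_map => z /r_ge0/ger0_real/complex.complex_realP[k ->].
  by [].
have Hs : char_poly (A^T *m A) = \prod_(a <- s) ('X - a%:P).
  apply: (@map_poly_inj _ _ f); rewrite Er Es big_map rmorph_prod.
  by apply: eq_bigr => a _; rewrite rmorphB /= map_polyX map_polyC.
have Eg : char_poly (A^T *m A) = \prod_(a <- gram_eigenvalues A) ('X - a%:P).
  by rewrite /gram_eigenvalues; case: xgetP => [t -> //|/(_ s)].
split=> // a; rewrite -root_prod_XsubC -Eg Hs root_prod_XsubC => sa.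
have : 0 <= f a by apply: r_ge0; rewrite Es map_f.
by rewrite complex.lecR.
Qed.

(* T values; when T exceeds m the list is padded with zeros, which does not
   affect its l_p norms. *)
Definition singular_values (A : 'M[R]_(m, T)) : seq R :=
  [seq Num.sqrt a | a <- gram_eigenvalues A].

(* Meaningful for p in [1, +oo]. *)
Definition schatten (p : \bar R) (A : 'M[R]_(m, T)) : R :=
  match p with
  | p%:E => (\sum_(s <- singular_values A) s `^ p) `^ p^-1
  | +oo%E => \big[Num.max/0]_(s <- singular_values A) s
  | -oo%E => 0
  end.

(* mxvec concatenates rows, hence the transpose in order to stack columns. *)
Definition vec (A : 'M[R]_(m, T)) : 'cV[R]_(T * m) := (mxvec A^T)^T.

End Matrices.

Section Probability.
Context (d : measure_display) (Omega : measurableType d) (R : realType).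
Variable P : probability Omega R.

Definition psi2_norm (Z : Omega -> R) : \bar R :=
  ereal_inf [set c%:E | c in [set c : R | 0 < c /\
    ('E_P[fun w => expR (`|Z w| ^+ 2 / c ^+ 2)] <= 2%:E)%E]].

(* g is a version of E(f | G), for G a sub-sigma-algebra. *)
Definition is_cond_exp (G : set (set Omega)) (f g : Omega -> R) : Prop :=
  [/\ P.-integrable setT (EFin \o f),
      P.-integrable setT (EFin \o g),
      forall B : set R, measurable B -> G (g @^-1` B) &
      forall A : set Omega, G A ->
        (\int[P]_(w in A) (g w)%:E = \int[P]_(w in A) (f w)%:E)%E].

Definition mutually_independent (d' : measure_display) (V : measurableType d')
    (I : finType) (Z : I -> Omega -> V) : Prop :=
  forall (J : {set I}) (B : I -> set V), (forall i, measurable (B i)) ->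
    fine (P (\bigcap_(i in [set` J]) (Z i @^-1` B i))) =
    \prod_(i in J) fine (P (Z i @^-1` B i)).

Definition iid (d' : measure_display) (V : measurableType d')
    (I : finType) (Z : I -> Omega -> V) : Prop :=
  mutually_independent Z /\
  forall (i j : I) (B : set V), measurable B ->
    P (Z i @^-1` B) = P (Z j @^-1` B).

Definition sigma_of (d' : measure_display) (V : measurableType d')
    (X : Omega -> V) : set (set Omega) :=
  preimage_set_system setT X measurable.

End Probability.

Section Model.
Context (d : measure_display) (Omega : measurableType d) (R : realType).
Variables (P : probability Omega R) (m T : nat).
Variables (X : {mfun Omega >-> borel_mx R m T}) (Y : {RV P >-> R}).

Definition risk (A : 'M[R]_(m, T)) : \bar R :=
  'E_P[fun w => (Y w - mx_inner (X w) A) ^+ 2].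

Definition second_moment_mx : 'M[R]_(T * m) :=
  \matrix_(i, j) fine 'E_P[fun w => (vec (X w) *m (vec (X w))^T) i j].

(* The norm `|A| of a matrix is the maximum of the `|A i j|. *)
Definition assumption_X (bXinf bXlinf bX2 : R) : Prop :=
  [/\ 0 < bXinf, 0 < bXlinf & 0 < bX2] /\
  [/\ {ae P, forall w, schatten +oo (X w : 'M[R]_(m, T)) <= bXinf},
      {ae P, forall w, `|(X w : 'M[R]_(m, T))| <= bXlinf},
      {ae P, forall w, schatten 2%:E (X w : 'M[R]_(m, T)) <= bX2} &
      second_moment_mx \in unitmx].

(* eta is E(Y | X) and v is E((Y - E(Y | X))^2 | X). *)
Definition assumption_Y (bY bYinf bYpsi2 bY2 : R) : Prop :=
  [/\ 0 < bY, 0 < bYinf, 0 < bYpsi2 & 0 < bY2] /\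
  exists eta v : Omega -> R,
    is_cond_exp P (sigma_of X) Y eta /\
    is_cond_exp P (sigma_of X) (fun w => (Y w - eta w) ^+ 2) v /\
    [/\ (psi2_norm P (fun w => Y w - eta w)%R <= bYpsi2%:E)%E,
        (Lnorm P +oo (EFin \o eta) <= bYinf%:E)%E,
        {ae P, forall w, v w <= bY2 ^+ 2} &
        ('E_P[fun w => (Y w ^+ 2)%R] <= (bY ^+ 2)%:E)%E].

End Model.

Definition empirical_risk (R : realType) (m T n : nat)
    (D : 'I_n -> borel_mx R m T * R) (A : 'M[R]_(m, T)) : R :=
  n%:R^-1 * \sum_(i < n) ((D i).2 - mx_inner (D i).1 A) ^+ 2.

Definition is_argmin (R : realType) (V : Type) (F : V -> R) (a : V) : Prop :=
  forall b : V, F a <= F b.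

Definition c_XY (R : realType) (c bXinf bX2 bY bYinf bYpsi2 bY2 : R) : R :=
  c * (1 + bX2 ^+ 2 + bY * bX2 + bYpsi2 ^+ 2 + bYinf ^+ 2 + bY2 ^+ 2
       + bXinf ^+ 2).

Definition lambda_nx (R : realType) (cXY : R) (n : nat) (x : R) : R :=
  cXY * ((x + ln n%:R) * ln n%:R / Num.sqrt n%:R).

(* Main.v *)
Require Import Defs.
From HB Require Import structures.
From mathcomp Require Import all_boot all_order all_algebra.
From mathcomp Require Import all_classical all_reals all_analysis.
From mathcomp Require Import complex measurable_realfun ess_sup_inf.
From mathcomp Require Import ring lra.

Set Implicit Arguments.
Unset Strict Implicit.
Unset Printing Implicit Defensive.

Import Order.TTheory GRing.Theory Num.Theory.
Import numFieldNormedType.Exports.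

Local Open Scope classical_set_scope.
Local Open Scope ring_scope.

(** A matrix is identified with the row of its entries, so that the risk becomes
    a quadratic form q a = rho - 2 <v, a> + <a S, a> and the Frobenius norm the
    Euclidean norm. The only properties of the nuclear norm N that matter are its
    convexity and the fact that it dominates the Frobenius norm. Write be for the
    bracket in c_XY and L = x + log n. As 2 log n >= 1, the penalty lam satisfies
    kap^2 (be L)^2 <= lam^2 n for a large constant kap. Let Fs be the infimum of
    the penalized risk q + lam N. It is shown that outside an event of the sample of
    probability at most exp (- x) every minimizer ah of the penalized empirical risk
    has q ah <= Fs + lam, which implies the claim.

    Truncation. By [exp_moment_le] the mean of exp (Y^2 / (8 be)) is at most 3.
    With K^2 = 32 be L all responses of the sample are at most K with high
    probability, and clipping Y at level K changes v by at most a multiple of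
    be / n ([clip_bias]).

    Estimation errors. The difference between the risk and the empirical risk,
    compared at ah and at a fixed matrix b, is the sum of a linear and of a
    quadratic function of ah - b. The linear part is a sum of independent random
    vectors, bounded by a dimension free Bernstein inequality
    ([vector_bernstein]). For the quadratic part a lower bound of the empirical
    second moment matrix is enough. It holds up to an error of order
    (L / n) |ah - b|^2 ([cov_lower_tail]), because the traces of the n-th powers of
    the matrices c I + (15/16) k S - (sum of the first k outer products) do not
    increase in mean, by Klein's inequality. Subtracting from such a trace its
    first order expansion at c I removes the dimension from the bound.

    From errors to risk. Let a0 be nearly optimal with N a0 = r. Comparing ah with
    a0 bounds the excess penalized risk by a small multiple of lam (1 + N ah + r),
    which suffices unless r is much larger than 1 + N ah. In that case ah is
    compared with the matrix of nearly minimal norm among those with at most the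
    same excess. Its norm is at most N ah + 1, so the error is of the order of
    lam (1 + N ah). This matrix is in turn compared with a0: its norm is much
    smaller than r although its penalized risk is nearly the same, so the distance
    from a0 in the geometry of S is at least of order lam r / sqrt be, and this
    signal dominates the fluctuation of the difference of the two losses
    ([gap_event]). Rounding the excess to multiples of lam leaves at most n such
    matrices, which are deterministic ([oracle_deterministic], [oracle_event]).
    When n < 20 L the penalty is so large that ah = 0.

    Conditioning. The fresh observation is independent of the sample, hence a
    version of the conditional risk is at most Fs + lam almost surely wherever
    q ah <= Fs + lam ([conditional_risk_le]). *)

(** * Euclidean geometry of row vectors and the real spectral theorem *)

Section Dot.
Context (R : realType).
Definition dot n (u v : 'rV[R]_n) : R := \sum_i u 0 i * v 0 i.

Lemma mulmx_dot n (u v : 'rV[R]_n) : u *m v^T = (dot u v)%:M.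
Proof.
apply/matrixP=> i j; rewrite !ord1 !mxE /= mulr1n; apply: eq_bigr => k _.
by rewrite mxE.
Qed.

Lemma dotE n (u v : 'rV[R]_n) : dot u v = (u *m v^T) 0 0.
Proof. by rewrite mulmx_dot mxE mulr1n. Qed.

Lemma dotC n (u v : 'rV[R]_n) : dot u v = dot v u.
Proof. by apply: eq_bigr => i _; rewrite mulrC. Qed.

Lemma dotDl n (u v w : 'rV[R]_n) : dot (u + v) w = dot u w + dot v w.
Proof. by rewrite -big_split; apply: eq_bigr => i _; rewrite mxE mulrDl. Qed.

Lemma dotZl n a (u v : 'rV[R]_n) : dot (a *: u) v = a * dot u v.
Proof. by rewrite mulr_sumr; apply: eq_bigr => i _; rewrite mxE mulrA. Qed.

Lemma dotDr n (u v w : 'rV[R]_n) : dot u (v + w) = dot u v + dot u w.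
Proof. by rewrite dotC dotDl !(dotC u). Qed.

Lemma dotZr n a (u v : 'rV[R]_n) : dot u (a *: v) = a * dot u v.
Proof. by rewrite dotC dotZl dotC. Qed.

Lemma dotNl n (u v : 'rV[R]_n) : dot (- u) v = - dot u v.
Proof. by rewrite -scaleN1r dotZl mulN1r. Qed.

Lemma dotNr n (u v : 'rV[R]_n) : dot u (- v) = - dot u v.
Proof. by rewrite dotC dotNl dotC. Qed.

Lemma dotBl n (u v w : 'rV[R]_n) : dot (u - v) w = dot u w - dot v w.
Proof. by rewrite dotDl dotNl. Qed.

Lemma dotBr n (u v w : 'rV[R]_n) : dot u (v - w) = dot u v - dot u w.
Proof. by rewrite dotDr dotNr. Qed.

Lemma dot0l n (u : 'rV[R]_n) : dot 0 u = 0.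
Proof. by rewrite -(scale0r 0) dotZl mul0r. Qed.

Lemma dot0r n (u : 'rV[R]_n) : dot u 0 = 0.
Proof. by rewrite dotC dot0l. Qed.

Lemma dot_sumr n (I : Type) (s : seq I) (P : pred I) (u : 'rV[R]_n) F :
  dot u (\sum_(i <- s | P i) F i) = \sum_(i <- s | P i) dot u (F i).
Proof.
by apply: (big_morph (dot u)) => [v w|]; [rewrite dotDr|rewrite dot0r].
Qed.

Lemma dot_mulmx n k (u : 'rV[R]_n) (v : 'rV[R]_k) (S : 'M[R]_(n, k)) : dot (u *m S) v = dot u (v *m S^T).
Proof. by rewrite !dotE trmx_mul trmxK mulmxA. Qed.

Lemma dot_ge0 n (u : 'rV[R]_n) : 0 <= dot u u.
Proof. by apply: sumr_ge0 => i _; rewrite -expr2 sqr_ge0. Qed.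

Lemma dot_eq0 n (u : 'rV[R]_n) : (dot u u == 0) = (u == 0).
Proof.
apply/idP/eqP => [|->]; last by rewrite dot0l.
rewrite psumr_eq0 => [/allP u0|i _]; last by rewrite -expr2 sqr_ge0.
apply/rowP => i; have := u0 i (mem_index_enum _).
by rewrite /= mulf_eq0 orbb mxE => /eqP.
Qed.

(** The discriminant of a nonnegative quadratic polynomial; every
    Cauchy-Schwarz inequality below is obtained from it, for scalar products as
    well as for expectations. *)
Lemma discr_le (a b c : R) : (forall t, 0 <= a + 2 * b * t + c * t ^+ 2) ->
  b ^+ 2 <= a * c.
Proof.
move=> H; have c0 : 0 <= c.
  rewrite leNgt; apply/negP => cn.
  have a0 : 0 <= a by have := H 0; lra.
  pose t := (a + 1 + 2 * `|b|) / (- c) + 1.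
  have t1 : 1 <= t.
    rewrite lerDr divr_ge0 //; last by lra.
    by have := normr_ge0 b; lra.
  have ct : c * t = - (a + 1 + 2 * `|b|) + c.
    by rewrite /t mulrDr mulr1; congr (_ + c); field; lra.
  have := H t.
  have := ler_norm b; set B := `|b| in ct *; move=> bB.
  have -> : a + 2 * b * t + c * t ^+ 2 = a + t * (2 * b + c * t) by ring.
  rewrite ct => H1.
  have : t * (2 * b + (- (a + 1 + 2 * B) + c)) <= 1 * (2 * b + (- (a + 1 + 2 * B) + c)).
    by rewrite ler_wnM2r //; lra.
  lra.
have [c00|cp] := eqVneq c 0.
  rewrite c00 mulr0 in H *.
  have [->|bn] := eqVneq b 0; first by rewrite expr0n.
  have := H (- (a + 1) / (2 * b)).
  rewrite mul0r addr0 [_ * (_ / _)](_ : _ = - (a + 1)); first lra.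
  by field.
have cp' : 0 < c by rewrite lt_def cp.
have := H (- b / c).
have -> : a + 2 * b * (- b / c) + c * (- b / c) ^+ 2 = (a * c - b ^+ 2) / c.
  by field.
by rewrite pmulr_lge0 ?invr_gt0 // subr_ge0.
Qed.

Lemma dot_CS n (u v : 'rV[R]_n) : dot u v ^+ 2 <= dot u u * dot v v.
Proof.
apply: discr_le => t.
have := dot_ge0 (u + t *: v); rewrite dotDl !dotDr !dotZl !dotZr (dotC v u).
by set a := dot u u; set d := dot u v; set e := dot v v => ?;
  rewrite (_ : _ + _ = a + t * d + (t * d + t * (t * e))) //; ring.
Qed.

Lemma sqr_entry_le n (u : 'rV[R]_n) j : u 0 j ^+ 2 <= dot u u.
Proof.
rewrite /dot (bigD1 j) //= -expr2 lerDl.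
by apply: sumr_ge0 => i _; rewrite -expr2 sqr_ge0.
Qed.

Lemma entry_le n (u : 'rV[R]_n) b j : dot u u <= b -> `|u 0 j| <= 1 + b.
Proof.
move=> ub; have u0 := dot_ge0 u; have b1 : 0 <= 1 + b by lra.
rewrite -(ler_pXn2r (n := 2)) // ?nnegrE // real_normK ?num_real //.
apply: le_trans (sqr_entry_le u j) (le_trans ub _).
by have := sqr_ge0 b; rewrite sqrrD expr1n; lra.
Qed.

End Dot.

Section Spectral.
Context (R : realType).

Lemma trmx_delta_dot n (i : 'I_n) (u : 'rV[R]_n) : dot (delta_mx 0 i) u = u 0 i.
Proof.
rewrite /dot (bigD1 i) //= mxE !eqxx mul1r big1 ?addr0 // => j ji.
by rewrite mxE eqxx (negbTE ji) mul0r.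
Qed.

(** The reflection in the hyperplane orthogonal to e - u. *)
Lemma householder n (u e : 'rV[R]_n) : dot u u = 1 -> dot e e = 1 ->
  exists H : 'M[R]_n, [/\ H^T = H, H *m H = 1%:M & e *m H = u].
Proof.
move=> u1 e1; have [->|ne] := eqVneq e u.
  by exists 1%:M; rewrite trmx1 !mulmx1.
pose w := e - u; pose k := 2 / dot w w.
have w0 : dot w w != 0 by rewrite dot_eq0 subr_eq0.
exists (1%:M - k *: (w^T *m w)); split.
- by rewrite linearB linearZ /= trmx1 trmx_mul trmxK.
- set M := w^T *m w.
  have ww : M *m M = dot w w *: M.
    by rewrite mulmxA -(mulmxA w^T) mulmx_dot mul_mx_scalar -scalemxAl.
  rewrite mulmxBl mul1mx mulmxBr mulmx1.
  rewrite -scalemxAl -scalemxAr ww.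
  rewrite !scalerA (_ : k * k * dot w w = k *+ 2); last first.
    by rewrite /k -mulr_natr; field.
  rewrite mulr2n scalerDl opprB [_ + _ - _]addrK.
  by rewrite subrK.
- rewrite mulmxBr mulmx1 -scalemxAr mulmxA mulmx_dot mul_scalar_mx scalerA.
  have ew : dot w w = 2 * dot e w.
    by rewrite /w dotBl !dotBr u1 e1 (dotC u e); ring.
  have ew0 : dot e w != 0 by apply: contra_neq w0 => h; rewrite ew h mulr0.
  rewrite (_ : k * _ = 1) ?scale1r; last by rewrite /k ew; field.
  by rewrite /w opprB addrCA subrr addr0.
Qed.

(** An eigenvector v over the complex closure exists; comparing v S v^* with
    its conjugate shows that the eigenvalue is real, hence a root of the real
    characteristic polynomial. *)
Lemma sym_eigenvector n (S : 'M[R]_n.+1) : S^T = S ->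
  exists (x : R) (u : 'rV[R]_n.+1), dot u u = 1 /\ u *m S = x *: u.
Proof.
move=> sS; pose C : numClosedFieldType := complex.complex R.
pose f : {rmorphism R -> C} := complex.real_complex R.
have [z] := @spectral.eigenvalue_closed C _ (map_mx f S) isT.
case/eigenvalueP => v Ev v0.
have n2 (u : 'rV[C]_n.+1) :
    (u *m (map_mx Num.conj u)^T) 0 0 = \sum_i `|u 0 i| ^+ 2.
  by rewrite mxE; apply: eq_bigr => i _; rewrite !mxE normCK.
have v2 : (v *m (map_mx Num.conj v)^T) 0 0 != 0.
  rewrite n2; apply: contra v0.
  rewrite psumr_eq0 => [/allP v0|i _]; last by rewrite exprn_ge0.
  apply/eqP/rowP=> i; have := v0 i (mem_index_enum _).
  by rewrite /= expf_eq0 /= normr_eq0 mxE => /eqP.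
have cS : map_mx Num.conj (map_mx f S) = map_mx f S.
  apply/matrixP=> i j; rewrite !mxE.
  by apply/CrealP/complex.complex_realP; eexists.
have zr : z \is Num.real.
  apply/CrealP/(mulIf v2).
  have := congr1 (fun M : 'M[C]_1 => M 0 0) (congr1 (mulmx^~ (map_mx Num.conj v)^T) Ev).
  rewrite /= -scalemxAl [X in _ = X]mxE => <-.
  have -> : (v *m map_mx f S) *m (map_mx Num.conj v)^T =
      v *m (map_mx Num.conj (v *m map_mx f S))^T.
    have fT : (map_mx f S)^T = map_mx f S by rewrite map_trmx sS.
    by rewrite map_mxM cS trmx_mul fT mulmxA.
  by rewrite Ev map_mxZ linearZ /= -scalemxAr [in RHS]mxE.
have /complex.complex_realP[x Ex] := zr.
have rx : root (char_poly S) x.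
  rewrite -(fmorph_root f) map_char_poly -eigenvalue_root_char.
  by apply/eigenvalueP; exists v; rewrite // Ev Ex.
move: rx; rewrite -eigenvalue_root_char => /eigenvalueP [u Eu u0].
have u2 : 0 < dot u u by rewrite lt_def dot_ge0 dot_eq0 u0.
exists x, ((Num.sqrt (dot u u))^-1 *: u); split.
  rewrite dotZl dotZr mulrA -expr2 exprVn sqr_sqrtr ?ltW // mulVf //.
  by rewrite gt_eqF.
by rewrite -scalemxAl Eu scalerA mulrC -scalerA.
Qed.

(** Induction on the dimension: a reflection moves a unit eigenvector to the
    first basis vector, and in the new basis the matrix is a scalar next to a
    smaller symmetric block. *)
Lemma spectral_real n (S : 'M[R]_n) : S^T = S ->
  exists (V : 'M[R]_n) (d : 'rV[R]_n), V *m V^T = 1%:M /\ S = V^T *m diag_mx d *m V.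
Proof.
elim: n S => [|n IH] S sS.
  by exists 0, 0; split; apply/matrixP => -[].
have [x [u [u1 Eu]]] := sym_eigenvector sS.
pose e : 'rV[R]_n.+1 := delta_mx 0 0.
have e1 : dot e e = 1 by rewrite trmx_delta_dot mxE !eqxx.
have [H [sH HH eH]] := householder u1 e1.
have [T defT] : exists T : 'M[R]_(1 + n), T = H *m S *m H by eexists.
have sT : T^T = T by rewrite defT !trmx_mul sH sS mulmxA.
have eT : e *m T = x *: e.
  by rewrite defT !mulmxA eH Eu -scalemxAl -eH -mulmxA HH mulmx1.
have T0 j : T 0 j = x * (j == 0)%:R.
  have := congr1 (fun M : 'rV_(1 + n) => M 0 j) eT.
  by rewrite /e -rowE !mxE eqxx /=.
have TB : T = block_mx x%:M 0 0 (drsubmx T).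
  rewrite -[LHS]submxK; congr block_mx.
  - by apply/matrixP => i j; rewrite !ord1 !mxE lshift0 T0 mulr1n mulr1.
  - by apply/matrixP => i j; rewrite !ord1 !mxE lshift0 T0 mulr0.
  - apply/matrixP => i j; rewrite !ord1 -sT !mxE lshift0 T0.
    by rewrite mulr0.
have sT' : (drsubmx T)^T = drsubmx T by rewrite trmx_drsub sT.
have [V [d [VV ET]]] := IH _ sT'.
pose B : 'M[R]_(1 + n) := block_mx 1%:M 0 0 V.
pose D : 'rV[R]_(1 + n) := row_mx x%:M d.
have BB : B *m B^T = 1%:M.
  rewrite /B tr_block_mx mulmx_block !trmx0 trmx1 !mulmx0 !mul0mx VV.
  by rewrite mulmx1 !addr0 add0r -scalar_mx_block.
have TE : T = B^T *m diag_mx D *m B.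
  have -> : diag_mx D = block_mx x%:M 0 0 (diag_mx d).
    apply/matrixP => i j; rewrite !mxE.
    case: splitP => i' Ei; rewrite !mxE; case: splitP => j' Ej; rewrite !mxE.
    - by rewrite (_ : i = j) ?eqxx ?ord1 //; apply/val_inj; rewrite /= Ei Ej !ord1.
    - by rewrite (_ : (i == j) = false) // -val_eqE /= Ei Ej !ord1.
    - by rewrite (_ : (i == j) = false) // -val_eqE /= Ei Ej !ord1.
    - by rewrite (_ : (i == j) = (i' == j')) // -!val_eqE /= Ei Ej eqn_add2l.
  rewrite TB ET /B tr_block_mx !mulmx_block !trmx0 trmx1 !mulmx0 !mul0mx.
  by rewrite !(addr0, add0r, mul0mx, mulmx1, mul1mx).
have SE : S = H *m T *m H.
  by rewrite defT !mulmxA HH mul1mx -mulmxA HH mulmx1.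
exists ((B : 'M[R]_n.+1) *m H), D; split.
  by rewrite trmx_mul sH mulmxA -(mulmxA (B : 'M[R]_n.+1)) HH mulmx1.
by rewrite SE TE trmx_mul sH !mulmxA.
Qed.

End Spectral.

(** * Traces of powers of symmetric matrices *)

Section TracePowers.
Context (R : realType).

Definition above n (c : R) (A : 'M[R]_n) :=
  A^T = A /\ forall u : 'rV[R]_n, c * dot u u <= dot (u *m A) u.

(** Convexity of the power: it lies above its tangent at b. *)
Lemma tangent_pow (a b : R) q : 0 <= a -> 0 <= b ->
  b ^+ q.+1 + q.+1%:R * (a - b) * b ^+ q <= a ^+ q.+1.
Proof.
move=> a0 b0; elim: q => [|q IH]; first by rewrite !expr1 expr0; lra.
rewrite -subr_ge0.
have h1 : 0 <= a * (a ^+ q.+1 - (b ^+ q.+1 + q.+1%:R * (a - b) * b ^+ q)).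
  by rewrite mulr_ge0 // subr_ge0.
have h2 : 0 <= q.+1%:R * (a - b) ^+ 2 * b ^+ q.
  by apply: mulr_ge0; [apply: mulr_ge0; [exact: ler0n|exact: sqr_ge0]|exact: exprn_ge0].
have := addr_ge0 h1 h2; congr (0 <= _).
by rewrite !exprS; ring.
Qed.

Lemma rearrange_pow (a b : R) l k : 0 <= a -> 0 <= b ->
  a ^+ l * b ^+ k + b ^+ l * a ^+ k <= a ^+ (l + k) + b ^+ (l + k).
Proof.
wlog ab : a b / a <= b => [H a0 b0|a0 b0].
  have [/H|/ltW /H] := leP a b; first exact.
  by move=> /(_ b0 a0); rewrite addrC [leRHS]addrC.
rewrite -subr_ge0 !exprD.
have -> : a ^+ l * a ^+ k + b ^+ l * b ^+ k - (a ^+ l * b ^+ k + b ^+ l * a ^+ k)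
  = (b ^+ l - a ^+ l) * (b ^+ k - a ^+ k) by ring.
by rewrite mulr_ge0 // subr_ge0 lerXn2r.
Qed.

Lemma spec_pow n (V : 'M[R]_n) (d : 'rV[R]_n) q : V *m V^T = 1%:M ->
  (V^T *m diag_mx d *m V) ^+ q = V^T *m diag_mx (\row_i d 0 i ^+ q) *m V.
Proof.
move=> VV; elim: q => [|q IH].
  rewrite expr0 (_ : diag_mx _ = 1%:M) ?mulmx1 ?(mulmx1C VV) //.
  by apply/matrixP => i j; rewrite !mxE expr0.
rewrite exprSr IH -mulmxE !mulmxA -(mulmxA _ V V^T) VV mulmx1.
congr (_ *m _); rewrite -!mulmxA; congr (_ *m _).
apply/matrixP => i j; rewrite mul_diag_mx !mxE exprSr.
by rewrite mulrnAr.
Qed.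

(** The weights (V W^T)_ij^2 do not depend on the spectra, so an inequality
    between scalars can be integrated into one between traces. *)
Lemma tr_spec2 n (V W : 'M[R]_n) (x y : 'rV[R]_n) :
  \tr ((V^T *m diag_mx x *m V) *m (W^T *m diag_mx y *m W)) =
  \sum_i \sum_j x 0 i * y 0 j * (V *m W^T) i j ^+ 2.
Proof.
rewrite -!mulmxA mxtrace_mulC -!mulmxA.
have -> : diag_mx x *m (V *m (W^T *m (diag_mx y *m (W *m V^T)))) =
  (diag_mx x *m (V *m W^T)) *m (diag_mx y *m (V *m W^T)^T).
  by rewrite trmx_mul trmxK !mulmxA.
rewrite /mxtrace; apply: eq_bigr => i _; rewrite mxE; apply: eq_bigr => j _.
rewrite !mul_diag_mx; set M := V *m W^T; rewrite !mxE -/M.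
by ring.
Qed.

Lemma spec_quad n (V : 'M[R]_n) (d : 'rV[R]_n) (z : 'rV[R]_n) :
  dot (z *m (V^T *m diag_mx d *m V)) z = \sum_i d 0 i * (z *m V^T) 0 i ^+ 2.
Proof.
rewrite !mulmxA dot_mulmx /dot; apply: eq_bigr => i _.
by rewrite mul_mx_diag [in LHS]mxE; ring.
Qed.

Lemma dot_orth n (V : 'M[R]_n) (z : 'rV[R]_n) : V *m V^T = 1%:M ->
  dot z z = \sum_i (z *m V^T) 0 i ^+ 2.
Proof.
move=> VV; have := spec_quad V (const_mx 1) z.
rewrite (_ : diag_mx _ = 1%:M); last first.
  by apply/matrixP => i j; rewrite !mxE.
rewrite mulmx1 (mulmx1C VV) mulmx1 => ->.
by apply: eq_bigr => i _; rewrite mxE mul1r.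
Qed.

Lemma spec_above n c (A : 'M[R]_n) : above c A ->
  exists (V : 'M[R]_n) (d : 'rV[R]_n),
   [/\ V *m V^T = 1%:M, A = V^T *m diag_mx d *m V & forall i, c <= d 0 i].
Proof.
move=> [sA cA]; have [V [d [VV EA]]] := spectral_real sA.
exists V, d; split=> // i; pose ei : 'rV[R]_n := delta_mx 0 i.
have := cA (ei *m V); have e : ei *m V *m V^T = ei by rewrite -mulmxA VV mulmx1.
rewrite EA spec_quad (dot_orth _ VV) e (bigD1 i) //= [X in _ <= X](bigD1 i) //=.
rewrite mxE !eqxx expr1n !mulr1 !big1 ?addr0 ?mulr1 //.
  by move=> j ji; rewrite mxE eqxx (negbTE ji) expr0n mulr0.
by move=> j ji; rewrite mxE eqxx (negbTE ji) expr0n.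
Qed.

(** Klein's inequality for a power: written in the eigenbases of A and B, it is
    a combination with nonnegative weights of scalar tangent inequalities. *)
Lemma klein_pow n (A B : 'M[R]_n) q : above 0 A -> above 0 B ->
  \tr (B ^+ q.+1) + q.+1%:R * \tr ((A - B) *m B ^+ q) <= \tr (A ^+ q.+1).
Proof.
move=> /spec_above[V [a [VV -> a0]]] /spec_above[W [b [WW -> b0]]].
set A' := V^T *m diag_mx a *m V; set B' := W^T *m diag_mx b *m W.
pose one : 'rV[R]_n := const_mx 1.
have done_ : diag_mx one = 1%:M by apply/matrixP => i j; rewrite !mxE.
have V1 : V^T *m diag_mx one *m V = 1%:M.
  by rewrite done_ mulmx1 (mulmx1C VV).
have W1 : W^T *m diag_mx one *m W = 1%:M.
  by rewrite done_ mulmx1 (mulmx1C WW).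
rewrite mulmxBl linearB /= mulmxE -exprS.
have -> : \tr (A' ^+ q.+1) = \tr (A' ^+ q.+1 *m (W^T *m diag_mx one *m W)).
  by rewrite W1 mulmx1.
have -> : \tr (B' ^+ q.+1) = \tr ((V^T *m diag_mx one *m V) *m B' ^+ q.+1).
  by rewrite V1 mul1mx.
rewrite -mulmxE /A' /B' !spec_pow // !tr_spec2 -sumrB mulr_sumr -big_split /=.
apply: ler_sum => i _; rewrite -sumrB mulr_sumr -big_split /=.
apply: ler_sum => j _; rewrite !mxE !mul1r !mulr1.
set m := (_ ^+ 2); have m0 : 0 <= m by exact: sqr_ge0.
have := ler_wpM2r m0 (tangent_pow q (a0 i) (b0 j)).
rewrite mulrDl; congr (_ + _ <= _).
by rewrite exprS; ring.
Qed.

Section RankOne.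
Context (n : nat) (A : 'M[R]_n) (z : 'rV[R]_n).
Let B := A - z^T *m z.
Let a j := dot (z *m A ^+ j) z.
Let b j := dot (z *m B ^+ j) z.

Lemma above_moment0 c (M : 'M[R]_n) (u : 'rV[R]_n) j : 0 <= c -> above c M ->
  0 <= dot (u *m M ^+ j) u.
Proof.
move=> c0 /spec_above[V [d [VV -> d0]]]; rewrite spec_pow // spec_quad.
apply: sumr_ge0 => i _; rewrite mxE mulr_ge0 ?sqr_ge0 ?exprn_ge0 //.
exact: le_trans (d0 i).
Qed.

Lemma above_momentS c (M : 'M[R]_n) (u : 'rV[R]_n) j : 0 <= c -> above c M ->
  c * dot (u *m M ^+ j) u <= dot (u *m M ^+ j.+1) u.
Proof.
move=> c0 /spec_above[V [d [VV -> d0]]]; rewrite !spec_pow // !spec_quad.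
rewrite mulr_sumr ler_sum // => i _; rewrite !mxE mulrA ler_wpM2r ?sqr_ge0 //.
by rewrite exprS ler_wpM2r ?exprn_ge0 // (le_trans c0).
Qed.

(** Chebyshev's sum inequality for the spectral measure of u: nonnegative powers
    are similarly ordered, hence positively correlated. *)
Lemma moment_cheb c (M : 'M[R]_n) (u : 'rV[R]_n) l k : 0 <= c -> above c M ->
  dot (u *m M ^+ l) u * dot (u *m M ^+ k) u <= dot u u * dot (u *m M ^+ (l + k)) u.
Proof.
move=> c0 /spec_above[V [d [VV -> d0]]]; rewrite !spec_pow // !spec_quad.
rewrite (dot_orth _ VV).
under eq_bigr do rewrite mxE; under [X in _ * X <= _]eq_bigr do rewrite mxE.
under [X in _ <= _ * X]eq_bigr do rewrite mxE.
pose y i := (u *m V^T) 0 i ^+ 2.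
have y0 i : 0 <= y i by exact: sqr_ge0.
pose D i := d 0 i; have D0 i : 0 <= D i by exact: le_trans (d0 i).
pose S l k := \sum_i \sum_j (y i * y j) * (D i ^+ l * D j ^+ k).
have E l' k' : (\sum_i D i ^+ l' * y i) * (\sum_i D i ^+ k' * y i) = S l' k'.
  rewrite mulr_suml; apply: eq_bigr => i _; rewrite mulr_sumr.
  by apply: eq_bigr => j _; ring.
have sw l' k' : S l' k' = S k' l'.
  rewrite /S exchange_big /=; apply: eq_bigr => i _; apply: eq_bigr => j _; ring.
have -> : \sum_i (u *m V^T) 0 i ^+ 2 = \sum_i D i ^+ 0 * y i.
  by apply: eq_bigr => i _; rewrite expr0 mul1r.
rewrite !E.
suff : S l k + S k l <= S 0 (l + k)%N + S (l + k)%N 0.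
  by rewrite (sw k l) (sw (l + k)%N); lra.
rewrite /S -!big_split; apply: ler_sum => i _; rewrite -!big_split.
apply: ler_sum => j _ /=; rewrite -!mulrDr ler_wpM2l ?(mulr_ge0 (y0 i) (y0 j)) //.
rewrite !expr0 mul1r mulr1 [leRHS]addrC (mulrC (D i ^+ k)).
exact: rearrange_pow.
Qed.

(** Telescoping expansion of the powers of B = A - z^T z; the coefficients are
    again moments of B. *)
Lemma rank_one_moment m :
  z *m B ^+ m = z *m A ^+ m - \sum_(l < m) b l *: (z *m A ^+ (m - 1 - l)).
Proof.
elim: m => [|m IH]; first by rewrite !expr0 big_ord0 subr0.
rewrite exprSr -mulmxE mulmxA {2}/B mulmxBr.
have -> : z *m B ^+ m *m (z^T *m z) = b m *: z.
  by rewrite mulmxA mulmx_dot mul_scalar_mx.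
rewrite IH mulmxBl big_ord_recr /= !subn1 /= subnn expr0 mulmx1 opprD addrA.
congr (_ - _ - _); first by rewrite exprSr -mulmxE mulmxA.
rewrite mulmx_suml; apply: eq_bigr => l _.
rewrite -scalemxAl -mulmxA mulmxE -exprSr; congr (_ *: (_ *m _ ^+ _)).
by have lm := ltn_ord l; rewrite -subSn ?prednK ?(leq_ltn_trans _ lm) // -ltnS prednK ?(leq_ltn_trans _ lm).
Qed.

Context (c : R) (c0 : 0 < c) (cA : above c A) (cB : above 0 B).

(** In the expansion of z B^m every moment b l is at most a l, the product of
    two moments is at most |z|^2 a (m-1) by [moment_cheb], and a (m-1) is at most
    a m / c because A is above c. *)
Lemma rank_one_moment_ge m : a m * (1 - m%:R * dot z z / c) <= b m.
Proof.
case: m => [|m]; first by rewrite mul0r mul0r subr0 mulr1 /a /b !expr0.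
have a_ge0 j : 0 <= a j by apply: above_moment0 cA; exact: ltW.
have b_ge0 j : 0 <= b j by exact: above_moment0 cB.
have ba j : b j <= a j.
  rewrite /b rank_one_moment dotBl lerBlDr lerDl dotC dot_sumr sumr_ge0 // => l _.
  by rewrite dotC dotZl; exact: (mulr_ge0 (b_ge0 _) (a_ge0 _)).
have -> : b m.+1 = a m.+1 - \sum_(l < m.+1) b l * a (m - l)%N.
  rewrite {1}/b rank_one_moment dotBl [in X in _ - X]dotC dot_sumr; congr (_ - _).
  by apply: eq_bigr => l _; rewrite dotC dotZl subn1.
rewrite mulrBr mulr1 lerB //.
apply: (@le_trans _ _ (\sum_(l < m.+1) dot z z * a m)).
  apply: ler_sum => l _; apply: (@le_trans _ _ (a l * a (m - l)%N)).
    by rewrite ler_wpM2r.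
  have := moment_cheb z l (m - l) (ltW c0) cA.
  by rewrite subnKC // -ltnS.
rewrite sumr_const card_ord.
have := above_momentS z m (ltW c0) cA; rewrite -/(a m) -/(a m.+1) => h.
rewrite [leRHS](_ : _ = m.+1%:R * dot z z * (a m.+1 / c)); last by ring.
rewrite -[leLHS]mulr_natl mulrA ler_wpM2l ?(mulr_ge0 (ler0n _ _) (dot_ge0 _)) //.
by rewrite ler_pdivlMr // mulrC.
Qed.

(** Klein's inequality bounds the loss of trace below by <z, B^q z>, a power of
    the smaller matrix; [rank_one_moment_ge] replaces it by the power of A, up to
    a relative error of order q |z|^2 / c. *)
Lemma tr_rank_one_pow q :
  \tr (B ^+ q.+1) + q.+1%:R * ((1 - q%:R * dot z z / c) * dot (z *m A ^+ q) z)
  <= \tr (A ^+ q.+1).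
Proof.
have A0 : above 0 A.
  case: cA => sA h; split=> // u; rewrite mul0r.
  by apply: le_trans (h u); rewrite mulr_ge0 ?dot_ge0 // ltW.
apply: le_trans (klein_pow q A0 cB).
rewrite lerD2l ler_wpM2l // opprB addrCA subrr addr0.
have -> : \tr (z^T *m z *m B ^+ q) = b q.
  by rewrite -mulmxA mxtrace_mulC /b dotE [\tr _]big_ord1.
by have := rank_one_moment_ge q; rewrite mulrC.
Qed.

End RankOne.

(** The gap h between t^(q+1) and its tangent at c is nonnegative and convex.
    The right side is the sum of h over the spectrum; keeping only the weights of
    u on the eigenvectors and applying Jensen's inequality leaves h (<A u, u>).
    Unlike the trace of A^(q+1), this bound is not weakened by the directions in
    which A equals c, so the dimension does not enter. *)
Lemma tr_pow_gap n (A : 'M[R]_n) (c al : R) q (u : 'rV[R]_n) :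
  above 0 A -> 0 <= c -> dot u u = 1 ->
  al = dot (u *m A) u ->
  al ^+ q.+1 - c ^+ q.+1 - q.+1%:R * c ^+ q * (al - c) <=
  \tr (A ^+ q.+1) - n%:R * c ^+ q.+1 - q.+1%:R * c ^+ q * (\tr A - n%:R * c).
Proof.
move=> /[dup] A0 /spec_above[V [a [VV EA a0]]] c0 u1 alD.
pose h t := t ^+ q.+1 - c ^+ q.+1 - q.+1%:R * c ^+ q * (t - c).
have h0 t : 0 <= t -> 0 <= h t.
  by move=> t0; have := tangent_pow q t0 c0; rewrite /h; lra.
pose y i := (u *m V^T) 0 i ^+ 2.
have y0 i : 0 <= y i by exact: sqr_ge0.
have y1 : \sum_i y i = 1 by rewrite -u1 (dot_orth _ VV).
have alE : al = \sum_i a 0 i * y i by rewrite alD EA spec_quad.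
have al0 : 0 <= al by rewrite alE sumr_ge0 // => i _; rewrite mulr_ge0.
have trP p : \tr (A ^+ p) = \sum_i a 0 i ^+ p.
  rewrite EA spec_pow // -mulmxA mxtrace_mulC -mulmxA VV mulmx1 mxtrace_diag.
  by apply: eq_bigr => i _; rewrite mxE.
have -> : \tr (A ^+ q.+1) - n%:R * c ^+ q.+1 -
    q.+1%:R * c ^+ q * (\tr A - n%:R * c) = \sum_i h (a 0 i).
  rewrite trP -[in \tr A](expr1 A) trP /h !sumrB -mulr_sumr sumrB.
  rewrite !sumr_const card_ord.
  rewrite -[c ^+ q.+1 *+ n]mulr_natl -[c *+ n]mulr_natl.
  by congr (_ - _ * (_ - _)); apply: eq_bigr => i _; rewrite expr1.
apply: (@le_trans _ _ (\sum_i y i * h (a 0 i))); last first.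
  apply: ler_sum => i _; rewrite -[leRHS]mul1r ler_wpM2r ?h0 //.
  by rewrite -y1 (bigD1 i) //= lerDl sumr_ge0.
have -> : al ^+ q.+1 - c ^+ q.+1 - q.+1%:R * c ^+ q * (al - c) =
  \sum_i y i * (h al + (q.+1%:R * al ^+ q - q.+1%:R * c ^+ q) * (a 0 i - al)).
  under eq_bigr do rewrite mulrDr.
  rewrite big_split /= -mulr_suml y1 mul1r -[LHS]addr0; congr (_ + _).
  under eq_bigr do rewrite mulrCA.
  rewrite -mulr_sumr; under eq_bigr do rewrite mulrBr (mulrC (y _)) .
  by rewrite sumrB -alE -mulr_suml y1 mul1r subrr mulr0.
apply: ler_sum => i _; rewrite ler_wpM2l //.
have := tangent_pow q (a0 i) al0; rewrite /h; lra.
Qed.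

End TracePowers.

(** * Schatten norms *)

Section Schatten.
Context (R : realType).

Lemma char_poly_spec n (V : 'M[R]_n) (d : 'rV[R]_n) : V *m V^T = 1%:M ->
  char_poly (V^T *m diag_mx d *m V) = \prod_i ('X - (d 0 i)%:P).
Proof.
move=> VV; transitivity (char_poly (diag_mx d)); last first.
  rewrite char_poly_trig ?diag_mx_is_trig //.
  by apply: eq_bigr => i _; rewrite mxE eqxx mulr1n.
rewrite /char_poly; pose P := map_mx polyC V.
have PP : P^T *m P = 1%:M.
  by rewrite /P map_trmx -map_mxM (mulmx1C VV) map_mx1.
have -> : char_poly_mx (V^T *m diag_mx d *m V) = P^T *m char_poly_mx (diag_mx d) *m P.
  rewrite /char_poly_mx mulmxBr mulmxBl !map_mxM /= map_trmx; congr (_ - _).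
  by rewrite mul_mx_scalar -scalemxAl -map_trmx PP scalemx1.
by rewrite !det_mulmx [LHS]mulrC mulrA -det_mulmx (mulmx1C PP) det1 mul1r.
Qed.

(** The Gram eigenvalues are only specified through the characteristic
    polynomial, which determines them up to a permutation. *)
Lemma singular_values_sum m T (A : 'M[R]_(m, T)) (f : R -> R)
    (V : 'M[R]_T) (d : 'rV[R]_T) : V *m V^T = 1%:M ->
  A^T *m A = V^T *m diag_mx d *m V ->
  \sum_(s <- singular_values A) f s = \sum_i f (Num.sqrt (d 0 i)).
Proof.
move=> VV EA; rewrite big_map.
have [Eg _] := gram_eigenvaluesP A.
have pe : perm_eq (gram_eigenvalues A) [seq d 0 i | i <- enum 'I_T].
  apply: prod_XsubC_eq.
  by rewrite -Eg EA char_poly_spec // big_map big_enum.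
by rewrite (perm_big _ pe) big_map big_enum.
Qed.

Lemma gram_spec m T (A : 'M[R]_(m, T)) : exists (V : 'M[R]_T) (d : 'rV[R]_T),
  [/\ V *m V^T = 1%:M, A^T *m A = V^T *m diag_mx d *m V & forall i, 0 <= d 0 i].
Proof.
apply: spec_above; split; first by rewrite trmx_mul trmxK.
move=> u; rewrite mul0r.
by rewrite mulmxA dot_mulmx dot_ge0.
Qed.

Lemma schatten1E m T (A : 'M[R]_(m, T)) (V : 'M[R]_T) (d : 'rV[R]_T) :
  V *m V^T = 1%:M -> A^T *m A = V^T *m diag_mx d *m V ->
  schatten 1%:E A = \sum_i Num.sqrt (d 0 i).
Proof.
move=> VV EA; rewrite /schatten invr1 (singular_values_sum _ VV EA).
rewrite powRr1; last by apply: sumr_ge0 => i _; exact: powR_ge0.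
by apply: eq_bigr => i _; rewrite powRr1 // sqrtr_ge0.
Qed.

Lemma frobenius_spec m T (A : 'M[R]_(m, T)) (V : 'M[R]_T) (d : 'rV[R]_T) :
  V *m V^T = 1%:M -> A^T *m A = V^T *m diag_mx d *m V ->
  \tr (A^T *m A) = \sum_i d 0 i.
Proof.
by move=> VV ->; rewrite -mulmxA mxtrace_mulC -mulmxA VV mulmx1 mxtrace_diag.
Qed.

Lemma mx_inner_dot m T (A B : 'M[R]_(m, T)) :
  mx_inner A B = dot (mxvec A) (mxvec B).
Proof.
rewrite /mx_inner /dot /mxtrace (reindex _ (curry_mxvec_bij _ _)) /=.
transitivity (\sum_(p : 'I_m * 'I_T) A p.1 p.2 * B p.1 p.2); last first.
  by apply: eq_bigr => -[i j] _; rewrite /= !mxvecE.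
rewrite -(pair_bigA _ (fun i j => A i j * B i j)) exchange_big /=.
by apply: eq_bigr => j _; rewrite mxE; apply: eq_bigr => i _; rewrite mxE.
Qed.

Lemma schatten2E m T (A : 'M[R]_(m, T)) :
  schatten 2%:E A = Num.sqrt (mx_inner A A).
Proof.
have [V [d [VV EA d0]]] := gram_spec A.
rewrite /schatten (singular_values_sum _ VV EA) /mx_inner (frobenius_spec VV EA).
rewrite powR12_sqrt; last by apply: sumr_ge0 => i _; exact: powR_ge0.
congr Num.sqrt; apply: eq_bigr => i _.
by rewrite powR_mulrn ?sqrtr_ge0 // sqr_sqrtr.
Qed.

(** Half of the duality with the operator norm: U is the transposed partial
    isometry of the polar decomposition of A, and the bound on tr (U C) follows by
    writing the trace in an eigenbasis of C^T C. Convexity of the nuclear norm is a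
    consequence, since it makes the norm a maximum of linear forms. *)
Lemma nuclear_dual m T (A : 'M[R]_(m, T)) : exists U : 'M[R]_(T, m),
  \tr (U *m A) = schatten 1%:E A /\
  forall C : 'M[R]_(m, T), \tr (U *m C) <= schatten 1%:E C.
Proof.
have [V [d [VV EA d0]]] := gram_spec A.
pose W := V *m A^T; have WW : W *m W^T = diag_mx d.
  rewrite /W trmx_mul trmxK -mulmxA (mulmxA A^T) EA !mulmxA VV mul1mx.
  by rewrite -mulmxA VV mulmx1.
pose s := \row_i (Num.sqrt (d 0 i))^-1 : 'rV[R]_T.
exists (V^T *m diag_mx s *m W); split.
  rewrite (schatten1E VV EA) -!mulmxA mxtrace_mulC -!mulmxA.
  have -> : V *m (A^T *m (A *m V^T)) = diag_mx d by rewrite -WW /W trmx_mul trmxK !mulmxA.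
  rewrite mulmx_diag mxtrace_diag; apply: eq_bigr => i _; rewrite !mxE.
  have [->|n0] := eqVneq (d 0 i) 0; first by rewrite sqrtr0 invr0 mul0r.
  by rewrite -{2}[d 0 i]sqr_sqrtr // expr2 mulrA mulVf ?mul1r // sqrtr_eq0 -ltNge lt_def n0 d0.
move=> C; have [V' [d' [VV' EC d'0]]] := gram_spec C.
rewrite (schatten1E VV' EC); set U := V^T *m _ *m W.
have -> : \tr (U *m C) = \sum_j dot (row j V' *m U) (row j V' *m C^T).
  rewrite -[U *m C]mulmx1 -(mulmx1C VV') mulmxA mxtrace_mulC.
  rewrite /mxtrace; apply: eq_bigr => j _.
  transitivity (((V' *m U) *m (V' *m C^T)^T) j j).
    by rewrite trmx_mul trmxK !mulmxA.
  rewrite -!row_mul; set M := V' *m U; set M' := V' *m C^T.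
  by rewrite /dot [LHS]mxE; apply: eq_bigr => k _; rewrite !mxE.
apply: ler_sum => j _; apply: le_trans (ler_norm _) _; rewrite -sqrtr_sqr.
rewrite ler_sqrt // (le_trans (dot_CS _ _)) //.
have e1 : dot (row j V') (row j V') = 1.
  transitivity ((V' *m V'^T) j j); last by rewrite VV' mxE eqxx.
  by rewrite mxE; apply: eq_bigr => k _; rewrite !mxE.
have rowV (M : 'M[R]_T) (x : 'rV[R]_T) : M *m M^T = 1%:M ->
    dot (row j M *m (M^T *m diag_mx x *m M)) (row j M) = x 0 j.
  move=> MM; rewrite spec_quad -row_mul MM (bigD1 j) //= big1 => [|i ij].
    by rewrite !mxE eqxx expr1n mulr1 addr0.
  by rewrite !mxE eq_sym (negbTE ij) expr0n mulr0.
have -> : dot (row j V' *m C^T) (row j V' *m C^T) = d' 0 j.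
  by rewrite dot_mulmx trmxK -mulmxA EC dotC rowV.
rewrite -[leRHS]mul1r ler_wpM2r //.
set y := row j V' in e1 *; rewrite -e1 (dot_orth _ VV).
have -> : dot (y *m U) (y *m U) =
  dot (y *m (V^T *m diag_mx (\row_i (s 0 i ^+ 2 * d 0 i)) *m V)) y.
  rewrite dot_mulmx -mulmxA dotC; congr (dot (_ *m _) _).
  rewrite /U !trmx_mul trmxK tr_diag_mx -!mulmxA; congr (_ *m _).
  have WX k (X : 'M[R]_(T, k)) : V *m (A^T *m (A *m (V^T *m X))) = diag_mx d *m X.
    by rewrite -WW /W trmx_mul trmxK !mulmxA.
  rewrite WX trmxK !mulmxA; congr (_ *m _).
  apply/matrixP => i k; rewrite !mul_mx_diag !mxE.
  by have [->|] := eqVneq i k; rewrite ?mulr1n ?mulr0n ?mul0r // expr2; ring.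
rewrite spec_quad; apply: ler_sum => i _; rewrite -[leRHS]mul1r ler_wpM2r ?sqr_ge0 //.
rewrite !mxE exprVn sqr_sqrtr //.
have [->|n0] := eqVneq (d 0 i) 0; first by rewrite mulr0.
by rewrite mulVf.
Qed.

Lemma schatten1_ge0 m T (A : 'M[R]_(m, T)) : 0 <= schatten 1%:E A.
Proof.
have [V [d [VV EA d0]]] := gram_spec A.
by rewrite (schatten1E VV EA) sumr_ge0 // => i _; exact: sqrtr_ge0.
Qed.

Lemma schatten1_convex m T (A B : 'M[R]_(m, T)) s t : 0 <= s -> 0 <= t ->
  schatten 1%:E (s *: A + t *: B) <= s * schatten 1%:E A + t * schatten 1%:E B.
Proof.
move=> s0 t0; have [U [<- UC]] := nuclear_dual (s *: A + t *: B).
by rewrite mulmxDr -!scalemxAr linearD !linearZ /= lerD // ler_wpM2l.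
Qed.

Lemma schatten1_0 m T : schatten 1%:E (0 : 'M[R]_(m, T)) = 0.
Proof.
apply/eqP; rewrite eq_le schatten1_ge0 andbT.
by have := schatten1_convex (0 : 'M[R]_(m, T)) 0 (lexx 0) (lexx 0);
  rewrite !scale0r !mul0r !addr0.
Qed.

(** A sum of squares of nonnegative numbers is at most the square of the sum. *)
Lemma frobenius_le_schatten1 m T (A : 'M[R]_(m, T)) :
  mx_inner A A <= schatten 1%:E A ^+ 2.
Proof.
have [V [d [VV EA d0]]] := gram_spec A.
rewrite (schatten1E VV EA) /mx_inner (frobenius_spec VV EA) expr2 mulr_suml.
apply: ler_sum => i _; rewrite -{1}[d 0 i]sqr_sqrtr // expr2.
by rewrite ler_wpM2l ?sqrtr_ge0 // (bigD1 i) //= lerDl sumr_ge0.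
Qed.

End Schatten.

(** * The deterministic oracle inequality *)

Section QuadraticRisk.
Context (R : realType) (D : nat).
Implicit Types (v a b u : 'rV[R]_D) (S : 'M[R]_D).

(** The squared risk of the linear predictor a with rho = E y^2, v = E y x and
    S = E x^T x. The population and the empirical risk are both of this form. *)
Definition qrisk (rho : R) v S a := rho - 2 * dot v a + dot (a *m S) a.

Lemma dot_symmx S a b : S^T = S -> dot (a *m S) b = dot (b *m S) a.
Proof. by move=> sS; rewrite dot_mulmx sS dotC. Qed.

Lemma qriskD rho v S b u : S^T = S ->
  qrisk rho v S (b + u) = qrisk rho v S b - 2 * dot (v - b *m S) u + dot (u *m S) u.
Proof.
move=> sS; rewrite /qrisk mulmxDl !dotDl !dotDr dotNl (dot_symmx u b sS); ring.
Qed.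

(** Nonnegativity of the risk on the line through b with direction u. *)
Lemma qrisk_signal rho v S b u : S^T = S -> (forall a, 0 <= qrisk rho v S a) ->
  dot (v - b *m S) u ^+ 2 <= qrisk rho v S b * dot (u *m S) u.
Proof.
move=> sS q0; apply: discr_le => t.
have := q0 (b + - t *: u); rewrite qriskD // dotZr -scalemxAl dotZl dotZr.
by congr (0 <= _); ring.
Qed.

Lemma qrisk_midpoint rho v S a b : S^T = S ->
  qrisk rho v S (2^-1 *: a + 2^-1 *: b) =
  (qrisk rho v S a + qrisk rho v S b) / 2 - dot ((a - b) *m S) (a - b) / 4.
Proof.
move=> sS; rewrite /qrisk !mulmxDl mulNmx -!scalemxAl !dotDl !dotDr !dotNl !dotNr.
rewrite !dotZl !dotZr (dot_symmx b a sS); by field.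
Qed.

End QuadraticRisk.

Section Oracle.
Context (R : realType) (D n : nat) (N : 'rV[R]_D -> R).
Context (rho : R) (v : 'rV[R]_D) (S : 'M[R]_D).
Context (rhon : R) (vn : 'rV[R]_D) (Sn : 'M[R]_D).
Context (lam zeta tau nu cap Fs : R) (ah a0 : 'rV[R]_D) (B : nat -> 'rV[R]_D).
Let q := qrisk rho v S.
Let qn := qrisk rhon vn Sn.
Let e a := q a + lam * N a - Fs.
Let del : R := 34^-1.
Let r := N a0.

(** The probabilistic estimates enter as hypotheses: REL is a lower bound for the
    empirical covariance, NOISE a bound for the gradient of the estimation error at
    fixed comparators, and NOISEB adds a comparison of the comparators between
    themselves. Here e is the excess penalized risk, a0 is nearly optimal and
    r = N a0.

    Comparing ah with a0 bounds e ah by lam / 34 * (1 + N ah + r), up to a constant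
    factor. This gives the claim unless r is much larger than 1 + N ah, and in the
    latter case e ah <= lam r / 16. Then ah is compared with B k, a point of nearly minimal norm
    among those whose excess is at most (k + 1) lam, for the integer k below
    e ah / lam. As N (B k) <= N ah + 1, the error terms are now of the order of
    lam (1 + N ah) only. The points B k do not depend on the sample and k < n, so
    the probabilistic estimates are needed for finitely many fixed points. *)
Lemma oracle_deterministic :
  S^T = S -> Sn^T = Sn -> (forall u, 0 <= dot (u *m S) u) ->
  (forall a, 0 <= N a) ->
  (forall a, dot a a <= N a ^+ 2) ->
  (forall a b, N (2^-1 *: a + 2^-1 *: b) <= (N a + N b) / 2) ->
  0 < lam -> zeta <= del * lam -> 0 <= tau -> 0 <= nu ->
  (forall a, Fs <= q a + lam * N a) ->
  e a0 <= zeta ->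
  (forall b, qn ah + lam * N ah <= qn b + lam * N b) ->
  (forall k, e (B k) <= k.+1%:R * lam) ->
  (forall k a, e a <= k.+1%:R * lam -> e a <= cap -> N (B k) <= N a + 1) ->
  lam * r <= cap -> r <= n%:R ->
  (forall u, 15 / 16 * dot (u *m S) u <= dot (u *m Sn) u + tau * dot u u) ->
  (forall u, `|2 * dot ((v - a0 *m S) - (vn - a0 *m Sn)) u| <= nu * Num.sqrt (dot u u)) ->
  (forall k, (k < n)%N -> 16 < r -> N (B k) <= r / 16 ->
    (forall u, `|2 * dot ((v - B k *m S) - (vn - B k *m Sn)) u| <= nu * Num.sqrt (dot u u))
    /\ (q (B k) - qn (B k)) - (q a0 - qn a0) <=
         dot ((B k - a0) *m S) (B k - a0) / 16 + del * lam) ->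
  tau * (N ah + r) + nu <= del * lam ->
  q ah <= Fs + lam.
Proof.
move=> sS sSn S0 N0 N2 Nmid lam0 zetal tau0 nu0 Fs_le e0 ah_min eB NB lamr rn REL NOISE0 NOISEB size.
have e_ge0 a : 0 <= e a by rewrite subr_ge0.
have delE : del = 1 / 34 by rewrite div1r.
(* Strong convexity: the midpoint has nonnegative excess. *)
have conv a b : dot ((a - b) *m S) (a - b) <= 2 * (e a + e b).
  have := Fs_le (2^-1 *: a + 2^-1 *: b); rewrite /q qrisk_midpoint // -/q.
  have := ler_wpM2l (ltW lam0) (Nmid a b); rewrite /e -/q; lra.
have dN a b : Num.sqrt (dot (a - b) (a - b)) <= N a + N b.
  have tri : Num.sqrt (dot (a - b) (a - b)) <= Num.sqrt (dot a a) + Num.sqrt (dot b b).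
    rewrite -(ler_pXn2r (n := 2)) // ?nnegrE ?addr_ge0 ?sqrtr_ge0 //.
    rewrite sqrrD !sqr_sqrtr ?dot_ge0 // dotBl !dotBr (dotC b a).
    have h : - dot a b <= Num.sqrt (dot a a) * Num.sqrt (dot b b).
      rewrite -sqrtrM ?dot_ge0 // (le_trans (ler_norm _)) // normrN -sqrtr_sqr.
      by rewrite ler_sqrt ?mulr_ge0 ?dot_ge0 // dot_CS.
    by move: h; lra.
  have sN c : Num.sqrt (dot c c) <= N c.
    rewrite -[leRHS]ger0_norm ?N0 // -sqrtr_sqr ler_sqrt ?sqr_ge0 //.
  by apply: le_trans tri _; rewrite lerD.
(* The estimation error at ah relative to b has a quadratic part, controlled by
   REL and the strong convexity conv of the excess, and a linear part. *)
have comp b : (forall u, `|2 * dot ((v - b *m S) - (vn - b *m Sn)) u| <= nu * Num.sqrt (dot u u)) ->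
   N b <= r ->
   (q ah - qn ah) - (q b - qn b) <= (e ah + e b) / 8 + del * lam * (N ah + N b).
  move=> noise Nb.
  have qd : (q ah - qn ah) - (q b - qn b) =
    dot ((ah - b) *m S) (ah - b) - dot ((ah - b) *m Sn) (ah - b) -
    2 * dot ((v - b *m S) - (vn - b *m Sn)) (ah - b).
    have ahE : ah = b + (ah - b) by rewrite addrC subrK.
    have qE := qriskD rho v b (ah - b) sS; have qnE := qriskD rhon vn b (ah - b) sSn.
    rewrite -ahE -/q in qE; rewrite -ahE -/qn in qnE.
    by rewrite qE qnE dotBl; ring.
  rewrite qd; have h1 := REL (ah - b); have h2 := conv ah b.
  have h3 := noise (ah - b); have h4 := dN ah b.
  set s := Num.sqrt _ in h3 h4; have s0 : 0 <= s by exact: sqrtr_ge0.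
  have s2 : dot (ah - b) (ah - b) = s ^+ 2 by rewrite sqr_sqrtr // dot_ge0.
  rewrite s2 in h1; move: h3; rewrite ler_norml => /andP[h3 _].
  have h5 : tau * s ^+ 2 + nu * s <= del * lam * (N ah + N b).
    have h6 : tau * s ^+ 2 + nu * s = (tau * s + nu) * s by ring.
    rewrite h6 ler_pM ?addr_ge0 ?mulr_ge0 // (le_trans _ size) // lerD2r.
    by rewrite ler_wpM2l // (le_trans h4) // lerD2l.
  by lra.
have la0 : 0 <= del * lam by rewrite delE; lra.
have c1 := comp a0 NOISE0 (lexx _).
have am := ah_min a0.
have ea := e_ge0 ah; have Na := N0 ah; have r0 : 0 <= r by exact: N0.
have lN : 0 <= lam * N ah by rewrite mulr_ge0 // ltW.
have lr : 0 <= lam * r by rewrite mulr_ge0 // ltW.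
suff E : e ah <= lam * (1 + N ah) by move: E; rewrite /e; lra.
have step1 : e ah <= 8 / 7 * (9 / 8 * (del * lam) + del * lam * (N ah + r)).
  by move: c1 am e0; rewrite /e -/r; lra.
have [r16|r16] := leP r (16 * (1 + N ah)).
  have : lam * r <= lam * (16 * (1 + N ah)) by rewrite ler_wpM2l // ltW.
  by move: step1; rewrite delE; lra.
have lr16 : lam * (16 * (1 + N ah)) < lam * r by rewrite ltr_pM2l.
have e_small : e ah <= lam * r / 16 by move: step1; rewrite delE; lra.
have [k [kn kl ku]] : exists k, [/\ (k < n)%N, k%:R * lam <= e ah & e ah <= k.+1%:R * lam].
  pose k := Num.truncn (e ah / lam).
  have el : 0 <= e ah / lam by rewrite divr_ge0 // ltW.
  have /andP[k1 k2] := truncn_itv el.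
  exists k; split.
  - rewrite -(ltr_nat R); apply: le_lt_trans k1 _; rewrite ltr_pdivrMr //.
    have : lam * r <= lam * n%:R by rewrite ler_wpM2l // ltW.
    by lra.
  - by rewrite -ler_pdivlMr.
  - by rewrite -ler_pdivrMr // ltW.
have ecap : e ah <= cap by apply: le_trans lamr; lra.
have NBk := NB k ah ku ecap; have eBk := eB k.
have NBr : N (B k) <= r / 16 by lra.
have r16' : 16 < r by lra.
have [noiseB G] := NOISEB k kn r16' NBr.
have c2 := comp (B k) noiseB _.
have {}c2 : q ah - qn ah - (q (B k) - qn (B k)) <= (e ah + e (B k)) / 8 + del * lam * (N ah + N (B k)).
  by apply: c2; lra.
have convB := conv (B k) a0.
have eBk' : e (B k) <= e ah + lam by move: eBk; rewrite -natr1; lra.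
have lNB : lam * N (B k) <= lam * (N ah + 1) by rewrite ler_wpM2l // ltW.
have : e ah - e a0 <= (q ah - qn ah) - (q a0 - qn a0) by move: am; rewrite /e -/r; lra.
by move: c2 G convB; rewrite delE; rewrite delE in zetal; lra.
Qed.
End Oracle.

(** * Expectations and independence in a sample *)

Lemma meas_EFin d (T : measurableType d) (R : realType) (D : set T) (f : T -> R) :
  measurable_fun D f -> measurable_fun D (fun x => (f x)%:E).
Proof. by move=> /measurable_EFinP. Qed.

Section Superlevel.
Context d (T : measurableType d) (R : realType) (f : T -> R) (a : R).
Hypothesis mf : measurable_fun setT f.

Lemma superlevel_measurable : measurable [set w | a <= f w].
Proof.
have := @mf measurableT `[a, +oo[%classic (measurable_itv _).
by rewrite setTI; congr (measurable _); apply/funext => w /=; rewrite in_itv /= andbT.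
Qed.

Lemma strict_superlevel_measurable : measurable [set w | a < f w].
Proof.
have := @mf measurableT `]a, +oo[%classic (measurable_itv _).
by rewrite setTI; congr (measurable _); apply/funext => w /=; rewrite in_itv /= andbT.
Qed.

End Superlevel.

Section Integration.
Context d (T : measurableType d) (R : realType) (P : probability T R).
Local Notation "'E f" := (Rintegral P setT f) (at level 10, f at level 9).

Definition intg (f : T -> R) := P.-integrable setT (EFin \o f).

(** Bounded measurable functions: a class stable under the ring operations in
    which integrability is automatic. After truncation most functions of the
    sample belong to it. *)
Definition bm (f : T -> R) :=
  measurable_fun setT f /\ exists M : R, forall w, `|f w| <= M.

Lemma bm_intg (f : T -> R) : bm f -> intg f.
Proof.
move=> [mf [M fM]]; apply: (@le_integrable _ _ _ _ _ measurableT _ (EFin \o cst M)).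
- exact/measurable_EFinP.
- by move=> x _ /=; rewrite lee_fin (le_trans (fM x)) // ler_norm.
- exact: finite_measure_integrable_cst.
Qed.

Lemma intg_meas (f : T -> R) : intg f -> measurable_fun setT f.
Proof. by case/integrableP => /measurable_EFinP. Qed.

Lemma bmD (f g : T -> R) : bm f -> bm g -> bm (fun w => f w + g w).
Proof.
move=> [mf [M fM]] [mg [N gN]]; split; first exact: measurable_funD.
by exists (M + N) => w; rewrite (le_trans (ler_normD _ _)) // lerD.
Qed.

Lemma bmM (f g : T -> R) : bm f -> bm g -> bm (fun w => f w * g w).
Proof.
move=> [mf [M fM]] [mg [N gN]]; split; first exact: measurable_funM.
by exists (M * N) => w; rewrite normrM ler_pM.
Qed.

Lemma bm_cst c : bm (fun=> c).
Proof. by split; [exact: measurable_cst|exists `|c|]. Qed.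

Lemma bmZ c f : bm f -> bm (fun w => c * f w).
Proof. by move=> bf; apply: bmM => //; exact: bm_cst. Qed.

Lemma bmN (f : T -> R) : bm f -> bm (fun w => - f w).
Proof.
by move=> bf; under eq_fun do rewrite -mulN1r; exact: bmZ.
Qed.

Lemma bmB (f g : T -> R) : bm f -> bm g -> bm (fun w => f w - g w).
Proof. by move=> bf bg; apply: bmD => //; exact: bmN. Qed.

Lemma bmX f n : bm f -> bm (fun w => f w ^+ n).
Proof.
move=> bf; elim: n => [|n IH]; first by under eq_fun do rewrite expr0; exact: bm_cst.
by under eq_fun do rewrite exprS; exact: bmM.
Qed.

Lemma bm_sum (I : Type) (s : seq I) (p : pred I) (F : I -> T -> R) :
  (forall i, bm (F i)) -> bm (fun w => \sum_(i <- s | p i) F i w).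
Proof.
move=> bF; elim: s => [|i s IH].
  by under eq_fun do rewrite big_nil; exact: bm_cst.
under eq_fun do rewrite big_cons; case: (p i) => //; exact: bmD.
Qed.

Lemma intgD (f g : T -> R) : intg f -> intg g -> intg (fun w => f w + g w).
Proof. by move=> f_ g_; apply: integrableD f_ g_. Qed.

Lemma intgZ c f : intg f -> intg (fun w => c * f w).
Proof. by move=> f_; apply: integrableZl f_. Qed.

Lemma intgN f : intg f -> intg (fun w => - f w).
Proof. by move=> f_; under eq_fun do rewrite -mulN1r; exact: intgZ. Qed.

Lemma intgB (f g : T -> R) : intg f -> intg g -> intg (fun w => f w - g w).
Proof. by move=> f_ g_; apply: intgD => //; exact: intgN. Qed.

Lemma intg_cst c : intg (fun=> c).
Proof. exact/bm_intg/bm_cst. Qed.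

Lemma intg_sum (I : Type) (s : seq I) (p : pred I) (F : I -> T -> R) :
  (forall i, intg (F i)) -> intg (fun w => \sum_(i <- s | p i) F i w).
Proof.
move=> bF; elim: s => [|i s IH].
  by under eq_fun do rewrite big_nil; exact: intg_cst.
under eq_fun do rewrite big_cons; case: (p i) => //; exact: intgD.
Qed.

Lemma intg_le (f g : T -> R) : measurable_fun setT f -> intg g ->
  (forall w, `|f w| <= `|g w|) -> intg f.
Proof.
move=> mf g_ fg; apply: le_integrable g_ => //; first exact/measurable_EFinP.
by move=> w _; rewrite lee_fin.
Qed.

Lemma ExD (f g : T -> R) : intg f -> intg g -> 'E (fun w => f w + g w) = 'E f + 'E g.
Proof. by move=> *; rewrite RintegralD. Qed.

Lemma ExB (f g : T -> R) : intg f -> intg g -> 'E (fun w => f w - g w) = 'E f - 'E g.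
Proof. by move=> *; rewrite RintegralB. Qed.

Lemma ExZ c f : intg f -> 'E (fun w => c * f w) = c * 'E f.
Proof. by move=> *; rewrite RintegralZl. Qed.

Lemma Ex_cst c : 'E (fun=> c) = c.
Proof. by rewrite /Rintegral integral_cst //= probability_setT mule1. Qed.

Lemma Ex_sum (I : Type) (s : seq I) (p : pred I) (F : I -> T -> R) :
  (forall i, intg (F i)) ->
  'E (fun w => \sum_(i <- s | p i) F i w) = \sum_(i <- s | p i) 'E (F i).
Proof.
move=> bF; elim: s => [|i s IH].
  by under eq_fun do rewrite big_nil; rewrite Ex_cst big_nil.
under eq_fun do rewrite big_cons; rewrite big_cons; case: (p i) => //.
by rewrite ExD ?IH //; exact: intg_sum.
Qed.

Lemma Ex_le (f g : T -> R) : intg f -> intg g -> (forall w, f w <= g w) -> 'E f <= 'E g.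
Proof. by move=> *; apply: le_Rintegral. Qed.

Lemma Ex_ge0 (f : T -> R) : (forall w, 0 <= f w) -> 0 <= 'E f.
Proof. by move=> *; apply: Rintegral_ge0. Qed.

Lemma EFin_Ex (f : T -> R) : intg f -> ('E f)%:E = (\int[P]_w (f w)%:E)%E.
Proof. by move=> f_; rewrite fineK //; exact: integrable_fin_num. Qed.

Lemma Ex_ae (f g : T -> R) : measurable_fun setT f -> measurable_fun setT g ->
  {ae P, forall w, f w = g w} -> 'E f = 'E g.
Proof.
move=> mf mg fg; congr fine; apply: ae_eq_integral => //.
- exact/measurable_EFinP.
- exact/measurable_EFinP.
- by apply: filterS fg => w /= -> .
Qed.

Lemma Ex_markov (f : T -> R) (a : R) : intg f -> (forall w, 0 <= f w) -> 0 < a ->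
  (P [set w | (a <= f w)%R] <= ('E f / a)%:E)%E.
Proof.
move=> f_ f0 a0; have mA := superlevel_measurable a (intg_meas f_).
have : ((a%:E) * P [set w | (a <= f w)%R] <= ('E f)%:E)%E.
  rewrite EFin_Ex // -integral_cst //.
  apply: (@le_trans _ _ (\int[P]_(w in [set w | (a <= f w)%R]) (f w)%:E)%E).
    apply: ge0_le_integral => //.
      by move=> w _; rewrite lee_fin ltW.
    exact: (meas_EFin (measurable_funTS (intg_meas f_))).
  apply: ge0_subset_integral => //; first exact/meas_EFin/intg_meas.
  by move=> w _; rewrite lee_fin.
have Pf : P [set w | a <= f w] \is a fin_num by exact: fin_num_measure.
rewrite -(fineK Pf) -EFinM !lee_fin => h.
by rewrite ler_pdivlMr // mulrC.
Qed.

End Integration.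

Section IndependentProduct.
Context d (T : measurableType d) (R : realType) (P : probability T R).
Local Notation "'E f" := (Rintegral P setT f) (at level 10, f at level 9).

(** The law of (U, W) and the product of the laws of U and W agree on rectangles,
    hence are equal, and Fubini's theorem factors the integral of the product. *)
Lemma indep_Ex (U W : T -> R) : intg P U -> intg P W ->
  (forall A B : set R, measurable A -> measurable B ->
     P (U @^-1` A `&` W @^-1` B) = P (U @^-1` A) * P (W @^-1` B))%E ->
  intg P (fun w => U w * W w) /\ 'E (fun w => U w * W w) = 'E U * 'E W.
Proof.
move=> iU iW UW; have mU := intg_meas iU; have mW := intg_meas iW.
have mUW : measurable_fun setT (fun w => (U w, W w)) by exact: measurable_fun_pair.
pose U' : {mfun T >-> R} := HB.pack U (isMeasurableFun.Build _ _ _ _ U mU).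
pose W' : {mfun T >-> R} := HB.pack W (isMeasurableFun.Build _ _ _ _ W mW).
pose J : {mfun T >-> (R * R)%type} :=
  HB.pack (fun w => (U w, W w)) (isMeasurableFun.Build _ _ _ _ (fun w => (U w, W w)) mUW).
pose mu := distribution P U'; pose nu := distribution P W'.
pose m' := distribution P J.
have mE X : measurable X -> (mu \x nu)%E X = m' X.
  by apply: product_measure_unique => A B mA mB; exact: UW.
pose f (z : R * R) : \bar R := (z.1 * z.2)%:E.
have mf : measurable_fun setT f by apply/measurable_EFinP; exact: measurable_funM.
have absE (V : {mfun T >-> R}) : intg P V ->
   (\int[distribution P V]_y `|y|%:E = \int[P]_w `|V w|%:E)%E.
  by move=> _; rewrite ge0_integral_distribution //; exact/measurable_EFinP.
have idE (V : {mfun T >-> R}) : intg P V ->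
   (\int[distribution P V]_y y%:E = \int[P]_w (V w)%:E)%E.
  by move=> iV; rewrite integral_distribution //; exact/measurable_EFinP.
have finabs (V : T -> R) : intg P V -> (\int[P]_w `|V w|%:E < +oo)%E.
  by case/integrableP.
have fE : (mu \x nu)%E.-integrable setT f.
  apply/integrable12ltyP => //.
  have -> : (fun x => \int[nu]_y `|f (x, y)|)%E =
      (fun x => `|x|%:E * \int[P]_w `|W w|%:E)%E.
    apply/funext => x; rewrite -(absE W') // -ge0_integralZl_EFin //.
    - by apply: eq_integral => y _; rewrite /f /= normrM EFinM.
    - by apply/measurable_EFinP.
  have f0 := finabs _ iW.
  rewrite ge0_integralZr //.
  - rewrite (absE U') // lte_mul_pinfty ?finabs //; first exact: integral_ge0.
    by rewrite ge0_fin_numE ?finabs // integral_ge0.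
  - by apply/measurable_EFinP.
  - by apply: integral_ge0.
have ifJ : intg P (fun w => U w * W w).
  apply/integrableP; split.
    by apply/measurable_EFinP; exact: measurable_funM.
  case/integrableP : fE => _; apply: le_lt_trans.
  rewrite (eq_measure_integral m'); last by move=> A mA _; exact: mE.
  by rewrite ge0_integral_distribution //; exact: measurableT_comp.
split => //.
apply: EFin_inj; rewrite EFinM !EFin_Ex //.
have -> : (\int[P]_w (U w * W w)%:E = \int[m']_z f z)%E.
  by rewrite integral_distribution.
rewrite (eq_measure_integral (mu \x nu)%E); last by move=> A mA _; exact/esym/mE.
rewrite -integral12_prod_meas1 // /fubini_F.
have -> : (fun x => \int[nu]_y f (x, y))%E = (fun x => x%:E * \int[P]_w (W w)%:E)%E.
  apply/funext => x; rewrite -(idE W') // -integralZl //.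
  by apply: (@integrable_pushforward _ _ _ _ _ _ mW) => //; exact/measurable_EFinP.
have -> : (\int[P]_w (W w)%:E = ('E W)%:E)%E by rewrite EFin_Ex.
rewrite integralZr //.
  by rewrite (idE U').
by apply: (@integrable_pushforward _ _ _ _ _ _ mU) => //; exact/measurable_EFinP.
Qed.

End IndependentProduct.

Section Sample.
Context d (T : measurableType d) (R : realType) (P : probability T R).
Context d' (V : measurableType d') (I : finType) (Z : I -> T -> V).
Hypothesis mZ : forall i, measurable_fun setT (Z i).
Local Notation "'E f" := (Rintegral P setT f) (at level 10, f at level 9).

Definition gen_sample (J : {set I}) : set (set T) :=
  [set A | exists (j : I) (B : set V), [/\ j \in J, measurable B & A = Z j @^-1` B]].

Definition sig_sample (J : {set I}) := <<s gen_sample J >>.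

Definition sig_fun (J : {set I}) (f : T -> R) :=
  @measurable_fun _ _ (g_sigma_algebraType (gen_sample J)) R setT f.

Lemma sig_funP (J : {set I}) (f : T -> R) : sig_fun J f <->
  forall B : set R, measurable B -> sig_sample J (f @^-1` B).
Proof.
split=> [h B mB|h _ B mB]; last by rewrite setTI; exact: h.
by have := h measurableT B mB; rewrite setTI.
Qed.

Lemma measurable_preimage (f : T -> V) (B : set V) :
  measurable_fun setT f -> measurable B -> measurable (f @^-1` B).
Proof. by move=> mf mB; rewrite -[_ @^-1` _]setTI; exact: mf. Qed.

Lemma gen_sample_measurable J : gen_sample J `<=` measurable.
Proof. by move=> _ [j [B [_ mB ->]]]; exact: measurable_preimage. Qed.

Lemma sig_sample_measurable J : sig_sample J `<=` measurable.
Proof. apply: smallest_sub; [exact: sigma_algebra_measurable|exact: gen_sample_measurable]. Qed.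

Lemma sig_fun_measurable J f : sig_fun J f -> measurable_fun setT f.
Proof.
move=> /sig_funP h _ B mB; rewrite setTI.
exact: (sig_sample_measurable (h B mB)).
Qed.

Lemma sig_superlevel J (f : T -> R) a : sig_fun J f -> sig_sample J [set w | a <= f w].
Proof. exact: superlevel_measurable. Qed.

Lemma sig_strict_superlevel J (f : T -> R) a :
  sig_fun J f -> sig_sample J [set w | a < f w].
Proof. exact: strict_superlevel_measurable. Qed.

Lemma sig_fun_of (J : {set I}) (j : I) (v : V -> R) : j \in J -> measurable_fun setT v ->
  sig_fun J (v \o Z j).
Proof.
move=> jJ mv; apply/sig_funP => B mB; apply: sub_sigma_algebra.
exists j, (v @^-1` B); split => //.
by rewrite -[_ @^-1` _]setTI; exact: mv.
Qed.

Hypothesis indepZ : mutually_independent P Z.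

Let cyl (J : {set I}) (B : I -> set V) : set T :=
  \bigcap_(i in [set` J]) (Z i @^-1` B i).

(** For a fixed B both sides are finite measures of A. They agree on the cylinders
    over J, which generate the sigma-algebra and are stable under intersection. *)
Lemma indep_sig (J : {set I}) (i : I) (A : set T) (B : set V) : i \notin J ->
  sig_sample J A -> measurable B ->
  (P (A `&` Z i @^-1` B) = P A * P (Z i @^-1` B))%E.
Proof.
move=> iJ; move: A.
move=> A sA mB; pose C := Z i @^-1` B; have mC : measurable C by exact: measurable_preimage.
pose G : set (set T) :=
  [set A | exists B : I -> set V, (forall i, measurable (B i)) /\ A = cyl J B].
have mcyl B0 : (forall i, measurable (B0 i)) -> measurable (cyl J B0).
  move=> mB0; apply: fin_bigcap_measurable => // j _.
  by apply: measurable_preimage.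
have Gm : G `<=` measurable by move=> _ [B0 [mB0 ->]]; exact: mcyl.
have GI : setI_closed G.
  move=> _ _ [B1 [m1 ->]] [B2 [m2 ->]]; exists (fun i => B1 i `&` B2 i); split.
    by move=> j; exact: measurableI.
  by rewrite /cyl -bigcapI.
have GT : G setT.
  exists (fun=> setT); split => //; rewrite /cyl.
  by apply/esym/seteqP; split.
have sAG : <<s G >> A.
  move: sA; apply: smallest_sub; first exact: smallest_sigma_algebra.
  move=> _ [j [B0 [jJ mB0 ->]]]; apply: sub_sigma_algebra.
  exists (fun k => if k == j then B0 else setT); split.
    by move=> k; case: ifP.
  apply/seteqP; split => w.
    by move=> Bw k _; case: eqP => [->|].
  by move=> /(_ j jJ); rewrite /= eqxx.
have pC0 : (0 <= fine (P C))%R by exact: fine_ge0.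
pose m1 : {measure set T -> \bar R} := mrestr P mC.
pose m2 : {measure set T -> \bar R} := mscale (NngNum pC0) P.
have fP X : measurable X -> P X \is a fin_num by move=> ?; exact: fin_num_measure.
have -> : (P A * P C)%E = m2 A by rewrite /m2 /= /mscale /= fineK ?fP // muleC.
have -> : P (A `&` C) = m1 A by [].
apply: (g_sigma_algebra_measure_unique G Gm (fun=> setT)) => //.
- by rewrite bigcup_const.
- move=> _ [B0 [mB0 ->]]; rewrite /m1 /m2 /= /mrestr /mscale /=.
  pose B1 k := if k == i then B else B0 k.
  have mB1 k : measurable (B1 k) by rewrite /B1; case: ifP.
  have e1 : cyl J B0 `&` C = cyl (i |: J) B1.
    apply/seteqP; split => w.
      move=> [h1 h2] k; rewrite /B1 /= in_setU1; case: eqP => [-> _//|_ /=]; exact: h1.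
    move=> h; split; last by have := h i; rewrite /B1 /= eqxx; apply; rewrite setU11.
    move=> k /= kJ; have := h k; rewrite /B1 /= in_setU1 kJ orbT => /(_ isT).
    by case: eqP kJ => // ->; rewrite (negbTE iJ).
  have := indepZ (i |: J) mB1; rewrite -/(cyl _ _) big_setU1 //= {2}/B1 eqxx.
  have -> : \prod_(k in J) fine (P (Z k @^-1` B1 k)) = fine (P (cyl J B0)).
    rewrite (indepZ J mB0); apply: eq_bigr => k kJ; rewrite /B1.
    by case: eqP kJ => // ->; rewrite (negbTE iJ).
  rewrite -e1 => h.
  have mc := mcyl _ mB0; have mcC : measurable (cyl J B0 `&` C) by exact: measurableI.
  by rewrite -[LHS](fineK (fP _ mcC)) h EFinM !fineK // fP.
- move=> k; rewrite /m1 /= /mrestr (le_lt_trans (probability_le1 P _)) ?ltry //.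
  by rewrite setTI.
Qed.

(** The form in which independence is used throughout: a function of the
    observations in J and a function of another observation are uncorrelated. *)
Lemma sample_Ex (J : {set I}) (i : I) (u : T -> R) (v : V -> R) : i \notin J ->
  sig_fun J u -> intg P u -> measurable_fun setT v -> intg P (v \o Z i) ->
  intg P (fun w => u w * v (Z i w)) /\
  'E (fun w => u w * v (Z i w)) = 'E u * 'E (v \o Z i).
Proof.
move=> iJ /sig_funP su iu mv iv.
apply: (@indep_Ex _ _ _ P u (v \o Z i)) => // A B mA mB.
rewrite comp_preimage; apply: (@indep_sig J) => //; first exact: su.
by rewrite -[_ @^-1` _]setTI; exact: mv.
Qed.

Lemma law_Ex (i j : I) (v : V -> R) :
  (forall B : set V, measurable B -> P (Z i @^-1` B) = P (Z j @^-1` B)) ->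
  measurable_fun setT v -> intg P (v \o Z i) ->
  intg P (v \o Z j) /\ 'E (v \o Z j) = 'E (v \o Z i).
Proof.
move=> ij mv iv; have mev := meas_EFin mv.
have eqm : forall A, measurable A -> A `<=` setT -> pushforward P (Z i) A = pushforward P (Z j) A.
  by move=> A mA _; exact: ij.
pose Z' k : {mfun T >-> V} := HB.pack (Z k) (isMeasurableFun.Build _ _ _ _ (Z k) (mZ k)).
have ivj : intg P (v \o Z j).
  apply/integrableP; split; first by apply: meas_EFin; exact: measurableT_comp.
  case/integrableP : iv => _; apply: le_lt_trans.
  have e k : (\int[P]_x `|(EFin \o (v \o Z k)) x| =
    \int[distribution P (Z' k)]_y `|(v y)%:E|)%E.
    by rewrite ge0_integral_distribution //; exact: measurableT_comp.
  by rewrite !e (eq_measure_integral (distribution P (Z' i))) // => A mA _; exact/esym/ij.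
split => //; apply: EFin_inj; rewrite !EFin_Ex //.
have e k : intg P (v \o Z k) -> (\int[P]_x ((v \o Z k) x)%:E =
    \int[distribution P (Z' k)]_y (v y)%:E)%E.
  by move=> ?; rewrite integral_distribution.
by rewrite !e // (eq_measure_integral (distribution P (Z' i))) // => A mA _; exact/esym/ij.
Qed.

End Sample.

(** * A Bernstein inequality for random vectors *)

(** A second order expansion with explicit remainder, for y of either sign. *)
Lemma one_plus_pow_le (R : realType) (y : R) k : 0 <= 1 + y -> k%:R * y <= 1 ->
  (1 + y) ^+ k <= 1 + k%:R * y + k%:R ^+ 2 * y ^+ 2.
Proof.
move=> y1; elim: k => [|k IH] ky; first by rewrite expr0; lra.
have k0 : 0 <= k%:R :> R by [].
have ky' : k%:R * y <= 1.
  have [y0|/ltW y0] := leP 0 y; last by rewrite (le_trans (mulr_ge0_le0 k0 y0)).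
  by apply: le_trans ky; rewrite ler_wpM2r // ler_nat.
rewrite exprSr; apply: (@le_trans _ _ ((1 + k%:R * y + k%:R ^+ 2 * y ^+ 2) * (1 + y))).
  by rewrite ler_wpM2r // IH.
rewrite -natr1; have y20 := sqr_ge0 y.
rewrite -subr_ge0 (_ : _ - _ = y ^+ 2 * (k%:R * (1 - k%:R * y) + 1)); last by ring.
by rewrite mulr_ge0 // addr_ge0 // mulr_ge0 // subr_ge0.
Qed.

(** The increment x is small compared with c / p, so the power can be expanded to
    second order. The first order term is linear in x: it has mean zero when x is
    centered and independent of s. *)
Lemma potential_step (R : realType) D (s x : 'rV[R]_D) (c q : R) p : 0 < c ->
  16 * p.+1%:R ^+ 2 * dot x x <= c ^+ 2 ->
  q = c ^+ 2 + dot s s ->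
  (c ^+ 2 + dot (s + x) (s + x)) ^+ p.+1 <=
    q ^+ p.+1 + 2 * p.+1%:R * (q ^+ p * dot s x) + 10 * p.+1%:R ^+ 2 * (q ^+ p * dot x x).
Proof.
move=> c0 hx qD.
have qE : c ^+ 2 + dot (s + x) (s + x) = q + (2 * dot s x + dot x x).
  by rewrite qD dotDl !dotDr (dotC x s); ring.
have c2 : 0 < c ^+ 2 by rewrite exprn_gt0.
have ss := dot_ge0 s; have xx := dot_ge0 x.
have q0 : 0 < q by rewrite qD; lra.
rewrite qE; set u := 2 * dot s x + dot x x; set P := p.+1%:R : R.
have P1 : 1 <= P by rewrite /P ler1n.
have P2 : 1 <= P ^+ 2 by rewrite expr_ge1.
have xc : 16 * dot x x <= q.
  apply: le_trans (_ : c ^+ 2 <= _); last by rewrite qD; lra.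
  apply: le_trans hx; rewrite -subr_ge0.
  rewrite (_ : _ - _ = 16 * ((P ^+ 2 - 1) * dot x x)); last by ring.
  by rewrite mulr_ge0 // mulr_ge0 // subr_ge0.
have cs : dot s x ^+ 2 <= q * dot x x.
  apply: le_trans (dot_CS _ _) _; rewrite ler_wpM2r // qD; lra.
have u2 : u ^+ 2 <= 9 * q * dot x x.
  have h : u ^+ 2 <= 2 * (4 * dot s x ^+ 2 + dot x x ^+ 2).
    rewrite -subr_ge0 (_ : _ - _ = (2 * dot s x - dot x x) ^+ 2) ?sqr_ge0 //.
    by rewrite /u; ring.
  apply: (le_trans h); have : dot x x ^+ 2 <= q * dot x x.
    by rewrite expr2 ler_wpM2r //; lra.
  have : 0 <= q * dot x x by rewrite mulr_ge0 // ltW.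
  have : 16 * dot x x ^+ 2 <= q * dot x x by rewrite expr2 mulrA ler_wpM2r.
  by move: cs; lra.
have Pu : P * u <= q.
  rewrite real_leNgt ?num_real //; apply/negP => h.
  have : q ^+ 2 < (P * u) ^+ 2 by rewrite ltrXn2r // ?nnegrE ltW // (lt_trans q0).
  rewrite exprMn; have : P ^+ 2 * u ^+ 2 <= P ^+ 2 * (9 * q * dot x x).
    by rewrite ler_wpM2l // sqr_ge0.
  have : 16 * P ^+ 2 * dot x x * q <= q * q.
    by rewrite ler_wpM2r ?(ltW q0) // (le_trans hx) // qD; lra.
  have : 0 < q * q by rewrite mulr_gt0.
  have -> : P ^+ 2 * (9 * q * dot x x) = 9 * (P ^+ 2 * dot x x * q) by ring.
  have -> : 16 * P ^+ 2 * dot x x * q = 16 * (P ^+ 2 * dot x x * q) by ring.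
  by rewrite expr2; lra.
have key := @one_plus_pow_le R (u / q) p.+1.
have -> : (q + u) ^+ p.+1 = q ^+ p.+1 * (1 + u / q) ^+ p.+1.
  by rewrite -exprMn mulrDr mulr1 mulrCA mulfV ?mulr1 // gt_eqF.
have qu0 : 0 <= q + u.
  by rewrite -qE addr_ge0 ?dot_ge0 // ltW.
have h1 : 0 <= 1 + u / q.
  by rewrite -[X in X + _](@mulfV _ q) ?gt_eqF // -mulrDl divr_ge0 // ltW.
have h2 : P * (u / q) <= 1 by rewrite mulrA ler_pdivrMr // mul1r.
have qp : 0 <= q ^+ p by rewrite exprn_ge0 // ltW.
apply: le_trans (ler_wpM2l (exprn_ge0 _ (ltW q0)) (key h1 h2)) _; rewrite -/P.
have -> : q ^+ p.+1 * (1 + P * (u / q) + P ^+ 2 * (u / q) ^+ 2) =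
  q ^+ p.+1 + P * (q ^+ p * u) + P ^+ 2 * (q ^+ p * (u ^+ 2 / q)).
  by rewrite exprS; field; rewrite gt_eqF.
have : q ^+ p * (u ^+ 2 / q) <= q ^+ p * (9 * dot x x).
  by rewrite ler_wpM2l // ler_pdivrMr // mulrAC.
move=> /(ler_wpM2l (sqr_ge0 P)) h3.
have h4 : P * (q ^+ p * dot x x) <= P ^+ 2 * (q ^+ p * dot x x).
  rewrite ler_wpM2r ?mulr_ge0 //; rewrite expr2 -[leLHS]mulr1 ler_wpM2l //; lra.
apply: (@le_trans _ _ (q ^+ p.+1 + P * (q ^+ p * u) + P ^+ 2 * (q ^+ p * (9 * dot x x)))).
  by rewrite lerD2l.
rewrite /u.
have -> : q ^+ p.+1 + P * (q ^+ p * (2 * dot s x + dot x x)) + P ^+ 2 * (q ^+ p * (9 * dot x x)) =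
  q ^+ p.+1 + 2 * P * (q ^+ p * dot s x) + (P * (q ^+ p * dot x x) + 9 * (P ^+ 2 * (q ^+ p * dot x x))) by ring.
by rewrite lerD2l -mulrA; lra.
Qed.

Lemma expR1_le4 (R : realType) : expR 1 <= 4 :> R.
Proof.
have h : (2^-1 : R) <= expR (- 2^-1).
  by apply: le_trans (expR_ge1Dx _); lra.
suff : expR (2%:R * 2^-1) <= 4 :> R by rewrite mulfV.
have h2 : expR (2^-1 : R) <= 2.
  by rewrite -[expR _]invrK -expRN -[leRHS]invrK lef_pV2 // posrE ?expR_gt0.
rewrite expRM_natl [leRHS](_ : _ = 2 ^+ 2); last by ring.
by rewrite lerXn2r // nnegrE ?expR_ge0.
Qed.

Section IID.
Context d (T : measurableType d) (R : realType) (P : probability T R).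
Context d' (V : measurableType d') (n : nat) (Z : option 'I_n -> T -> V).
Hypothesis mZ : forall i, measurable_fun setT (Z i).
Hypothesis iidZ : iid P Z.
Local Notation "'E f" := (Rintegral P setT f) (at level 10, f at level 9).

(** The index None carries the fresh observation and Some i the i-th point of the
    sample; past k consists of the first k points of the sample. *)
Definition past (k : nat) : {set option 'I_n} :=
  [set o : option 'I_n | if o is Some i then (i < k)%N else false].

Definition psum (A : zmodType) (F : V -> A) (k : nat) (w : T) : A :=
  \sum_(i < n | (i < k)%N) F (Z (Some i) w).

Lemma psum0 (A : zmodType) (F : V -> A) w : psum F 0 w = 0.
Proof. by rewrite /psum big_pred0. Qed.

Lemma psumS (A : zmodType) (F : V -> A) (i : 'I_n) w :
  psum F i.+1 w = psum F i w + F (Z (Some i) w).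
Proof.
rewrite /psum (bigD1 i) /= ?ltnSn // addrC; congr (_ + _).
by apply: eq_bigl => j; rewrite ltnS ltn_neqAle andbC.
Qed.

Lemma psum_full (A : zmodType) (F : V -> A) w :
  psum F n w = \sum_(i < n) F (Z (Some i) w).
Proof. by apply: eq_bigl => i; rewrite ltn_ord. Qed.

Lemma notin_past (i : 'I_n) : Some i \notin past i.
Proof. by rewrite inE ltnn. Qed.

Lemma bm_comp (v : V -> R) i : measurable_fun setT v ->
  (exists M : R, forall x, `|v x| <= M) -> bm (v \o Z i).
Proof.
by move=> mv [M vM]; split; [exact: measurableT_comp|exists M => w; exact: vM].
Qed.

Lemma sig_psum (v : V -> R) k : measurable_fun setT v ->
  sig_fun Z (past k) (fun w => \sum_(i < n | (i < k)%N) v (Z (Some i) w)).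
Proof.
move=> mv; rewrite /sig_fun; under eq_fun do rewrite big_mkcond.
apply: (@measurable_sum _ (g_sigma_algebraType _)) => i /=.
case ik : (i < k)%N.
  by apply: (@sig_fun_of _ _ _ _ _ _ Z (past k) (Some i) v) => //; rewrite inE.
exact: measurable_cst.
Qed.

Lemma iid_Ex (u : T -> R) (v : V -> R) (i : 'I_n) :
  sig_fun Z (past i) u -> bm u -> measurable_fun setT v ->
  (exists M : R, forall x, `|v x| <= M) ->
  'E (fun w => u w * v (Z (Some i) w)) = 'E u * 'E (v \o Z None).
Proof.
move=> su bu mv bv; have [indZ idZ] := iidZ.
have [_ ->] := sample_Ex mZ indZ (notin_past i) su (bm_intg P bu) mv
   (bm_intg P (bm_comp (Some i) mv bv)).
congr (_ * _); apply: (proj2 (law_Ex mZ _ mv _)).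
  by move=> B mB; exact: idZ.
exact/bm_intg/bm_comp.
Qed.

Section VectorBernstein.
Context (D : nat) (f : V -> 'rV[R]_D) (M W c : R) (p : nat).
Hypothesis mf : forall j, measurable_fun setT (fun v => f v 0 j).
Hypothesis fM : forall v, dot (f v) (f v) <= M ^+ 2.
Hypothesis M0 : 0 <= M.
Hypothesis f0 : forall j, 'E (fun w => f (Z None w) 0 j) = 0.
Hypothesis fW : 'E (fun w => dot (f (Z None w)) (f (Z None w))) <= W.
Hypothesis c0 : 0 < c.
Hypothesis cM : 4 * p.+1%:R * M <= c.
Hypothesis cW : 10 * n%:R * p.+1%:R * W <= c ^+ 2.

Let S k w := psum f k w.
Let q k w := c ^+ 2 + dot (S k w) (S k w).

Let f_bound j v : `|f v 0 j| <= M.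
Proof.
rewrite -(ler_pXn2r (n := 2)) // ?nnegrE // real_normK ?num_real //.
exact: le_trans (sqr_entry_le _ _) (fM v).
Qed.

Let SE k w j : S k w 0 j = \sum_(i < n | (i < k)%N) f (Z (Some i) w) 0 j.
Proof. by rewrite /S /psum summxE. Qed.

Let bmS k j : bm (fun w => S k w 0 j).
Proof.
under eq_fun do rewrite SE; apply: bm_sum => i.
by apply: (@bm_comp (fun v => f v 0 j) (Some i)) => //; exists M.
Qed.

Let sigS k j : sig_fun Z (past k) (fun w => S k w 0 j).
Proof. by under eq_fun do rewrite SE; exact: (@sig_psum (fun v => f v 0 j)). Qed.

Let bmq k a : bm (fun w => q k w ^+ a).
Proof. by apply: bmX; apply: bmD; [exact: bm_cst|apply: bm_sum => j; exact: bmM]. Qed.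

Let sigq k a : sig_fun Z (past k) (fun w => q k w ^+ a).
Proof.
rewrite /sig_fun; apply: measurable_funX; apply: measurable_funD.
  exact: measurable_cst.
apply: (@measurable_sum _ (g_sigma_algebraType _)) => j.
by apply: measurable_funM; exact: sigS.
Qed.

Let bmf2 i : bm (fun w => dot (f (Z i w)) (f (Z i w))).
Proof.
apply: bm_sum => j.
by apply: bmM; apply: (@bm_comp (fun v => f v 0 j) i) => //; exists M.
Qed.

Lemma potential_Ex_step (i : 'I_n) :
  'E (fun w => q i.+1 w ^+ p.+1) <=
  'E (fun w => q i w ^+ p.+1) * (1 + 10 * p.+1%:R ^+ 2 * W / c ^+ 2).
Proof.
set PP := p.+1%:R : R.
have c2 : 0 < c ^+ 2 by rewrite exprn_gt0.
pose g1 j w := q i w ^+ p * S i w 0 j * f (Z (Some i) w) 0 j.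
pose g2 w := q i w ^+ p * dot (f (Z (Some i) w)) (f (Z (Some i) w)).
have bg1 j : bm (g1 j).
  apply: bmM; first by apply: bmM; [exact: bmq|exact: bmS].
  by apply: (@bm_comp (fun v => f v 0 j) (Some i)) => //; exists M.
have bg2 : bm g2 by apply: bmM; [exact: bmq|exact: bmf2].
have E1 j : 'E (g1 j) = 0.
  rewrite /g1 (@iid_Ex (fun w => q i w ^+ p * S i w 0 j) (fun v => f v 0 j)) //.
  - by rewrite (f0 j) mulr0.
  - by rewrite /sig_fun; apply: measurable_funM; [exact: sigq|exact: sigS].
  - by apply: bmM; [exact: bmq|exact: bmS].
  - by exists M.
have E2 : 'E g2 <= 'E (fun w => q i w ^+ p) * W.
  rewrite /g2 (@iid_Ex (fun w => q i w ^+ p) (fun v => dot (f v) (f v))) //.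
  - rewrite ler_wpM2l //; apply: Ex_ge0 => w.
    by rewrite exprn_ge0 // addr_ge0 ?dot_ge0 // ltW.
  - by apply: (@measurable_sum _ V) => j; exact: measurable_funM.
  - by exists (M ^+ 2) => v; rewrite ger0_norm ?dot_ge0.
have W0 : 0 <= W by apply: le_trans fW; apply: Ex_ge0 => w; exact: dot_ge0.
have E3 : 'E (fun w => q i w ^+ p) <= 'E (fun w => q i w ^+ p.+1) / c ^+ 2.
  rewrite ler_pdivlMr // mulrC -ExZ; last exact/bm_intg/bmq.
  apply: Ex_le => [||w].
  - by apply/bm_intg/bmZ/bmq.
  - exact/bm_intg/bmq.
  - rewrite [leRHS]exprS ler_wpM2r ?exprn_ge0 ?addr_ge0 ?dot_ge0 ?(ltW c2) //.
    by rewrite /q lerDl dot_ge0.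
have step w : q i.+1 w ^+ p.+1 <=
    q i w ^+ p.+1 + (2 * PP * \sum_j g1 j w + 10 * PP ^+ 2 * g2 w).
  have := @potential_step R D (S i w) (f (Z (Some i) w)) c (q i w) p c0 _ erefl.
  rewrite {1}/q /S -psumS -/(S _ _) -/(q _ _) addrA.
  have -> : q i w ^+ p * dot (psum f i w) (f (Z (Some i) w)) = \sum_j g1 j w.
    by rewrite /dot mulr_sumr; apply: eq_bigr => j _; rewrite mulrA.
  apply; apply: (@le_trans _ _ ((4 * PP * M) ^+ 2)).
    rewrite !exprMn (_ : 4 ^+ 2 = 16); last by ring.
    by rewrite ler_wpM2l // mulr_ge0 // sqr_ge0.
  by rewrite lerXn2r // nnegrE ?(ltW c0) // !mulr_ge0.
have bs1 : bm (fun w => \sum_j g1 j w) by exact: bm_sum.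
apply: (@le_trans _ _ ('E (fun w => q i w ^+ p.+1 + (2 * PP * \sum_j g1 j w + 10 * PP ^+ 2 * g2 w)))).
  apply: Ex_le => //; first exact/bm_intg/bmq.
  apply/bm_intg/bmD; first exact: bmq.
  by apply: bmD; exact: bmZ.
rewrite ExD; [|exact/bm_intg/bmq|by apply/bm_intg/bmD; exact: bmZ].
rewrite ExD; [|exact/bm_intg/bmZ|exact/bm_intg/bmZ].
rewrite !ExZ ?Ex_sum; [|by move=> j; exact: bm_intg|exact: bm_intg|exact: bm_intg].
rewrite big1 ?mulr0 ?add0r; last by move=> j _; exact: E1.
rewrite mulrDr mulr1 lerD2l.
apply: (@le_trans _ _ (10 * PP ^+ 2 * (('E (fun w => q i w ^+ p.+1) / c ^+ 2) * W))).
  rewrite ler_wpM2l ?mulr_ge0 ?sqr_ge0 // (le_trans E2) //.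
  by rewrite ler_wpM2r.
by rewrite le_eqVlt; apply/orP; left; apply/eqP; ring.
Qed.

(** The argument of Chernoff with the potential (c^2 + |S|^2)^(p+1) in place of an
    exponential. Each observation multiplies its mean by at most
    1 + 10 (p+1)^2 W / c^2, so it stays below c^(2(p+1)) e^(p+1), and the claim is
    Markov's inequality. Only Euclidean norms enter, so the bound does not depend
    on the dimension. *)
Lemma vector_bernstein :
  (P [set w | (16 * c ^+ 2 <= dot (S n w) (S n w))%R] <= (expR (- p.+1%:R))%:E)%E.
Proof.
have c2 : 0 < c ^+ 2 by rewrite exprn_gt0.
set PP := p.+1%:R : R.
have W0 : 0 <= W by apply: le_trans fW; apply: Ex_ge0 => w; exact: dot_ge0.
set r := 1 + 10 * PP ^+ 2 * W / c ^+ 2.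
have r0 : 0 <= r by rewrite addr_ge0 // divr_ge0 ?(ltW c2) // !mulr_ge0 // sqr_ge0.
have Ek k : (k <= n)%N -> 'E (fun w => q k w ^+ p.+1) <= (c ^+ 2) ^+ p.+1 * r ^+ k.
  elim: k => [_|k IH kn].
    rewrite (_ : (fun w => _) = fun=> (c ^+ 2) ^+ p.+1) ?Ex_cst ?mulr1 //.
    by apply/funext => w; rewrite /q /S psum0 dot0l addr0.
  apply: le_trans (potential_Ex_step (Ordinal kn)) _.
  by rewrite -/PP -/r [r ^+ _]exprSr mulrA ler_wpM2r // IH // ltnW.
have rn : r ^+ n <= expR PP.
  apply: (@le_trans _ _ (expR (10 * PP ^+ 2 * W / c ^+ 2) ^+ n)).
    by rewrite lerXn2r // ?nnegrE ?expR_ge0 // expR_ge1Dx.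
  rewrite -expRM_natl ler_expR mulrA ler_pdivrMr //.
  rewrite (_ : _ * _ = PP * (10 * n%:R * PP * W)); last by ring.
  by rewrite ler_wpM2l.
(* On the event the potential exceeds (17 c^2)^(p+1), and 17 >= e * e: one factor
   e pays for the growth of the mean, the other is the claimed probability. *)
apply: (@le_trans _ _ (P [set w | ((17 * c ^+ 2) ^+ p.+1 <= q n w ^+ p.+1)%R])).
  apply: le_measure; rewrite ?inE.
  - have mS : measurable_fun setT (fun w => dot (S n w) (S n w)).
      by apply: (@measurable_sum _ T) => j; have [+ _] := bmS n j; move=> ?; exact: measurable_funM.
    exact: superlevel_measurable mS.
  - by have [mS _] := bmq n p.+1; exact: superlevel_measurable mS.
  - move=> w /= h; have q17 : 17 * c ^+ 2 <= q n w by rewrite /q; lra.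
    have c17 : 0 <= 17 * c ^+ 2 by lra.
    by rewrite lerXn2r // nnegrE (le_trans c17).
apply: le_trans (Ex_markov _ _ _) _.
- exact/bm_intg/bmq.
- by move=> w; rewrite exprn_ge0 // addr_ge0 ?dot_ge0 // ltW.
- by rewrite exprn_gt0 // mulr_gt0.
rewrite lee_fin ler_pdivrMr ?exprn_gt0 ?mulr_gt0 //.
apply: le_trans (Ek n (leqnn _)) _; rewrite (exprMn p.+1 17 (c ^+ 2)).
rewrite mulrA [leRHS]mulrC.
apply: ler_wpM2l; first exact: exprn_ge0 (ltW c2).
apply: (le_trans rn).
rewrite expRN mulrC ler_pdivlMr ?expR_gt0 //.
have -> : expR PP = expR 1 ^+ p.+1 by rewrite -expRM_natl mulr1.
rewrite -exprMn lerXn2r ?nnegrE ?mulr_ge0 ?expR_ge0 //.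
apply: (@le_trans _ _ (4 * 4)); last by lra.
by rewrite ler_pM ?expR_ge0 ?expR1_le4.
Qed.

End VectorBernstein.
End IID.

(** * The lower tail of the empirical covariance *)

Section CovarianceLowerTail.
Context d (T : measurableType d) (R : realType) (P : probability T R).
Context d' (V : measurableType d') (n : nat) (Z : option 'I_n -> T -> V).
Hypothesis mZ : forall i, measurable_fun setT (Z i).
Hypothesis iidZ : iid P Z.
Local Notation "'E f" := (Rintegral P setT f) (at level 10, f at level 9).
Context (D : nat) (f : V -> 'rV[R]_D) (b2 : R).
Hypothesis mf : forall j, measurable_fun setT (fun v => f v 0 j).
Hypothesis b20 : 0 < b2.
Hypothesis fb : forall v, dot (f v) (f v) <= b2.
Hypothesis n0 : (0 < n)%N.

Definition second_moment : 'M[R]_D :=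
  \matrix_(i, j) 'E (fun w => f (Z None w) 0 i * f (Z None w) 0 j).

Let f_bound j v : `|f v 0 j| <= 1 + b2. Proof. exact: entry_le. Qed.

Let bmf i j : bm (fun w => f (Z i w) 0 j).
Proof. by apply: (@bm_comp _ _ _ _ _ _ _ mZ (fun v => f v 0 j) i) => //; exists (1 + b2). Qed.

Let mff i j : measurable_fun setT (fun v => f v 0 i * f v 0 j).
Proof. exact: measurable_funM. Qed.

Let ff_bound i j : exists M : R, forall v, `|f v 0 i * f v 0 j| <= M.
Proof. by exists ((1 + b2) * (1 + b2)) => v; rewrite normrM ler_pM. Qed.

Lemma second_moment_quad u :
  dot (u *m second_moment) u = 'E (fun w => dot (f (Z None w)) u ^+ 2).
Proof.
have -> : (fun w => dot (f (Z None w)) u ^+ 2) =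
  (fun w => \sum_i \sum_j (u 0 j * u 0 i) * (f (Z None w) 0 j * f (Z None w) 0 i)).
  apply/funext => w; rewrite expr2 /dot mulr_suml; apply: eq_bigr => i _.
  by rewrite mulr_sumr; apply: eq_bigr => j _; ring.
rewrite Ex_sum => [|i]; last by apply/bm_intg/bm_sum => j; apply: bmZ; exact: bmM.
rewrite {1}/dot; apply: eq_bigr => i _; rewrite mxE mulr_suml.
rewrite Ex_sum => [|j]; last by apply/bm_intg/bmZ; exact: bmM.
apply: eq_bigr => j _; rewrite ExZ; last by apply/bm_intg; exact: bmM.
by rewrite mxE; ring.
Qed.

Lemma second_moment_sym : second_moment^T = second_moment.
Proof.
apply/matrixP => i j; rewrite !mxE; congr Rintegral.
by apply/funext => w; rewrite mulrC.
Qed.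

Lemma second_moment_above : above 0 second_moment.
Proof.
split=> [|u]; first exact: second_moment_sym.
by rewrite mul0r second_moment_quad; apply: Ex_ge0 => w; exact: sqr_ge0.
Qed.

Lemma bm_dotf i u : bm (fun w => dot (f (Z i w)) u).
Proof. by apply: bm_sum => j; apply: bmM => //; exact: bm_cst. Qed.

Lemma second_moment_le u : dot (u *m second_moment) u <= b2 * dot u u.
Proof.
rewrite second_moment_quad -[leRHS](Ex_cst P); apply: Ex_le.
- exact/bm_intg/bmX/bm_dotf.
- exact: intg_cst.
- by move=> w; rewrite (le_trans (dot_CS _ _)) // ler_wpM2r ?dot_ge0.
Qed.

(** A k is c I plus the deficit of the first k outer products with respect to
    a0 = 15/16 of their mean, so a direction u in which the empirical second moment
    is too small makes <A n u, u> large. The margin 1 - a0 pays for the second order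
    effect of a rank one update, and c is large enough for all A k to be above
    c / 2. Ap k is A k before the (k+1)-st outer product is subtracted. *)
Let S2 := second_moment.
Let c : R := 32 * n%:R * b2.
Let a0 : R := 15 / 16.
Let G k w := psum (V := V) Z (fun v => (f v)^T *m f v) k w.
Let A k w : 'M[R]_D := c%:M + (k%:R * a0) *: S2 - G k w.
Let Ap k w : 'M[R]_D := A k w + a0 *: S2.

Let nb0 : 0 < n%:R * b2. Proof. by rewrite mulr_gt0 // ltr0n. Qed.
Let c0 : 0 < c. Proof. by rewrite /c -mulrA mulr_gt0. Qed.

Let dot_outer (z u : 'rV[R]_D) : dot (u *m (z^T *m z)) u = dot z u ^+ 2.
Proof. by rewrite mulmxA mulmx_dot mul_scalar_mx dotZl (dotC u) expr2. Qed.

Let G_quad k w u :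
  dot (u *m G k w) u = \sum_(i < n | (i < k)%N) dot (f (Z (Some i) w)) u ^+ 2.
Proof.
rewrite /G /psum mulmx_sumr dotC dot_sumr; apply: eq_bigr => i _.
by rewrite dotC dot_outer.
Qed.

Let G_sym k w : (G k w)^T = G k w.
Proof.
by rewrite /G /psum linear_sum /=; apply: eq_bigr => i _; rewrite trmx_mul trmxK.
Qed.

Let G_le k w u : dot (u *m G k w) u <= n%:R * b2 * dot u u.
Proof.
rewrite G_quad big_mkcond /=.
apply: (@le_trans _ _ (\sum_(i < n) b2 * dot u u)).
  apply: ler_sum => i _; case: ifP => _.
    by rewrite (le_trans (dot_CS _ _)) // ler_wpM2r ?dot_ge0.
  by rewrite mulr_ge0 ?dot_ge0 // ltW.
by rewrite sumr_const card_ord -[leLHS]mulr_natl mulrA.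
Qed.

Let A_above k w : above (16 * n%:R * b2) (A k w).
Proof.
split.
  by rewrite /A linearB linearD linearZ /= G_sym tr_scalar_mx second_moment_sym.
move=> u; rewrite /A mulmxBr mulmxDr dotBl dotDl -scalemxAr dotZl.
rewrite mul_mx_scalar dotZl.
have [_ /(_ u)] := second_moment_above; rewrite mul0r => h1.
have h2 := G_le k w u; have h3 := dot_ge0 u.
have : 0 <= k%:R * a0 * dot (u *m second_moment) u.
  by rewrite mulr_ge0 // mulr_ge0 // /a0; lra.
have : 0 <= n%:R * b2 * dot u u by rewrite mulr_ge0 // ltW.
by rewrite /c -/S2; lra.
Qed.

Let Ap_above k w : above (16 * n%:R * b2) (Ap k w).
Proof.
have [sA hA] := A_above k w; have [sS hS] := second_moment_above.
split; first by rewrite /Ap linearD linearZ /= sA second_moment_sym.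
move=> u; rewrite /Ap mulmxDr dotDl -scalemxAr dotZl; apply: (le_trans (hA u)).
have := hS u; rewrite mul0r => h; rewrite lerDl mulr_ge0 // /a0; lra.
Qed.

Let AS (i : 'I_n) w : A i.+1 w = Ap i w - (f (Z (Some i) w))^T *m f (Z (Some i) w).
Proof.
rewrite /A /Ap /A /G psumS -natr1 mulrDl mul1r scalerDl opprD !addrA.
by rewrite -!addrA; congr (_ + (_ + _)); rewrite addrCA.
Qed.

Let above_le (cc c' : R) (M : 'M[R]_D) : cc <= c' -> above c' M -> above cc M.
Proof.
move=> ccc [sM hM]; split => // u; apply: le_trans (hM u).
by rewrite ler_wpM2r // dot_ge0.
Qed.

(** Adding a0 S costs at most its first order term by Klein's inequality, and
    subtracting the outer product gains at least a0 times its first order term by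
    [tr_rank_one_pow]. The two first order terms have the same mean. *)
Lemma tr_step (i : 'I_n) w :
  \tr (A i.+1 w ^+ n) <= \tr (A i w ^+ n) + n%:R * a0 *
   (\tr (S2 *m Ap i w ^+ n.-1) -
    dot (f (Z (Some i) w) *m Ap i w ^+ n.-1) (f (Z (Some i) w))).
Proof.
set z := f (Z (Some i) w).
have cc : 0 < 16 * n%:R * b2 by rewrite -mulrA mulr_gt0.
have B0 := above_le (ltW cc) (A_above i.+1 w); rewrite (AS i w) -/z in B0 *.
have A0 := above_le (ltW cc) (A_above i w).
have Ap0 := above_le (ltW cc) (Ap_above i w).
have := tr_rank_one_pow cc (Ap_above i w) B0 n.-1.
have := klein_pow n.-1 A0 Ap0; rewrite !prednK //.
rewrite {1}/Ap opprD addrA subrr add0r mulNmx -scalemxAl linearN linearZ /=.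
set X := \tr (S2 *m _); set Y := dot (z *m _) z => h1 h2.
have Y0 : 0 <= Y by apply: above_moment0 Ap0.
have nn : n%:R = 1 + n.-1%:R :> R by rewrite nat1r prednK.
have n1 : 1 <= n%:R :> R by rewrite ler1n.
have h3 : a0 * Y <= (1 - n.-1%:R * dot z z / (16 * n%:R * b2)) * Y.
  rewrite ler_wpM2r // /a0 lerBrDr -lerBrDl ler_pdivrMr //.
  rewrite (_ : (1 - 15 / 16) * _ = n%:R * b2); last by field.
  by rewrite ler_pM ?dot_ge0 ?fb // ler_nat leq_pred.
have : n%:R * (a0 * Y) <= n%:R * ((1 - n.-1%:R * dot z z / (16 * n%:R * b2)) * Y).
  by rewrite ler_wpM2l.
by move: h1 h2; rewrite mulrN mulrBr -!mulrA; lra.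
Qed.

Let bm_mx (M : T -> 'M[R]_D) q : (forall i j, bm (fun w => M w i j)) ->
  forall i j, bm (fun w => (M w ^+ q) i j).
Proof.
move=> bM; elim: q => [|q IH] i j.
  exact: bm_cst.
under eq_fun do rewrite exprS -mulmxE mxE.
by apply: bm_sum => k; exact: bmM.
Qed.

Let sig_mx (M : T -> 'M[R]_D) J q : (forall i j, sig_fun Z J (fun w => M w i j)) ->
  forall i j, sig_fun Z J (fun w => (M w ^+ q) i j).
Proof.
move=> bM; elim: q => [|q IH] i j.
  exact: measurable_cst.
rewrite /sig_fun; under eq_fun do rewrite exprS -mulmxE mxE.
apply: (@measurable_sum _ (g_sigma_algebraType _)) => k.
by apply: measurable_funM; [exact: bM|exact: IH].
Qed.

Let GE k w i j : G k w i j =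
  \sum_(l < n | (l < k)%N) f (Z (Some l) w) 0 i * f (Z (Some l) w) 0 j.
Proof.
rewrite /G /psum summxE; apply: eq_bigr => l _.
by rewrite mxE big_ord1 mxE.
Qed.

Let bmA k i j : bm (fun w => A k w i j).
Proof.
under eq_fun do rewrite !mxE GE; apply: bmB; first exact: bm_cst.
by apply: bm_sum => l; exact: bmM.
Qed.

Let sigA k i j : sig_fun Z (past n k) (fun w => A k w i j).
Proof.
rewrite /sig_fun; under eq_fun do rewrite !mxE GE.
apply: measurable_funB; first exact: measurable_cst.
exact: (@sig_psum _ _ _ _ _ _ Z (fun v => f v 0 i * f v 0 j) k).
Qed.

Let bmAp k i j : bm (fun w => Ap k w i j).
Proof.
under eq_fun do rewrite mxE; apply: bmD; first exact: bmA.
exact: bm_cst.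
Qed.

Let sigAp k i j : sig_fun Z (past n k) (fun w => Ap k w i j).
Proof.
rewrite /sig_fun; under eq_fun do rewrite mxE.
apply: measurable_funD; first exact: sigA.
exact: measurable_cst.
Qed.

Let bm_tr (M : T -> 'M[R]_D) q : (forall i j, bm (fun w => M w i j)) ->
  bm (fun w => \tr (M w ^+ q)).
Proof. by move=> bM; apply: bm_sum => i; exact: bm_mx. Qed.

Lemma tr_Ex_step (i : 'I_n) :
  'E (fun w => \tr (A i.+1 w ^+ n)) <= 'E (fun w => \tr (A i w ^+ n)).
Proof.
pose X w := \tr (S2 *m Ap i w ^+ n.-1).
pose Y w := dot (f (Z (Some i) w) *m Ap i w ^+ n.-1) (f (Z (Some i) w)).
have XE : X = fun w => \sum_k \sum_l S2 l k * (Ap i w ^+ n.-1) k l.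
  apply/funext => w; rewrite /X /mxtrace exchange_big /=; apply: eq_bigr => k _.
  by rewrite mxE.
have YE : Y = fun w => \sum_k \sum_l (Ap i w ^+ n.-1) k l *
    (f (Z (Some i) w) 0 l * f (Z (Some i) w) 0 k).
  apply/funext => w; rewrite /Y /dot exchange_big /=; apply: eq_bigr => l _.
  by rewrite mxE mulr_suml; apply: eq_bigr => k _; ring.
have bmXe k l : bm (fun w => S2 l k * (Ap i w ^+ n.-1) k l).
  by apply: bmZ; apply: bm_mx => *; exact: bmAp.
have bmYe k l : bm (fun w => (Ap i w ^+ n.-1) k l *
    (f (Z (Some i) w) 0 l * f (Z (Some i) w) 0 k)).
  by apply: bmM; [apply: bm_mx => *; exact: bmAp|exact: bmM].
have bX : bm X.
  by rewrite XE; apply: bm_sum => k; exact: bm_sum.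
have bY : bm Y.
  by rewrite YE; apply: bm_sum => k; exact: bm_sum.
have XY : 'E X = 'E Y.
  rewrite XE YE.
  rewrite !Ex_sum => [|k|k]; [|by apply/bm_intg/bm_sum|by apply/bm_intg/bm_sum].
  apply: eq_bigr => k _.
  rewrite !Ex_sum => [|l|l]; [|exact: bm_intg|exact: bm_intg].
  apply: eq_bigr => l _.
  rewrite ExZ; last by apply/bm_intg; apply: bm_mx => *; exact: bmAp.
  rewrite (@iid_Ex _ _ _ _ _ _ _ _ mZ iidZ (fun w => (Ap i w ^+ n.-1) k l)
     (fun v => f v 0 l * f v 0 k)) //.
  - by rewrite mulrC /S2 [second_moment _ _]mxE.
  - by apply: sig_mx => *; exact: sigAp.
  - by apply: bm_mx => *; exact: bmAp.
apply: (@le_trans _ _ ('E (fun w => \tr (A i w ^+ n) + n%:R * a0 * (X w - Y w)))).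
  apply: Ex_le => [||w]; last exact: tr_step.
  - by apply/bm_intg/bm_tr => *; exact: bmA.
  - apply/bm_intg/bmD; first by apply: bm_tr => *; exact: bmA.
    by apply: bmZ; exact: bmB.
rewrite ExD; last by apply/bm_intg/bmZ; exact: bmB.
  rewrite ExZ; last by apply/bm_intg/bmB.
  by rewrite ExB ?XY ?subrr ?mulr0 ?addr0 //; exact: bm_intg.
by apply/bm_intg/bm_tr => *; exact: bmA.
Qed.

(** The trace of A^n minus its first order expansion at c I. The terms of the order
    of the dimension D cancel. *)
Definition cov_gap w :=
  \tr (A n w ^+ n) - D%:R * c ^+ n - n%:R * c ^+ n.-1 * (\tr (A n w) - D%:R * c).

Lemma sig_cov_gap : sig_fun Z (past n n) cov_gap.
Proof.
have strA q : sig_fun Z (past n n) (fun w => \tr (A n w ^+ q)).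
  apply: (@measurable_sum _ (g_sigma_algebraType _)) => i.
  by apply: sig_mx => *; exact: sigA.
rewrite /sig_fun /cov_gap; apply: measurable_funB; first apply: measurable_funB.
- exact: strA.
- exact: measurable_cst.
- apply: measurable_funM; first exact: measurable_cst.
  by apply: measurable_funB; [exact: (strA 1%N)|exact: measurable_cst].
Qed.

Lemma scalar_mx_exp q (x : R) : (x%:M : 'M[R]_D) ^+ q = (x ^+ q)%:M.
Proof.
elim: q => [|q IH]; first by rewrite !expr0.
by rewrite exprS IH -mulmxE -scalar_mxM -exprS.
Qed.

Lemma cov_gap_ge0 w : 0 <= cov_gap w.
Proof.
have cc : 0 <= 16 * n%:R * b2 by rewrite -mulrA mulr_ge0 // ltW.
have cM : above 0 (c%:M : 'M[R]_D).
  split=> [|u]; first exact: tr_scalar_mx.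
  by rewrite mul0r mul_mx_scalar dotZl mulr_ge0 ?dot_ge0 // ltW.
have := klein_pow n.-1 (above_le cc (A_above n w)) cM.
rewrite prednK // !scalar_mx_exp mul_mx_scalar linearZ linearB /= !mxtrace_scalar.
by rewrite -[c ^+ n *+ D]mulr_natl -[c *+ D]mulr_natl /cov_gap; lra.
Qed.

(** The mean of the trace of A k ^ n does not increase with k, and the first order
    term only contributes n / 16 times the trace of the second moment matrix, which
    is at most b2. *)
Lemma cov_gap_Ex : 'E cov_gap <= c ^+ n * (n%:R / 512).
Proof.
have bmtr : bm (fun w => \tr (A n w ^+ n)) by apply: bm_tr => *; exact: bmA.
have bmt : bm (fun w => \tr (A n w)).
  by apply: (@bm_tr (A n) 1) => *; exact: bmA.
have En k : (k <= n)%N -> 'E (fun w => \tr (A k w ^+ n)) <= D%:R * c ^+ n.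
  elim: k => [_|k IH kn].
    rewrite (_ : (fun w => _) = fun=> D%:R * c ^+ n) ?Ex_cst //.
    apply/funext => w; rewrite /A /G psum0 mul0r scale0r addr0 subr0.
    by rewrite scalar_mx_exp mxtrace_scalar mulr_natl.
  by apply: le_trans (tr_Ex_step (Ordinal kn)) _; exact/IH/ltnW.
have trG w : \tr (G n w) = \sum_(i < n) dot (f (Z (Some i) w)) (f (Z (Some i) w)).
  rewrite /G psum_full linear_sum /=; apply: eq_bigr => i _.
  by rewrite mxtrace_mulC mulmx_dot mxtrace_scalar.
have bdot i : bm (fun w => dot (f (Z i w)) (f (Z i w))).
  by apply: bm_sum => j; exact: bmM.
have trS : \tr S2 = 'E (fun w => dot (f (Z None w)) (f (Z None w))).
  rewrite Ex_sum => [|j]; last by apply/bm_intg; exact: bmM.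
  by apply: eq_bigr => i _; rewrite mxE.
have [_ idZ] := iidZ.
have Edot i : 'E (fun w => dot (f (Z i w)) (f (Z i w))) = \tr S2.
  rewrite trS; have mdot : measurable_fun setT (fun v : V => dot (f v) (f v)).
    by apply: (@measurable_sum _ V) => j; exact: mff.
  have h B (mB : measurable B) := idZ None i B mB.
  exact: (proj2 (law_Ex mZ h mdot (bm_intg P (bdot None)))).
have trA w : \tr (A n w) - D%:R * c = n%:R * a0 * \tr S2 -
    \sum_(i < n) dot (f (Z (Some i) w)) (f (Z (Some i) w)).
  by rewrite /A linearB linearD linearZ /= trG mxtrace_scalar -[c *+ D]mulr_natl; ring.
have EtrA : 'E (fun w => \tr (A n w) - D%:R * c) = - (n%:R / 16 * \tr S2).
  rewrite (_ : (fun w => _) = fun w => n%:R * a0 * \tr S2 -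
    \sum_(i < n) dot (f (Z (Some i) w)) (f (Z (Some i) w))); last exact/funext.
  rewrite ExB ?Ex_cst; [|exact: intg_cst|by apply: intg_sum => i; exact: bm_intg].
  rewrite Ex_sum => [|i]; last exact: bm_intg.
  under eq_bigr do rewrite Edot.
  by rewrite sumr_const card_ord -[_ *+ n]mulr_natl /a0; field.
have S2b : \tr S2 <= b2.
  rewrite trS -[leRHS](Ex_cst P); apply: Ex_le => //; [exact: bm_intg|exact: intg_cst].
have b3 : bm (fun w => \tr (A n w) - D%:R * c) by apply: bmB => //; exact: bm_cst.
rewrite /cov_gap ExB; [|by apply/bm_intg/bmB => //; exact: bm_cst|by apply/bm_intg/bmZ].
rewrite ExB ?Ex_cst; [|exact: bm_intg|exact: intg_cst].
rewrite ExZ ?EtrA; last exact: bm_intg.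
have h1 := En n (leqnn _).
have cn : 0 <= n%:R * c ^+ n.-1 by rewrite mulr_ge0 // exprn_ge0 // ltW.
have h2 : n%:R * c ^+ n.-1 * (n%:R / 16 * \tr S2) <= n%:R * c ^+ n.-1 * (n%:R / 16 * b2).
  by rewrite ler_wpM2l // ler_wpM2l // divr_ge0.
have h3 : n%:R * c ^+ n.-1 * (n%:R / 16 * b2) = c ^+ n * (n%:R / 512).
  by rewrite -[in c ^+ n](prednK n0) exprS {2}/c; field.
rewrite -h3; lra.
Qed.

Lemma gap_mono (al be : R) q : c <= be -> be <= al ->
  be ^+ q.+1 - c ^+ q.+1 - q.+1%:R * c ^+ q * (be - c) <=
  al ^+ q.+1 - c ^+ q.+1 - q.+1%:R * c ^+ q * (al - c).
Proof.
move=> cb ba; have b0 : 0 <= be by apply: le_trans cb; exact: ltW.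
have := tangent_pow q (le_trans b0 ba) b0.
have : q.+1%:R * c ^+ q * (al - be) <= q.+1%:R * be ^+ q * (al - be).
  by rewrite ler_wpM2r ?subr_ge0 // ler_wpM2l // lerXn2r // nnegrE ltW.
lra.
Qed.

(** If the conclusion fails for u, then <A n u, u> > c (1 + t) |u|^2, and
    [tr_pow_gap] bounds cov_gap below by the gap of the scalar power at c (1 + t).
    One random variable thus controls all directions at once. *)
Lemma cov_lower_tail t w : 0 <= t ->
  cov_gap w < c ^+ n * ((1 + t) ^+ n - 1 - n%:R * t) ->
  forall u : 'rV[R]_D, 15 / 16 * dot (u *m second_moment) u <=
    n%:R^-1 * \sum_(i < n) dot (f (Z (Some i) w)) u ^+ 2 + 32 * t * b2 * dot u u.
Proof.
move=> t0 gapt u; have [->|un0] := eqVneq u 0.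
  rewrite mul0mx !dot0l !mulr0 addr0 mulr_ge0 ?invr_ge0 // sumr_ge0 // => i _.
  exact: sqr_ge0.
have u2 : 0 < dot u u by rewrite lt_def dot_eq0 un0 dot_ge0.
rewrite leNgt; apply/negP => h.
have nn : 0 < n%:R :> R by rewrite ltr0n.
pose r := (Num.sqrt (dot u u))^-1; pose e := r *: u.
have r2 : r ^+ 2 = (dot u u)^-1 by rewrite exprVn sqr_sqrtr // ltW.
have e1 : dot e e = 1 by rewrite /e dotZl dotZr mulrA -expr2 r2 mulVf ?gt_eqF.
have cc : 0 <= 16 * n%:R * b2 by rewrite -mulrA mulr_ge0 // ltW.
have := tr_pow_gap n.-1 (above_le cc (A_above n w)) (ltW c0) e1 erefl.
rewrite prednK // -/(cov_gap w); set al := dot (e *m A n w) e.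
have be : c * (1 + t) <= al.
  have -> : al = r ^+ 2 * dot (u *m A n w) u.
    by rewrite /al /e -scalemxAl dotZl dotZr mulrA.
  rewrite r2 [leRHS]mulrC ler_pdivlMr //.
  rewrite /A mulmxBr mulmxDr dotBl dotDl -scalemxAr dotZl mul_mx_scalar dotZl.
  rewrite G_quad; under eq_bigl do rewrite ltn_ord.
  move: h; rewrite -(ltr_pM2l nn) mulrDr mulrA mulfV ?gt_eqF // mul1r.
  rewrite -/S2 /a0; set X := \sum_(_ < _) _; set Y := dot (u *m S2) u; rewrite /c.
  lra.
have cb : c <= c * (1 + t) by rewrite ler_peMr ?(ltW c0) // lerDl.
have := gap_mono n.-1 cb be; rewrite prednK // => h1 h2.
have := le_lt_trans (le_trans h1 h2) gapt.
rewrite exprMn.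
have -> : (c ^+ n * (1 + t) ^+ n - c ^+ n - n%:R * c ^+ n.-1 * (c * (1 + t) - c)) =
  c ^+ n * ((1 + t) ^+ n - 1 - n%:R * t).
  by rewrite -[in c ^+ n](prednK n0) -[in X in _ = X * _](prednK n0) [c ^+ n.-1.+1]exprS; ring.
by rewrite ltxx.
Qed.

Lemma cov_gap_tail a : 0 < a ->
  (P [set w | (c ^+ n * a <= cov_gap w)%R] <= (n%:R / 512 / a)%:E)%E.
Proof.
move=> a0'; have cn : 0 < c ^+ n by rewrite exprn_gt0.
apply: le_trans (Ex_markov _ cov_gap_ge0 _) _; last first.
- rewrite lee_fin ler_pdivrMr ?mulr_gt0 // (le_trans cov_gap_Ex) //.
  by rewrite le_eqVlt; apply/orP; left; apply/eqP; field; rewrite gt_eqF.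
- by rewrite mulr_gt0.
have bmtr : bm (fun w => \tr (A n w ^+ n)) by apply: bm_tr => *; exact: bmA.
have bmt : bm (fun w => \tr (A n w)).
  by apply: (@bm_tr (A n) 1) => *; exact: bmA.
apply/bm_intg; apply: bmB; first by apply: bmB => //; exact: bm_cst.
by apply: bmZ; apply: bmB => //; exact: bm_cst.
Qed.

End CovarianceLowerTail.

(** * Bernstein's inequality without centering *)

Section Uncentered.
Context d (T : measurableType d) (R : realType) (P : probability T R).
Context d' (V : measurableType d') (n : nat) (Z : option 'I_n -> T -> V).
Hypothesis mZ : forall i, measurable_fun setT (Z i).
Hypothesis iidZ : iid P Z.
Local Notation "'E f" := (Rintegral P setT f) (at level 10, f at level 9).
Context (D : nat) (f : V -> 'rV[R]_D) (M2 W c : R) (p : nat).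
Hypothesis mf : forall j, measurable_fun setT (fun v => f v 0 j).
Hypothesis fM : forall v, dot (f v) (f v) <= M2.
Hypothesis fW : 'E (fun w => dot (f (Z None w)) (f (Z None w))) <= W.
Hypothesis c0 : 0 < c.
Hypothesis cM : 64 * p.+1%:R ^+ 2 * M2 <= c ^+ 2.
Hypothesis cW : 10 * n%:R * p.+1%:R * W <= c ^+ 2.

Definition mean_row : 'rV[R]_D := \row_j 'E (fun w => f (Z None w) 0 j).
Definition dev_row w : 'rV[R]_D := \sum_(i < n) f (Z (Some i) w) - n%:R *: mean_row.

Let bmf i j : bm (fun w => f (Z i w) 0 j).
Proof.
apply: (@bm_comp _ _ _ _ _ _ _ mZ (fun v => f v 0 j) i) => //.
by exists (1 + M2) => v; exact: entry_le.
Qed.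

Let bmdot i : bm (fun w => dot (f (Z i w)) (f (Z i w))).
Proof. by apply: bm_sum => j; exact: bmM. Qed.

Let g v := f v - mean_row.

Let E_g2 : 'E (fun w => dot (g (Z None w)) (g (Z None w))) =
  'E (fun w => dot (f (Z None w)) (f (Z None w))) - dot mean_row mean_row.
Proof.
rewrite (_ : (fun w => _) = fun w => dot (f (Z None w)) (f (Z None w)) +
   (- 2 * dot (f (Z None w)) mean_row + dot mean_row mean_row)); last first.
  by apply/funext => w; rewrite /g dotBl !dotBr (dotC mean_row (f _)); ring.
have bdm : bm (fun w => dot (f (Z None w)) mean_row).
  by apply: bm_sum => j; apply: bmM => //; exact: bm_cst.
rewrite ExD; [|exact: bm_intg|by apply: bm_intg; apply: bmD; [exact: bmZ|exact: bm_cst]].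
rewrite ExD ?Ex_cst; [|by apply: bm_intg; exact: bmZ|exact: intg_cst].
rewrite ExZ; last exact: bm_intg.
suff -> : 'E (fun w => dot (f (Z None w)) mean_row) = dot mean_row mean_row by ring.
rewrite Ex_sum => [|j]; last by apply: bm_intg; apply: bmM => //; exact: bm_cst.
apply: eq_bigr => j _; rewrite (_ : (fun w => _) = fun w => mean_row 0 j * f (Z None w) 0 j).
  by rewrite ExZ ?[mean_row 0 j]mxE //; exact: bm_intg.
by apply/funext => w; rewrite mulrC.
Qed.

Let EfM : 'E (fun w => dot (f (Z None w)) (f (Z None w))) <= M2.
Proof.
rewrite -[leRHS](Ex_cst P); apply: Ex_le => //; [exact: bm_intg|exact: intg_cst].
Qed.

Let mean_leM : dot mean_row mean_row <= M2.
Proof.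
have := EfM; have : 0 <= 'E (fun w => dot (g (Z None w)) (g (Z None w))).
  by apply: Ex_ge0 => w; exact: dot_ge0.
by rewrite E_g2; lra.
Qed.

Let mg j : measurable_fun setT (fun v => g v 0 j).
Proof.
by under eq_fun do rewrite /g mxE; apply: measurable_funD.
Qed.

Lemma dev_rowE w : psum Z g n w = dev_row w.
Proof.
by rewrite psum_full /g sumrB sumr_const card_ord -scaler_nat.
Qed.

Lemma sig_dev_row : sig_fun Z (past n n) (fun w => dot (dev_row w) (dev_row w)).
Proof.
apply: (@measurable_sum _ (g_sigma_algebraType _)) => j.
have h : sig_fun Z (past n n) (fun w => dev_row w 0 j).
  rewrite /sig_fun; under eq_fun do rewrite -dev_rowE /psum summxE.
  exact: (@sig_psum _ _ _ _ _ _ Z (fun v => g v 0 j) n).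
by apply: measurable_funM.
Qed.

(** Centering decreases the second moment and at most doubles the bound on the
    norm. *)
Lemma bernstein_uncentered :
  (P [set w | (16 * c ^+ 2 <= dot (dev_row w) (dev_row w))%R] <= (expR (- p.+1%:R))%:E)%E.
Proof.
have M20 : 0 <= M2 by apply: le_trans EfM; apply: Ex_ge0 => w; exact: dot_ge0.
have E0 := E_g2; have hmm := dot_ge0 mean_row; have hW := fW.
rewrite (_ : [set w | _] = [set w | 16 * c ^+ 2 <= dot (psum Z g n w) (psum Z g n w)]); last first.
  by apply/funext => w /=; rewrite dev_rowE.
apply: (@vector_bernstein _ _ _ _ _ _ _ _ mZ iidZ _ g (2 * Num.sqrt M2) W) => //.
- move=> v; rewrite exprMn sqr_sqrtr // /g dotBl !dotBr (dotC mean_row).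
  have h1 := fM v; have h2 := mean_leM.
  have := dot_ge0 (f v + mean_row); rewrite dotDl !dotDr (dotC mean_row).
  by rewrite (_ : 2 ^+ 2 = 4); [lra|ring].
- move=> j; under eq_fun do rewrite /g !mxE.
  by rewrite ExB ?Ex_cst ?subrr //; [exact: bm_intg|exact: intg_cst].
- by lra.
- rewrite -(ler_pXn2r (n := 2)) // ?nnegrE ?(ltW c0) ?mulr_ge0 ?sqrtr_ge0 //.
  rewrite !exprMn sqr_sqrtr // (le_trans _ cM) // le_eqVlt; apply/orP; left.
  by apply/eqP; ring.
Qed.

End Uncentered.

(** * Truncation of a sub-Gaussian response *)

Section Population.
Context d (T : measurableType d) (R : realType) (P : probability T R).
Context d' (V : measurableType d') (n : nat) (Z : option 'I_n -> T -> V).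
Hypothesis mZ : forall i, measurable_fun setT (Z i).
Local Notation "'E f" := (Rintegral P setT f) (at level 10, f at level 9).
Context (D : nat) (f : V -> 'rV[R]_D) (b2 : R) (y : V -> R) (be K : R).
Hypothesis mf : forall j, measurable_fun setT (fun v => f v 0 j).
Hypothesis fb : forall v, dot (f v) (f v) <= b2.
Hypothesis my : measurable_fun setT y.
Hypothesis be0 : 0 < be.
Let x0 w := f (Z None w).
Let y0 w := y (Z None w).
Let U w := expR (y0 w ^+ 2 / (8 * be)).
Hypothesis iU : intg P U.
Hypothesis EU : 'E U <= 3.

Definition clip (t : R) : R := if `|t| <= K then t else 0.
Definition pop_rho := 'E (fun w => y (Z None w) ^+ 2).
Definition pop_v : 'rV[R]_D := \row_j 'E (fun w => y (Z None w) * f (Z None w) 0 j).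
Definition pop_vt : 'rV[R]_D := \row_j 'E (fun w => clip (y (Z None w)) * f (Z None w) 0 j).
Local Notation S2 := (second_moment P Z f).

Let my0 : measurable_fun setT y0. Proof. exact: measurableT_comp. Qed.

Let bmx j : bm (fun w => x0 w 0 j).
Proof.
apply: (@bm_comp _ _ _ _ _ _ _ mZ (fun v => f v 0 j) None) => //.
by exists (1 + b2) => v; exact: entry_le.
Qed.

Let bmdot a : bm (fun w => dot (x0 w) a).
Proof. by apply: bm_sum => j; apply: bmM => //; exact: bm_cst. Qed.

Let U_ge w : 1 + y0 w ^+ 2 / (8 * be) <= U w.
Proof. exact: expR_ge1Dx. Qed.

Let y2_le w : y0 w ^+ 2 <= 8 * be * (U w - 1).
Proof.
have := U_ge w; have b := be0; rewrite -lerBrDl ler_pdivrMr; last by lra.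
by move=> h; apply: le_trans h _; rewrite mulrC.
Qed.

Lemma intg_y2 : intg P (fun w => y0 w ^+ 2).
Proof.
have b := be0; apply: (intg_le (g := fun w => 8 * be * (U w - 1))).
- exact: measurable_funX.
- by apply: intgZ; apply: intgB => //; exact: intg_cst.
- move=> w; rewrite ger0_norm ?sqr_ge0 // (le_trans (y2_le w)) // ler_norm //.
Qed.

Lemma intg_y : intg P y0.
Proof.
apply: (intg_le (g := fun w => 1 + y0 w ^+ 2)) => //.
  by apply: intgD; [exact: intg_cst|exact: intg_y2].
move=> w; rewrite [leRHS]ger0_norm; last by rewrite addr_ge0 ?sqr_ge0.
rewrite -[y0 w ^+ 2]real_normK ?num_real //; set t := `|_|.
by have := sqr_ge0 (t - 1); rewrite sqrrB1; have := sqr_ge0 t; lra.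
Qed.

Lemma intgMbm (g h : T -> R) : intg P g -> bm h -> intg P (fun w => g w * h w).
Proof.
move=> ig [mh [M hM]]; have mg := intg_meas ig.
apply: (intg_le (g := fun w => M * g w)); [exact: measurable_funM|exact: intgZ|].
by move=> w; rewrite !normrM mulrC ler_wpM2r // (le_trans (hM w)) // ler_norm.
Qed.

Lemma pop_rho_le : pop_rho <= 16 * be.
Proof.
have b := be0; apply: (@le_trans _ _ ('E (fun w => 8 * be * (U w - 1)))).
  apply: Ex_le; [exact: intg_y2| |exact: y2_le].
  by apply: intgZ; apply: intgB => //; exact: intg_cst.
rewrite ExZ; last by apply: intgB => //; exact: intg_cst.
rewrite ExB ?Ex_cst //; last exact: intg_cst.
have := EU => h; rewrite (_ : 16 * be = 8 * be * 2); last by ring.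
by rewrite ler_wpM2l //; lra.
Qed.

Lemma intg_sq_res a : intg P (fun w => (y0 w - dot (x0 w) a) ^+ 2).
Proof.
rewrite (_ : (fun w => _) = fun w => y0 w ^+ 2 + ((-2) * (y0 w * dot (x0 w) a) + dot (x0 w) a ^+ 2)).
  apply: intgD; first exact: intg_y2.
  apply: intgD; last exact/bm_intg/bmX.
  by apply: intgZ; apply: intgMbm; [exact: intg_y|exact: bmdot].
by apply/funext => w; ring.
Qed.

Lemma pop_vE a : dot pop_v a = 'E (fun w => y0 w * dot (x0 w) a).
Proof.
rewrite (_ : (fun w => _) = fun w => \sum_j a 0 j * (y0 w * x0 w 0 j)); last first.
  by apply/funext => w; rewrite /dot mulr_sumr; apply: eq_bigr => j _; ring.
rewrite Ex_sum => [|j]; last by apply: intgZ; apply: intgMbm; [exact: intg_y|exact: bmx].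
apply: eq_bigr => j _; rewrite ExZ ?mxE 1?mulrC //.
by apply: intgMbm; [exact: intg_y|exact: bmx].
Qed.

Lemma qrisk_Ex a : qrisk pop_rho pop_v S2 a = 'E (fun w => (y0 w - dot (x0 w) a) ^+ 2).
Proof.
rewrite (_ : (fun w => _) = fun w => y0 w ^+ 2 + ((-2) * (y0 w * dot (x0 w) a) + dot (x0 w) a ^+ 2)); last first.
  by apply/funext => w; ring.
have i1 : intg P (fun w => y0 w * dot (x0 w) a) by apply: intgMbm; [exact: intg_y|exact: bmdot].
have i2 : intg P (fun w => dot (x0 w) a ^+ 2) by exact/bm_intg/bmX.
rewrite ExD; [|exact: intg_y2|by apply: intgD => //; exact: intgZ].
rewrite ExD //; last exact: intgZ.
rewrite ExZ // -pop_vE /qrisk (second_moment_quad P mZ mf fb) // /pop_rho; ring.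
Qed.

Lemma qrisk_ge0 a : 0 <= qrisk pop_rho pop_v S2 a.
Proof. by rewrite qrisk_Ex; apply: Ex_ge0 => w; exact: sqr_ge0. Qed.

Let res w := y0 w - clip (y0 w).

Lemma clip_meas : measurable_fun setT clip.
Proof.
rewrite /clip; apply: measurable_fun_ifT => //.
  by apply: measurable_fun_ler => //; exact: measurableT_comp.
Qed.

Lemma clip_le t : 0 <= K -> `|clip t| <= K.
Proof. by move=> K0; rewrite /clip; case: ifP => //; rewrite normr0. Qed.

Let mres : measurable_fun setT res.
Proof. by apply: measurable_funB => //; apply: measurableT_comp => //; exact: clip_meas. Qed.

Hypothesis K0 : 0 <= K.

Let res2_le w : res w ^+ 2 <= 16 * be * expR (- (K ^+ 2 / (16 * be))) * U w.
Proof.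
have b := be0; rewrite /res /clip; case: ifP => [_|/negbT].
  by rewrite subrr expr0n /= !mulr_ge0 ?expR_ge0 ?(ltW b).
rewrite -ltNge subr0 => yK.
(* Half of the exponent of U w absorbs the factor y^2, the other half is large
   beyond the level K. *)
have h1 : y0 w ^+ 2 <= 16 * be * expR (y0 w ^+ 2 / (16 * be)).
  have := expR_ge1Dx (y0 w ^+ 2 / (16 * be)) => h.
  have {h} : y0 w ^+ 2 / (16 * be) <= expR (y0 w ^+ 2 / (16 * be)) by lra.
  by rewrite ler_pdivrMr; [rewrite mulrC|lra].
apply: (le_trans h1); rewrite -[leRHS]mulrA ler_wpM2l //; first lra.
rewrite /U -expRD ler_expR.
have : K ^+ 2 <= y0 w ^+ 2.
  by rewrite -[y0 w ^+ 2]real_normK ?num_real // lerXn2r ?nnegrE // ltW.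
rewrite -subr_ge0 => h; rewrite -subr_ge0.
rewrite (_ : _ - _ = (y0 w ^+ 2 - K ^+ 2) / (16 * be)); last by field; rewrite gt_eqF.
by rewrite divr_ge0 //; lra.
Qed.

Lemma intg_res2 : intg P (fun w => res w ^+ 2).
Proof.
apply: (intg_le (g := fun w => 16 * be * expR (- (K ^+ 2 / (16 * be))) * U w)).
- exact: measurable_funX.
- exact: intgZ.
- by move=> w; rewrite ger0_norm ?sqr_ge0 // (le_trans (res2_le w)) // ler_norm.
Qed.

Lemma res2_Ex_le : 'E (fun w => res w ^+ 2) <= 48 * be * expR (- (K ^+ 2 / (16 * be))).
Proof.
have b := be0; apply: (@le_trans _ _ (16 * be * expR (- (K ^+ 2 / (16 * be))) * 'E U)).
  rewrite -ExZ //; apply: Ex_le; [exact: intg_res2|exact: intgZ|exact: res2_le].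
rewrite (_ : 48 * be * _ = 16 * be * expR (- (K ^+ 2 / (16 * be))) * 3); last by ring.
by rewrite ler_wpM2l // !mulr_ge0 ?expR_ge0 ?(ltW b).
Qed.

Lemma tail_y : (P [set w | (K < `|y0 w|)%R] <= (3 * expR (- (K ^+ 2 / (8 * be))))%:E)%E.
Proof.
have b := be0.
have mU := intg_meas iU.
apply: (@le_trans _ _ (P [set w | (expR (K ^+ 2 / (8 * be)) <= U w)%R])).
  apply: le_measure; rewrite ?inE.
  - by apply: strict_superlevel_measurable; exact: measurableT_comp.
  - exact: superlevel_measurable.
  - move=> w /= Kw; rewrite ler_expR ler_wpM2r ?invr_ge0 //; first lra.
    by rewrite -[y0 w ^+ 2]real_normK ?num_real // lerXn2r ?nnegrE // ltW.
apply: le_trans (Ex_markov iU _ _) _; [by move=> w; exact: expR_ge0|exact: expR_gt0|].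
by rewrite lee_fin expRN ler_wpM2r ?invr_ge0 ?expR_ge0.
Qed.

(** The Cauchy-Schwarz inequality for the residual of clipping and <x, a>. The
    bound is in terms of <a S, a> rather than |a|^2, so that it can be absorbed by
    the excess risk. *)
Lemma clip_bias a : dot (pop_v - pop_vt) a ^+ 2 <=
  48 * be * expR (- (K ^+ 2 / (16 * be))) * dot (a *m S2) a.
Proof.
have bx := bmdot a.
have bc : bm (fun w => clip (y0 w)).
  split; first by apply: measurableT_comp => //; exact: clip_meas.
  by exists K => w; exact: clip_le.
have ires : intg P res by apply: intgB; [exact: intg_y|exact: bm_intg].
have -> : dot (pop_v - pop_vt) a = 'E (fun w => res w * dot (x0 w) a).
  rewrite dotBl pop_vE.
  have -> : dot pop_vt a = 'E (fun w => clip (y0 w) * dot (x0 w) a).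
    rewrite (_ : (fun w => _) = fun w => \sum_j a 0 j * (clip (y0 w) * x0 w 0 j)); last first.
      by apply/funext => w; rewrite /dot mulr_sumr; apply: eq_bigr => j _; ring.
    rewrite Ex_sum => [|j]; last by apply/bm_intg/bmZ; exact: bmM.
    by apply: eq_bigr => j _; rewrite ExZ ?mxE 1?mulrC //; apply: bm_intg; exact: bmM.
  rewrite -ExB; [|by apply: intgMbm; [exact: intg_y|]|by apply: bm_intg; exact: bmM].
  by congr Rintegral; apply/funext => w; rewrite /res mulrBl.
apply: (@le_trans _ _ ('E (fun w => res w ^+ 2) * dot (a *m S2) a)).
  rewrite (second_moment_quad P mZ mf fb); apply: discr_le => t.
  have i1 := intg_res2; have i2 : intg P (fun w => res w * dot (x0 w) a) by exact: intgMbm.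
  have i3 : intg P (fun w => dot (x0 w) a ^+ 2) by exact/bm_intg/bmX.
  have : 0 <= 'E (fun w => (res w + t * dot (x0 w) a) ^+ 2).
    by apply: Ex_ge0 => w; exact: sqr_ge0.
  rewrite (_ : (fun w => _) = fun w => res w ^+ 2 + ((2 * t) * (res w * dot (x0 w) a) + t ^+ 2 * dot (x0 w) a ^+ 2)).
    rewrite ExD //; last by apply: intgD; exact: intgZ.
    rewrite ExD; [|exact: intgZ|exact: intgZ].
    by rewrite !ExZ //; congr (0 <= _); ring.
  by apply/funext => w; ring.
rewrite ler_wpM2r ?res2_Ex_le // (second_moment_quad P mZ mf fb).
by apply: Ex_ge0 => w; exact: sqr_ge0.
Qed.

End Population.

(** * Numerical relations between penalty, radius and sample size *)

Section Numeric.
Context (R : realType).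
Implicit Types (be L lam n r sg P kap : R).

Lemma le_of_sq (a b : R) : 0 <= b -> a ^+ 2 <= b ^+ 2 -> a <= b.
Proof.
move=> b0 h; rewrite real_leNgt ?num_real //; apply/negP => ba.
have h2 : b ^+ 2 < a ^+ 2 by rewrite ltrXn2r // nnegrE // (le_trans b0) // ltW.
by have := lt_le_trans h2 h; rewrite ltxx.
Qed.

(** The parameter kap stands for the large constant of the penalty. It is replaced by
    its lower bound only at the end, where the inequalities become linear with
    numerical coefficients. *)
Lemma drop_factor kap (u t : R) : 1000 * 1000 <= kap -> 0 <= u -> kap * u <= t ->
  1000 * 1000 * u <= t.
Proof. by move=> k u0; apply: le_trans; exact: (ler_wpM2r u0 k). Qed.

Lemma drop_factor2 kap (u t : R) : 1000 * 1000 <= kap -> 0 <= u -> kap ^+ 2 * u <= t ->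
  1000 * 1000 * (1000 * 1000) * u <= t.
Proof.
move=> k u0; apply: le_trans; apply: (ler_wpM2r u0); rewrite expr2.
have h : 0 <= 1000 * 1000 :> R by apply: mulr_ge0; exact: ler0n.
exact: (ler_pM h h k k).
Qed.

Lemma scale_le be L lam n kap : 0 < lam -> 1 <= n ->
  kap ^+ 2 * (be * L) ^+ 2 <= lam ^+ 2 * n -> kap * (be * L) <= lam * n.
Proof.
move=> lam0 n1 F1; apply: le_of_sq; first by rewrite mulr_ge0 ?ltW //; lra.
rewrite !exprMn -exprMn; apply: le_trans F1 _; rewrite ler_wpM2l ?sqr_ge0 //.
by rewrite expr2 ler_peMr; lra.
Qed.

(** The penalty is at least kap be L / sqrt n, while lam r is at most a multiple of
    be; hence r is at most of order sqrt n / (kap L). *)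
Lemma radius_le be L lam n r kap : 0 < be -> 2^-1 <= L -> 0 < lam -> 0 <= r ->
  lam * r <= 17 * be -> 0 <= n ->
  kap ^+ 2 * (be * L) ^+ 2 <= lam ^+ 2 * n ->
  kap ^+ 2 * ((be * L) ^+ 2 * r ^+ 2) <= 1156 * (n * (be * L) ^+ 2).
Proof.
move=> be0 L2 lam0 r0 lamr n0 F1.
have h1 : (lam * r) ^+ 2 <= (17 * be) ^+ 2.
  by rewrite lerXn2r // nnegrE mulr_ge0 // ltW.
have h2 : be ^+ 2 <= 4 * (be * L) ^+ 2.
  have : 1 <= (2 * L) ^+ 2 by rewrite expr_ge1 //; lra.
  move=> /(ler_wpM2l (sqr_ge0 be)); rewrite mulr1 !exprMn; lra.
have h3 : kap ^+ 2 * ((be * L) ^+ 2 * r ^+ 2) <= lam ^+ 2 * n * r ^+ 2.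
  by rewrite mulrA ler_wpM2r ?sqr_ge0.
have h4 : lam ^+ 2 * n * r ^+ 2 <= (17 * be) ^+ 2 * n.
  by rewrite mulrAC -exprMn ler_wpM2r.
apply: (le_trans h3); apply: (le_trans h4).
have := ler_wpM2r n0 h2; rewrite exprMn expr2; lra.
Qed.

(** The conditions of Bernstein's inequality, in dimension free form, for the gradient
    of the loss at a point of norm at most r: the bound on the values and the bound on
    the second moment must be small compared with the square of lam n. *)
Lemma noise_numeric be L lam n r kap P : 0 < be -> 2^-1 <= L -> 0 < lam -> 0 <= r ->
  1 <= n -> 20 * L <= n -> 1000 * 1000 <= kap ->
  kap ^+ 2 * (be * L) ^+ 2 <= lam ^+ 2 * n -> lam * r <= 17 * be ->
  0 <= P -> P <= 6 * L ->
  64 * P ^+ 2 * (2 * be ^+ 2 * (32 * L + r ^+ 2)) <= (lam * n / 1088) ^+ 2 /\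
  10 * n * P * (be ^+ 2 * (64 * L + 196)) <= (lam * n / 1088) ^+ 2.
Proof.
move=> be0 L2 lam0 r0 n1 Ln k F1 lamr P0 PL.
have n0 : 0 <= n by lra.
have L0 : 0 <= L by lra.
have F3 := radius_le be0 L2 lam0 r0 lamr n0 F1.
have A0 := sqr_ge0 (be * L); set A := (be * L) ^+ 2 in F1 F3 A0 *.
have X0 : 0 <= lam ^+ 2 * n ^+ 2 by rewrite mulr_ge0 ?sqr_ge0.
have AL : 0 <= A * L by rewrite mulr_ge0.
have Ar : 0 <= A * r ^+ 2 by rewrite mulr_ge0 ?sqr_ge0.
have h1 : 1000 * 1000 * (1000 * 1000) * (A * n) <= lam ^+ 2 * n ^+ 2.
  apply: (drop_factor2 k); first by rewrite mulr_ge0.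
  rewrite mulrA (_ : lam ^+ 2 * n ^+ 2 = lam ^+ 2 * n * n); last by ring.
  exact: ler_wpM2r.
have h2 : 20 * (A * L) <= A * n by rewrite mulrCA ler_wpM2l.
have h3 : 1000 * 1000 * (1000 * 1000) * (A * r ^+ 2) <= 1156 * (n * A).
  exact: (drop_factor2 k).
have P2 : P ^+ 2 <= 36 * L ^+ 2.
  by rewrite (_ : 36 * L ^+ 2 = (6 * L) ^+ 2); [rewrite lerXn2r // nnegrE mulr_ge0|ring].
have AE : be ^+ 2 * L ^+ 2 = A by rewrite /A exprMn.
have cE : (lam * n / 1088) ^+ 2 = lam ^+ 2 * n ^+ 2 / (1088 * 1088) by field.
split.
- apply: (@le_trans _ _ (64 * (36 * L ^+ 2) * (2 * be ^+ 2 * (32 * L + r ^+ 2)))).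
    have w0 : 0 <= 2 * be ^+ 2 * (32 * L + r ^+ 2).
      by have h := sqr_ge0 be; have h' := sqr_ge0 r; apply: mulr_ge0; clear -h h' L0; lra.
    by apply: (ler_wpM2r w0); clear -P2; lra.
  rewrite (_ : _ * _ = 48 * 96 * (32 * (A * L) + A * r ^+ 2)); last by rewrite -AE; ring.
  by rewrite cE; clear -h1 h2 h3 AL Ar X0 AL; lra.
- apply: (@le_trans _ _ (10 * n * (6 * L) * (be ^+ 2 * (64 * L + 392 * L)))).
    have nP0 : 0 <= n * P by rewrite mulr_ge0.
    have bb := sqr_ge0 be.
    apply: ler_pM; [by clear -nP0; lra|by apply: mulr_ge0 => //; clear -L0; lra| |].
    + by have := ler_wpM2l n0 PL; clear; lra.
    + by apply: (ler_wpM2l bb); clear -L2; lra.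
  rewrite (_ : _ * _ = 160 * 171 * (A * n)); last by rewrite -AE; ring.
  by rewrite cE; clear -h1 X0; lra.
Qed.

(** The same conditions for the difference of the losses at two comparators at
    distance sqrt sg. The deviation c that is allowed has a term proportional to sg, and
    the signal hypothesis on (lam r)^2 makes sg large enough for the variance, which is
    of order be r^2 sg, to be admissible. *)
Lemma gap_numeric be L lam n r kap P sg : 0 < be -> 2^-1 <= L -> 0 < lam -> 16 < r ->
  1 <= n -> 1000 * 1000 <= kap ->
  kap ^+ 2 * (be * L) ^+ 2 <= lam ^+ 2 * n -> lam * r <= 17 * be ->
  (lam * r) ^+ 2 <= 600 * be * sg -> 0 <= sg ->
  0 <= P -> P <= 6 * L ->
  let c := n * (sg / 32 + lam / 68) / 4 in
  64 * P ^+ 2 * (24 * be ^+ 2 * r ^+ 2 * (r ^+ 2 + 64 * L)) <= c ^+ 2 /\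
  10 * n * P * (6 * be * (r ^+ 2 + 64 * L) * sg) <= c ^+ 2.
Proof.
move=> be0 L2 lam0 r16 n1 k F1 lamr H1 sg0 P0 PL.
have n0 : 0 <= n by lra.
have L0 : 0 <= L by lra.
have r0 : 0 <= r by lra.
have b0 := ltW be0.
have rr := sqr_ge0 r.
have k0 : 0 <= kap by lra.
have lb : lam ^+ 2 <= (17 / 16 * be) ^+ 2.
  have h : lam * 16 <= lam * r by rewrite ler_pM2l // ltW.
  by rewrite lerXn2r // ?nnegrE; clear -be0 lam0 h lamr; lra.
(* The two scales of the claim are be L r^2 and be L^2. *)
have Q1 : kap ^+ 2 * (be * L * r ^+ 2) <= 1200 * (sg * n).
  have q : kap ^+ 2 * (be * L) ^+ 2 * r ^+ 2 <= lam ^+ 2 * n * r ^+ 2.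
    by rewrite ler_wpM2r.
  have q2 : lam ^+ 2 * n * r ^+ 2 <= 600 * be * sg * n.
    by rewrite mulrAC -exprMn ler_wpM2r.
  have q3 : be * (kap ^+ 2 * (be * L ^+ 2 * r ^+ 2)) <= be * (600 * sg * n).
    rewrite (_ : be * (kap ^+ 2 * (be * L ^+ 2 * r ^+ 2)) =
      kap ^+ 2 * (be * L) ^+ 2 * r ^+ 2); last by ring.
    by apply: (le_trans q); apply: (le_trans q2); rewrite le_eqVlt; apply/orP; left; apply/eqP; ring.
  rewrite ler_pM2l // in q3.
  have q4 : kap ^+ 2 * (be * L * r ^+ 2) <= 2 * (kap ^+ 2 * (be * L ^+ 2 * r ^+ 2)).
    rewrite (_ : 2 * _ = (2 * L) * (kap ^+ 2 * (be * L * r ^+ 2))); last by ring.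
    rewrite ler_peMl; [by []| |lra].
    by rewrite mulr_ge0 ?sqr_ge0 // mulr_ge0 // mulr_ge0.
  by apply: (le_trans q4); lra.
have Q2 : kap ^+ 2 * (be * L ^+ 2) <= 2 * (lam * n).
  apply: le_of_sq; first by rewrite mulr_ge0 // mulr_ge0 // ltW.
  have q : kap ^+ 2 * L ^+ 2 <= 2 * n.
    have : be ^+ 2 * (kap ^+ 2 * L ^+ 2) <= be ^+ 2 * (2 * n).
      rewrite (_ : _ * _ = kap ^+ 2 * (be * L) ^+ 2); last by ring.
      apply: (le_trans F1); have := ler_wpM2r n0 lb.
      rewrite (_ : (17 / 16 * be) ^+ 2 * n = 289 / 256 * (be ^+ 2 * n)); last by field.
      have : 0 <= be ^+ 2 * n by rewrite mulr_ge0 ?sqr_ge0.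
      by lra.
    by rewrite ler_pM2l // exprn_gt0.
  rewrite (_ : (_ * _) ^+ 2 = (kap ^+ 2 * (be * L) ^+ 2) * (kap ^+ 2 * L ^+ 2)); last by ring.
  apply: (@le_trans _ _ ((lam ^+ 2 * n) * (2 * n))).
    by rewrite ler_pM // mulr_ge0 ?sqr_ge0.
  rewrite (_ : (2 * (lam * n)) ^+ 2 = 4 * (lam ^+ 2 * n * n)); last by ring.
  have : 0 <= lam ^+ 2 * n * n by apply: mulr_ge0 => //; rewrite mulr_ge0 ?sqr_ge0.
  by clear; lra.
have [G1 G2] : 0 <= be * L * r ^+ 2 /\ 0 <= be * L ^+ 2.
  by split; [apply: mulr_ge0 => //; exact: mulr_ge0|rewrite mulr_ge0 ?sqr_ge0].
have q1 := drop_factor2 k G1 Q1; have q2 := drop_factor2 k G2 Q2.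
set a := be * L * r ^+ 2 in G1 q1 *; set b := be * L ^+ 2 in G2 q2 *.
have sn : 0 <= sg * n by rewrite mulr_ge0.
have ln : 0 <= lam * n by rewrite mulr_ge0 // ltW.
have cE : (n * (sg / 32 + lam / 68) / 4) ^+ 2 =
  ((sg * n) ^+ 2 / 1024 + (sg * n) * (lam * n) / 1088 + (lam * n) ^+ 2 / (68 * 68)) / 16 by field.
have sl : 0 <= (sg * n) * (lam * n) by rewrite mulr_ge0.
have ss := sqr_ge0 (sg * n); have ll := sqr_ge0 (lam * n).
have P2 : P ^+ 2 <= 36 * L ^+ 2.
  by rewrite (_ : 36 * L ^+ 2 = (6 * L) ^+ 2); [rewrite lerXn2r // nnegrE mulr_ge0|ring].
have aa : 1000 * 1000 * (1000 * 1000) * a ^+ 2 <= (sg * n) ^+ 2.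
  rewrite (_ : _ * a ^+ 2 = (1000 * 1000 * a) * (1000 * 1000 * a)); last by ring.
  have k1 : 0 <= 1000 * 1000 :> R by apply: mulr_ge0; exact: ler0n.
  rewrite expr2; apply: ler_pM; first [exact: mulr_ge0 | by clear -q1 G1 sn; lra].
have ab : 1000 * 1000 * (1000 * 1000) * (a * b) <= (sg * n) * (lam * n).
  have h1 : 1000 * 1000 * a <= sg * n by clear -q1 G1 sn; lra.
  have h2 : 1000 * 1000 * b <= lam * n by clear -q2 G2 ln; lra.
  rewrite (_ : _ * (a * b) = (1000 * 1000 * a) * (1000 * 1000 * b)); last by ring.
  have k1 : 0 <= 1000 * 1000 :> R by apply: mulr_ge0; exact: ler0n.
  by apply: ler_pM; first [exact: mulr_ge0 | exact: h1 | exact: h2].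
have as_ : 1000 * 1000 * 100 * (a * (sg * n)) <= (sg * n) ^+ 2.
  by rewrite mulrA expr2 ler_wpM2r //; clear -q1 G1 sn; lra.
have bs : 1000 * 1000 * (b * (sg * n)) * 1000 <= (sg * n) * (lam * n).
  rewrite (_ : _ * 1000 = (sg * n) * (1000 * 1000 * 1000 * b)); last by ring.
  by rewrite ler_wpM2l //; clear -q2 G2 ln; lra.
rewrite /= cE; split.
- apply: (@le_trans _ _ (64 * (36 * L ^+ 2) * (24 * be ^+ 2 * r ^+ 2 * (r ^+ 2 + 64 * L)))).
    have w0 : 0 <= 24 * be ^+ 2 * r ^+ 2 * (r ^+ 2 + 64 * L).
      apply: mulr_ge0; last by clear -rr L0; lra.
      by apply: mulr_ge0 => //; have h := sqr_ge0 be; clear -h; lra.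
    by apply: (ler_wpM2r w0); clear -P2; lra.
  rewrite (_ : _ * _ = 72 * 768 * (a ^+ 2 + 64 * (a * b))); last by rewrite /a /b; ring.
  by clear -aa ab as_ bs G1 G2 sl ss ll; lra.
- apply: (@le_trans _ _ (10 * n * (6 * L) * (6 * be * (r ^+ 2 + 64 * L) * sg))).
    have w0 : 0 <= 6 * be * (r ^+ 2 + 64 * L) * sg.
      by apply: mulr_ge0 => //; apply: mulr_ge0; clear -b0 rr L0; lra.
    by apply: (ler_wpM2r w0); have := ler_wpM2l n0 PL; clear; lra.
  rewrite (_ : _ * _ = 360 * (a * (sg * n)) + 240 * 96 * (b * (sg * n))); last by rewrite /a /b; ring.
  by clear -aa ab as_ bs G1 G2 sl ss ll; lra.
Qed.

(** If a comparator has a much smaller norm than the nearly optimal point, its risk must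
    be larger by about lam r, by near optimality. The risk grows by at most
    sg + 2 |dd|, where - 2 dd is the derivative and dd^2 <= q0 sg, so sg cannot be small. *)
Lemma signal_numeric be lam r sg (dd q0 qb Nb zeta : R) : 0 < be -> 0 < lam -> 1 < r ->
  lam * r <= 17 * be -> 0 <= sg -> dd ^+ 2 <= q0 * sg -> q0 <= 17 * be ->
  Nb <= r / 16 -> zeta <= lam / 34 ->
  qb = q0 - 2 * dd + sg -> q0 + lam * r - zeta <= qb + lam * Nb ->
  (lam * r) ^+ 2 <= 600 * be * sg.
Proof.
move=> be0 lam0 r1 lamr sg0 dd2 q0b Nbr zl qbE base.
have lr0 : 0 <= lam * r by rewrite mulr_ge0 ?ltW //; lra.
have h1 : lam * Nb <= lam * (r / 16) by rewrite ler_wpM2l // ltW.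
have h2 : lam <= lam * r by rewrite ler_peMr ?ltW.
have h3 : lam * r <= 2 * (sg + 2 * `|dd|).
  have := ler_norm (- dd); rewrite normrN; lra.
have [sb|sb] := leP be sg.
  have : (lam * r) ^+ 2 <= (17 * be) ^+ 2 by rewrite lerXn2r // nnegrE mulr_ge0 // ltW.
  have : be * be <= be * sg by rewrite ler_wpM2l // ltW.
  have : 0 <= be * sg by rewrite mulr_ge0 // ltW.
  by rewrite (_ : (17 * be) ^+ 2 = 289 * (be * be)); [lra|ring].
have d2 : `|dd| ^+ 2 <= 17 * be * sg.
  by rewrite real_normK ?num_real // (le_trans dd2) // ler_wpM2r.
have : (lam * r) ^+ 2 <= (2 * (sg + 2 * `|dd|)) ^+ 2.
  by rewrite lerXn2r // nnegrE mulr_ge0 // addr_ge0 // mulr_ge0.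
have : (2 * (sg + 2 * `|dd|)) ^+ 2 <= 8 * sg ^+ 2 + 32 * `|dd| ^+ 2.
  rewrite -subr_ge0 (_ : _ - _ = 4 * (sg - 2 * `|dd|) ^+ 2); last by ring.
  by rewrite mulr_ge0 // sqr_ge0.
have : sg ^+ 2 <= be * sg by rewrite expr2 ler_wpM2r // ltW.
have : 0 <= be * sg by rewrite mulr_ge0 // ltW.
by lra.
Qed.

(** The smallness condition on the estimation errors in [oracle_deterministic], for
    the values of tau and nu that the probabilistic estimates provide. *)
Lemma size_numeric be (b2 : R) L lam n r kap (Na nu : R) : 0 < be -> 0 <= b2 -> b2 <= be ->
  2^-1 <= L -> 0 < lam -> 1 <= n -> 0 <= r -> 0 <= Na -> 1000 * 1000 <= kap ->
  kap ^+ 2 * (be * L) ^+ 2 <= lam ^+ 2 * n -> lam * r <= 17 * be ->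
  lam * Na <= 32 * be * L -> nu = lam / 136 + 14 * be / n ->
  640 * L * b2 / n * (Na + r) + nu <= lam / 34.
Proof.
move=> be0 b20 b2be L2 lam0 n1 r0 Na0 k F1 lamr lamN ->.
have n0 : 0 < n by lra.
have L0 : 0 <= L by lra.
have F2 := scale_le lam0 n1 F1.
have bL : 0 <= be * L by rewrite mulr_ge0 // ltW.
have h1 := drop_factor k bL F2.
have h2 := drop_factor2 k (sqr_ge0 _) F1.
have bL2 : be <= 2 * (be * L).
  have h : 1 <= 2 * L by clear -L2; lra.
  by have := ler_wpM2l (ltW be0) h; clear; lra.
have h3 : 14 * be / n <= lam / 1000.
  rewrite ler_pdivrMr //; clear -h1 bL2 bL be0 F2 ; lra.
have h4 : lam * (Na + r) <= 66 * (be * L).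
  by rewrite mulrDr; clear -lamN lamr bL2 bL; lra.
have h5 : 640 * L * b2 / n * (Na + r) <= lam / 1000.
  rewrite -(ler_pM2l (mulr_gt0 lam0 n0)).
  rewrite (_ : lam * n * _ = 640 * (L * b2) * (lam * (Na + r))); last by field; rewrite gt_eqF.
  apply: (@le_trans _ _ (640 * (be * L) * (66 * (be * L)))).
    have Lb0 : 0 <= L * b2 by rewrite mulr_ge0.
    have Lb : L * b2 <= be * L by rewrite mulrC ler_wpM2r.
    have h6 : 0 <= lam * (Na + r) by apply: mulr_ge0; [exact: ltW|exact: addr_ge0].
    apply: ler_pM; [by clear -Lb0; lra|exact: h6|by clear -Lb; lra|exact: h4].
  rewrite (_ : _ * _ = 640 * 66 * (be * L) ^+ 2); last by ring.
  rewrite (_ : lam * n * _ = lam ^+ 2 * n / 1000); last by field.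
  by clear -h2; have := sqr_ge0 (be * L); lra.
by clear -h3 h5 lam0; lra.
Qed.

End Numeric.

(** * Exceptional events of the sample *)

Section RareEvents.
Context d (T : measurableType d) (R : realType) (P : probability T R).
Context d' (V : measurableType d') (n : nat) (Z : option 'I_n -> T -> V).
Hypothesis mZ : forall i, measurable_fun setT (Z i).
Local Notation "'E f" := (Rintegral P setT f) (at level 10, f at level 9).

(** An explicit event of the sample stands in for the complement of Q, which may fail
    to be measurable. *)
Definition mostly (p : R) (Q : T -> Prop) := exists A : set T,
  [/\ sig_sample Z (past n n) A, (P A <= p%:E)%E & forall w, ~ A w -> Q w].

Lemma mostlyW p q (Q Q' : T -> Prop) : p <= q -> (forall w, Q w -> Q' w) ->
  mostly p Q -> mostly q Q'.
Proof.
move=> pq QQ [A [sA pA AQ]]; exists A; split => //; last by move=> w /AQ /QQ.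
by rewrite (le_trans pA) // lee_fin.
Qed.

Lemma mostlyT (Q : T -> Prop) : (forall w, Q w) -> mostly 0 Q.
Proof.
move=> h; exists set0; split; [|by rewrite measure0|by []].
exact: (@measurable0 _ (g_sigma_algebraType (gen_sample Z (past n n)))).
Qed.

Lemma mostlyI p q (Q Q' : T -> Prop) : mostly p Q -> mostly q Q' ->
  mostly (p + q) (fun w => Q w /\ Q' w).
Proof.
move=> [A [sA pA AQ]] [B [sB pB BQ]]; exists (A `|` B); split.
- exact: (@measurableU _ (g_sigma_algebraType (gen_sample Z (past n n)))).
- have mA := sig_sample_measurable mZ sA; have mB := sig_sample_measurable mZ sB.
  by apply: le_trans (measureU2 _ mA mB) _; rewrite EFinD leeD.
- by move=> w /not_orP[/AQ ? /BQ ?].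
Qed.

Lemma mostly_all (I : eqType) (s : seq I) p (Q : I -> T -> Prop) :
  {in s, forall i, mostly p (Q i)} ->
  mostly ((size s)%:R * p) (fun w => {in s, forall i, Q i w}).
Proof.
elim: s => [_|i s IH h]; first by rewrite mul0r; apply: mostlyT => w i.
have h1 := h i (mem_head _ _).
have {}IH := IH (fun j js => h j (@mem_behead _ (i :: s) j js)).
apply: mostlyW (mostlyI h1 IH); first by rewrite /= -natr1 mulrDl mul1r addrC.
by move=> w [q1 q2] j; rewrite inE => /orP[/eqP ->|/q2].
Qed.

End RareEvents.

Section SampleEvents.
Context d (T : measurableType d) (R : realType) (P : probability T R).
Context d' (V : measurableType d') (n : nat) (Z : option 'I_n -> T -> V).
Hypothesis mZ : forall i, measurable_fun setT (Z i).
Hypothesis iidZ : iid P Z.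
Local Notation "'E f" := (Rintegral P setT f) (at level 10, f at level 9).
Local Notation mostly := (mostly P Z).
Context (D : nat) (f : V -> 'rV[R]_D) (b2 : R) (y : V -> R) (be K : R).
Hypothesis mf : forall j, measurable_fun setT (fun v => f v 0 j).
Hypothesis fb : forall v, dot (f v) (f v) <= b2.
Hypothesis b20 : 0 < b2.
Hypothesis my : measurable_fun setT y.
Hypothesis be0 : 0 < be.
Let U w := expR (y (Z None w) ^+ 2 / (8 * be)).
Hypothesis iU : intg P U.
Hypothesis EU : 'E U <= 3.
Hypothesis K0 : 0 <= K.
Hypothesis n0 : (0 < n)%N.
Local Notation S := (second_moment P Z f).
Local Notation v := (pop_v P Z f y).
Local Notation vt := (pop_vt P Z f y K).
Local Notation rho := (pop_rho P Z y).
Local Notation yt x := (clip K (y x)).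

Definition emp_v w : 'rV[R]_D := n%:R^-1 *: \sum_(i < n) yt (Z (Some i) w) *: f (Z (Some i) w).
Definition emp_S w : 'M[R]_D := n%:R^-1 *: \sum_(i < n) (f (Z (Some i) w))^T *m f (Z (Some i) w).
Definition emp_rho w : R := n%:R^-1 * \sum_(i < n) yt (Z (Some i) w) ^+ 2.

Let nR : 0 < n%:R :> R. Proof. by rewrite ltr0n. Qed.

Lemma emp_S_sym w : (emp_S w)^T = emp_S w.
Proof.
rewrite /emp_S linearZ linear_sum /=; congr (_ *: _); apply: eq_bigr => i _.
by rewrite trmx_mul trmxK.
Qed.

Lemma mulmx_emp_S u w : u *m emp_S w =
  n%:R^-1 *: \sum_(i < n) dot (f (Z (Some i) w)) u *: f (Z (Some i) w).
Proof.
rewrite /emp_S -scalemxAr mulmx_sumr; congr (_ *: _); apply: eq_bigr => i _.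
by rewrite mulmxA mulmx_dot mul_scalar_mx dotC.
Qed.

Lemma emp_S_quad w u : dot (u *m emp_S w) u =
  n%:R^-1 * \sum_(i < n) dot (f (Z (Some i) w)) u ^+ 2.
Proof.
rewrite mulmx_emp_S dotZl dotC dot_sumr; congr (_ * _).
by apply: eq_bigr => i _; rewrite dotZr dotC expr2.
Qed.

Lemma emp_qrisk w u : qrisk (emp_rho w) (emp_v w) (emp_S w) u =
  n%:R^-1 * \sum_(i < n) (yt (Z (Some i) w) - dot (f (Z (Some i) w)) u) ^+ 2.
Proof.
rewrite /qrisk emp_S_quad /emp_rho /emp_v dotZl dotC dot_sumr mulrCA -mulrBr -mulrDr.
congr (_ * _); rewrite mulr_sumr -sumrB -big_split; apply: eq_bigr => i _ /=.
by rewrite dotZr dotC; ring.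
Qed.

Let f_bound j x : `|f x 0 j| <= 1 + b2. Proof. exact: entry_le. Qed.

Let myt : measurable_fun setT (fun x => yt x).
Proof. by apply: measurableT_comp => //; exact: clip_meas. Qed.

Let bmf i j : bm (fun w => f (Z i w) 0 j).
Proof.
by apply: (@bm_comp _ _ _ _ _ _ _ mZ (fun x => f x 0 j) i) => //; exists (1 + b2).
Qed.

Let bmyt i : bm (fun w => yt (Z i w)).
Proof.
apply: (@bm_comp _ _ _ _ _ _ _ mZ (fun x => yt x) i) => //.
by exists K => x; exact: clip_le.
Qed.

Let bmdot i u : bm (fun w => dot (f (Z i w)) u).
Proof. by apply: bm_sum => j; apply: bmM => //; exact: bm_cst. Qed.

Let mdot u : measurable_fun setT (fun x => dot (f x) u).
Proof. by apply: measurable_sum => j; apply: measurable_funM. Qed.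

Let dot2 x u : dot (f x) u ^+ 2 <= b2 * dot u u.
Proof. by rewrite (le_trans (dot_CS _ _)) // ler_wpM2r ?dot_ge0. Qed.

Let yt2 x : yt x ^+ 2 <= K ^+ 2.
Proof.
by rewrite -[_ ^+ 2]real_normK ?num_real // lerXn2r ?nnegrE //; exact: clip_le.
Qed.

Lemma clip_event : mostly (n%:R * (3 * expR (- (K ^+ 2 / (8 * be)))))
  (fun w => forall i : 'I_n, `|y (Z (Some i) w)| <= K).
Proof.
have mB : measurable [set x | K < `|y x|].
  by apply: strict_superlevel_measurable; exact: measurableT_comp.
have h : {in index_enum 'I_n, forall i, mostly (3 * expR (- (K ^+ 2 / (8 * be))))
  (fun w => `|y (Z (Some i) w)| <= K)}.
  move=> i _; exists (Z (Some i) @^-1` [set x | K < `|y x|]); split.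
  - by apply: sub_sigma_algebra; exists (Some i), [set x | K < `|y x|]; split => //; rewrite inE.
  - rewrite (iidZ.2 _ None) //; exact: (tail_y mZ my be0 iU EU K0).
  - by move=> w /= /negP; rewrite -leNgt.
apply: mostlyW (mostly_all mZ h); first by rewrite /index_enum -enumT -cardE card_ord.
by move=> w hw i; apply: hw; exact: mem_index_enum.
Qed.

Let raw b (x : V) : 'rV[R]_D := (yt x - dot (f x) b) *: f x.

Let mean_raw b : mean_row P Z (raw b) = vt - b *m S.
Proof.
apply/rowP => j; rewrite !mxE.
have -> : (fun w => raw b (Z None w) 0 j) = fun w => yt (Z None w) * f (Z None w) 0 j -
   \sum_k b 0 k * (f (Z None w) 0 k * f (Z None w) 0 j).
  apply/funext => w; rewrite /raw mxE mulrBl; congr (_ - _).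
  by rewrite /dot mulr_suml; apply: eq_bigr => k _; ring.
have bff k : bm (fun w => f (Z None w) 0 k * f (Z None w) 0 j) by exact: bmM.
rewrite ExB; [|by apply/bm_intg/bmM|by apply/bm_intg/bm_sum => k; exact: bmZ].
congr (_ - _); rewrite Ex_sum => [|k]; last by apply/bm_intg/bmZ.
by apply: eq_bigr => k _; rewrite ExZ ?mxE //; exact: bm_intg.
Qed.

Let sum_raw b w : \sum_(i < n) raw b (Z (Some i) w) = n%:R *: (emp_v w - b *m emp_S w).
Proof.
rewrite mulmx_emp_S -scalerBr scalerA mulfV ?gt_eqF // scale1r -sumrB.
by apply: eq_bigr => i _; rewrite /raw scalerBl.
Qed.

Let bias u : `|2 * dot (v - vt) u| <= 2 * Num.sqrt (48 * be * expR (- (K ^+ 2 / (16 * be))) * dot (u *m S) u).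
Proof.
have h := clip_bias mZ mf fb my be0 iU EU K0 u.
rewrite normrM ger0_norm // ler_wpM2l // -sqrtr_sqr ler_wsqrtr //.
Qed.

(** Bernstein's inequality for the gradient at b of the clipped loss, that is for the
    vectors (clip y - <x, b>) x, plus the bias of clipping. It is uniform in u because
    the Euclidean norm of the whole gradient is bounded. *)
Lemma noise_event b (c r2 s2 : R) p : 0 < c -> dot b b <= r2 ->
  dot (b *m S) b <= s2 ->
  64 * p.+1%:R ^+ 2 * (2 * b2 * (K ^+ 2 + b2 * r2)) <= c ^+ 2 ->
  10 * n%:R * p.+1%:R * (2 * b2 * (K ^+ 2 + s2)) <= c ^+ 2 ->
  mostly (expR (- p.+1%:R)) (fun w => forall u,
    `|2 * dot ((v - b *m S) - (emp_v w - b *m emp_S w)) u| <=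
    (8 * c / n%:R + 2 * Num.sqrt (48 * be * b2 * expR (- (K ^+ 2 / (16 * be))))) *
      Num.sqrt (dot u u)).
Proof.
move=> c0 br bs cM cW.
have hb := b20.
have mraw j : measurable_fun setT (fun x => raw b x 0 j).
  by under eq_fun do rewrite mxE; apply: measurable_funM => //; apply: measurable_funB.
have rawE x : dot (raw b x) (raw b x) = (yt x - dot (f x) b) ^+ 2 * dot (f x) (f x).
  by rewrite /raw dotZl dotZr mulrA expr2.
have sq x : (yt x - dot (f x) b) ^+ 2 <= 2 * (yt x ^+ 2 + dot (f x) b ^+ 2).
  by have := sqr_ge0 (yt x + dot (f x) b); rewrite !expr2; lra.
have rawM x : dot (raw b x) (raw b x) <= 2 * b2 * (K ^+ 2 + b2 * r2).
  rewrite rawE (_ : 2 * b2 * _ = 2 * (K ^+ 2 + b2 * r2) * b2); last by ring.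
  apply: ler_pM; rewrite ?sqr_ge0 ?dot_ge0 //; apply: le_trans (sq x) _.
  rewrite ler_wpM2l // lerD // (le_trans (dot2 _ _)) // ler_wpM2l //; exact: ltW.
have rawW : 'E (fun w => dot (raw b (Z None w)) (raw b (Z None w))) <= 2 * b2 * (K ^+ 2 + s2).
  apply: (@le_trans _ _ ('E (fun w => 2 * b2 * (K ^+ 2 + dot (f (Z None w)) b ^+ 2)))).
    apply: Ex_le.
    - apply: bm_intg; apply: (@bm_sum _ _ _ _ _ _ (fun j w => _)) => j.
      by rewrite /raw; apply: bmM; under eq_fun do rewrite mxE; apply: bmM => //; apply: bmB.
    - by apply/bm_intg/bmZ; apply: bmD; [exact: bm_cst|exact: bmX].
    - move=> w; rewrite rawE (_ : 2 * b2 * _ = 2 * (K ^+ 2 + dot (f (Z None w)) b ^+ 2) * b2); last by ring.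
      apply: ler_pM; rewrite ?sqr_ge0 ?dot_ge0 //; apply: le_trans (sq _) _.
      by rewrite ler_wpM2l // lerD2r.
  rewrite ExZ; last by apply: bm_intg; apply: bmD; [exact: bm_cst|exact: bmX].
  rewrite ExD ?Ex_cst; [|exact: intg_cst|by apply/bm_intg/bmX].
  rewrite -(second_moment_quad P mZ mf fb) ler_wpM2l ?mulr_ge0 ?(ltW b20) //.
  by rewrite lerD2l.
have sB : sig_fun Z (past n n) (fun w => dot (dev_row P Z (raw b) w) (dev_row P Z (raw b) w)).
  exact: sig_dev_row.
exists [set w | 16 * c ^+ 2 <= dot (dev_row P Z (raw b) w) (dev_row P Z (raw b) w)]; split.
- exact: sig_superlevel.
- exact: (bernstein_uncentered mZ iidZ mraw rawM rawW c0 cM cW).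
- move=> w /= /negP; rewrite -ltNge => hw u.
  have dE : dev_row P Z (raw b) w = n%:R *: ((emp_v w - b *m emp_S w) - (vt - b *m S)).
    by rewrite /dev_row sum_raw mean_raw -scalerBr.
  have -> : 2 * dot ((v - b *m S) - (emp_v w - b *m emp_S w)) u =
    2 * dot (v - vt) u - n%:R^-1 * (2 * dot (dev_row P Z (raw b) w) u).
    rewrite dE dotZl [n%:R^-1 * _]mulrCA mulKf ?gt_eqF // -mulrBr -dotBl.
    by congr (_ * dot _ _); rewrite !opprB; apply/rowP => j; rewrite !mxE; ring.
  apply: le_trans (ler_normB _ _) _; rewrite [leRHS]mulrDl [leLHS]addrC; apply: lerD.
    rewrite !normrM (ger0_norm (ltW _)) ?invr_gt0 // (ger0_norm (ler0n _ 2)).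
    rewrite (_ : 8 * c / n%:R * _ = n%:R^-1 * (2 * (4 * c * Num.sqrt (dot u u)))); last by ring.
    rewrite ler_wpM2l ?invr_ge0 // ler_wpM2l //.
    rewrite -sqrtr_sqr; apply: le_trans (ler_wsqrtr (dot_CS _ _)) _.
    rewrite sqrtrM ?dot_ge0 // ler_wpM2r ?sqrtr_ge0 //.
    rewrite -[leRHS]ger0_norm ?mulr_ge0 ?(ltW c0) // -sqrtr_sqr ler_wsqrtr //.
    by rewrite exprMn (_ : 4 ^+ 2 = 16) ?ltW //; ring.
  apply: le_trans (bias u) _; rewrite -[leRHS]mulrA ler_wpM2l //.
  rewrite -sqrtrM; last by rewrite !mulr_ge0 ?expR_ge0 ?(ltW be0) ?(ltW b20).
  apply: ler_wsqrtr.
  rewrite (_ : _ * b2 * _ * _ = 48 * be * expR (- (K ^+ 2 / (16 * be))) * (b2 * dot u u)); last by ring.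
  rewrite ler_wpM2l ?(second_moment_le P mZ mf fb) //.
  by rewrite !mulr_ge0 ?expR_ge0 ?(ltW be0).
Qed.

(** Clipping preserves the exponential moment condition, so [qrisk_Ex] applies to the
    clipped response. *)
Lemma qrisk_clip a : qrisk ('E (fun w => yt (Z None w) ^+ 2)) vt S a =
  'E (fun w => (yt (Z None w) - dot (f (Z None w)) a) ^+ 2).
Proof.
have Ut w : expR (yt (Z None w) ^+ 2 / (8 * be)) <= U w.
  have hbe := be0.
  rewrite /U ler_expR ler_wpM2r ?invr_ge0 //; first by lra.
  by rewrite /clip; case: ifP => // _; rewrite expr0n /= sqr_ge0.
have mUt : measurable_fun setT (fun w => expR (yt (Z None w) ^+ 2 / (8 * be))).
  apply: measurableT_comp => //; apply: measurable_funM => //.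
  by apply: measurable_funX; exact: (bmyt None).1.
have iUt : intg P (fun w => expR (yt (Z None w) ^+ 2 / (8 * be))).
  apply: (intg_le mUt iU) => w.
  by rewrite !ger0_norm ?expR_ge0.
exact: (qrisk_Ex mZ mf fb myt be0 iUt a).
Qed.

Let gap b a (x : V) : 'rV[R]_1 :=
  ((yt x - dot (f x) b) ^+ 2 - (yt x - dot (f x) a) ^+ 2)%:M.

Let bmres i u : bm (fun w => (yt (Z i w) - dot (f (Z i w)) u) ^+ 2).
Proof. by apply: bmX; apply: bmB. Qed.

(** The scalar case of Bernstein's inequality for the difference of the clipped losses
    at b and a. It factors as <x, b - a> (<x, b + a> - 2 clip y), which bounds its
    second moment by a multiple of s2. *)
Lemma gap_event b a (c m2 s0 : R) p :
  let s2 := dot ((b - a) *m S) (b - a) in 0 < c ->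
  dot (b - a) (b - a) <= m2 -> dot (b + a) (b + a) <= m2 ->
  64 * p.+1%:R ^+ 2 * (b2 * m2 * (2 * (b2 * m2 + 4 * K ^+ 2))) <= c ^+ 2 ->
  10 * n%:R * p.+1%:R * (2 * (b2 * m2 + 4 * K ^+ 2) * s2) <= c ^+ 2 ->
  s0 = 2 * Num.sqrt (48 * be * expR (- (K ^+ 2 / (16 * be))) * s2) ->
  mostly (expR (- p.+1%:R)) (fun w =>
    (qrisk rho v S b - qrisk (emp_rho w) (emp_v w) (emp_S w) b) -
    (qrisk rho v S a - qrisk (emp_rho w) (emp_v w) (emp_S w) a) <=
    4 * c / n%:R + s0).
Proof.
move=> s2 c0 bm2 pm2 cM cW ->.
have hb := b20; have hK := sqr_ge0 K.
have gapE x : gap b a x 0 0 = dot (f x) (b - a) * (dot (f x) (b + a) - 2 * yt x).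
  by rewrite mxE mulr1n dotBr dotDr; ring.
have gdot x : dot (gap b a x) (gap b a x) = gap b a x 0 0 ^+ 2.
  by rewrite /dot big_ord1 expr2.
have fac x : (dot (f x) (b + a) - 2 * yt x) ^+ 2 <= 2 * (b2 * m2 + 4 * K ^+ 2).
  apply: (@le_trans _ _ (2 * (dot (f x) (b + a) ^+ 2 + 4 * yt x ^+ 2))).
    by have := sqr_ge0 (dot (f x) (b + a) + 2 * yt x); rewrite !expr2; lra.
  rewrite ler_wpM2l //; apply: lerD; last by rewrite ler_wpM2l.
  by apply: le_trans (dot2 _ _) _; rewrite ler_wpM2l // ltW.
have mg j : measurable_fun setT (fun x => gap b a x 0 j).
  rewrite ord1; under eq_fun do rewrite gapE.
  by apply: measurable_funM => //; apply: measurable_funB => //; apply: measurable_funM.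
have gM x : dot (gap b a x) (gap b a x) <= b2 * m2 * (2 * (b2 * m2 + 4 * K ^+ 2)).
  rewrite gdot gapE exprMn; apply: ler_pM; rewrite ?sqr_ge0 //.
  by apply: le_trans (dot2 _ _) _; rewrite ler_wpM2l // ltW.
have gW : 'E (fun w => dot (gap b a (Z None w)) (gap b a (Z None w))) <=
    2 * (b2 * m2 + 4 * K ^+ 2) * s2.
  rewrite /s2 (second_moment_quad P mZ mf fb) -ExZ; last by apply/bm_intg/bmX.
  apply: Ex_le.
  - apply: bm_intg; under eq_fun do rewrite gdot gapE; apply: bmX; apply: bmM => //.
    by apply: bmB => //; apply: bmZ.
  - by apply/bm_intg/bmZ/bmX.
  - by move=> w; rewrite gdot gapE exprMn [leRHS]mulrC ler_wpM2l ?sqr_ge0.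
have sB : sig_fun Z (past n n) (fun w => dot (dev_row P Z (gap b a) w) (dev_row P Z (gap b a) w)).
  exact: sig_dev_row.
exists [set w | 16 * c ^+ 2 <= dot (dev_row P Z (gap b a) w) (dev_row P Z (gap b a) w)]; split.
- exact: sig_superlevel.
- exact: (bernstein_uncentered mZ iidZ mg gM gW c0 cM cW).
- move=> w /= /negP; rewrite -ltNge => hw.
  set dv := dev_row P Z (gap b a) w in hw.
  have dE : dv 0 0 = n%:R *
    ((qrisk (emp_rho w) (emp_v w) (emp_S w) b - qrisk (emp_rho w) (emp_v w) (emp_S w) a) -
     (qrisk ('E (fun w => yt (Z None w) ^+ 2)) vt S b - qrisk ('E (fun w => yt (Z None w) ^+ 2)) vt S a)).
    rewrite !emp_qrisk !qrisk_clip /dv /dev_row !mxE summxE -mulrBr [RHS]mulrBr mulVKf ?gt_eqF //.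
    congr (_ - _ * _); last first.
      by rewrite -ExB; try exact: bm_intg; congr Rintegral; apply/funext => t; rewrite mxE mulr1n.
    by rewrite -sumrB; apply: eq_bigr => i _; rewrite mxE mulr1n.
  have pq u : qrisk rho v S u = qrisk ('E (fun w => yt (Z None w) ^+ 2)) vt S u +
     (rho - 'E (fun w => yt (Z None w) ^+ 2)) - 2 * dot (v - vt) u.
    by rewrite /qrisk dotBl; ring.
  have -> : qrisk rho v S b - qrisk (emp_rho w) (emp_v w) (emp_S w) b -
    (qrisk rho v S a - qrisk (emp_rho w) (emp_v w) (emp_S w) a) =
    - (n%:R^-1 * dv 0 0) - 2 * dot (v - vt) (b - a).
    by rewrite dE mulKf ?gt_eqF // !pq dotBr; ring.
  apply: lerD; last first.
    by apply: le_trans (ler_norm _) _; rewrite normrN; exact: bias.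
  apply: le_trans (ler_norm _) _; rewrite normrN normrM ger0_norm ?invr_ge0 // mulrC.
  rewrite ler_wpM2r ?invr_ge0 //.
  rewrite -[leRHS]ger0_norm ?mulr_ge0 ?(ltW c0) // -sqrtr_sqr -[leRHS]sqrtr_sqr ler_wsqrtr //.
  move: hw; rewrite /dot big_ord1 -expr2 => /ltW h; apply: (le_trans h).
  by rewrite exprMn (_ : 4 ^+ 2 = 16) //; ring.
Qed.

End SampleEvents.

(** * The oracle inequality with high probability *)

Section Analytic.
Context (R : realType).

Lemma near_infimum (V : Type) (Q : V -> Prop) (g : V -> R) (a0 : V) (zeta : R) :
  Q a0 -> (forall a, 0 <= g a) -> 0 < zeta ->
  exists b, Q b /\ forall a, Q a -> g b <= g a + zeta.
Proof.
move=> Qa0 g0 z0; pose E : set R := [set g a | a in [set a | Q a]].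
have hE : has_inf E.
  by split; [exists (g a0), a0|exists 0 => _ [a _ <-]].
have [_ [b Qb <-] gb] := inf_adherent z0 hE.
exists b; split => // a Qa; apply: (le_trans (ltW gb)); rewrite lerD2r.
by apply: (ge_inf hE.2); exists a.
Qed.

Lemma exp_half_le (t : R) : 0 <= t -> t <= 1 -> expR (t / 2) <= 1 + t.
Proof.
move=> t0 t1; have h1 := expR_ge1Dx (- (t / 2)).
rewrite -[expR _]invrK -expRN.
have h2 : 1 <= (1 + t) * (1 - t / 2).
  have := mulr_ge0 t0 (_ : 0 <= 1 - t); rewrite subr_ge0 => /(_ t1); lra.
rewrite -div1r ler_pdivrMr ?expR_gt0 //; apply: le_trans h2 _.
by rewrite ler_wpM2l //; lra.
Qed.

Lemma ln_ge_half (n : nat) : (2 <= n)%N -> 2^-1 <= ln n%:R :> R.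
Proof.
move=> n2; apply: (@le_trans _ _ (ln 2)); last first.
  by rewrite ler_ln ?posrE ?ltr0n ?ler_nat // (leq_trans _ n2).
have h : 1 <= ln (4 : R).
  by rewrite -ler_expR lnK ?posrE ?expR1_le4 // ltr0n.
have -> : ln 2 = ln (4 : R) / 2 :> R.
  have -> : (4 : R) = 2 * 2 by rewrite -natrM.
  by rewrite lnM ?posrE ?ltr0n //; field.
by lra.
Qed.

(** For t = 20 L / n the power is at least e^(10 L), which dominates both the linear
    terms and e^L. *)
Lemma expR_power_gap (L t : R) (n : nat) : 2^-1 <= L -> 0 <= t -> t <= 1 ->
  n%:R * t = 20 * L -> expR L / 8 <= (1 + t) ^+ n - 1 - n%:R * t.
Proof.
move=> L2 t0 t1 ntE; rewrite ntE.
have h1 : expR (10 * L) <= (1 + t) ^+ n.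
  have -> : 10 * L = n%:R * (t / 2) by rewrite mulrA ntE; field.
  by rewrite expRM_natl lerXn2r ?nnegrE ?expR_ge0 ?exp_half_le //; lra.
have h2 : expR (10 * L) = expR (4 * L) ^+ 2 * expR (2 * L).
  by rewrite -expRM_natl -expRD; congr expR; ring.
have h3 := expR_ge1Dx (4 * L); have h4 := expR_ge1Dx (2 * L).
have h5 : 1 + 16 * L <= expR (4 * L) ^+ 2.
  have : (1 + 4 * L) ^+ 2 <= expR (4 * L) ^+ 2 by rewrite lerXn2r ?nnegrE ?expR_ge0 //; lra.
  have : L * 2^-1 <= L * L by rewrite ler_wpM2l //; lra.
  by rewrite sqrrD; lra.
have h6 : expR L <= expR (2 * L) by rewrite ler_expR; lra.
have h7 : (1 + 16 * L) * expR (2 * L) <= expR (10 * L).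
  by rewrite h2 ler_wpM2r ?expR_ge0.
have h8 : 32 * L <= 16 * L * expR (2 * L).
  rewrite (_ : 32 * L = 16 * L * 2); last by ring.
  by rewrite ler_wpM2l //; lra.
have := expR_gt0 L; lra.
Qed.

Lemma le_twice_mul (be L : R) : 0 < be -> 2^-1 <= L -> be <= 2 * (be * L).
Proof.
move=> be0 L2; have h : 1 <= 2 * L by lra.
by have := ler_wpM2l (ltW be0) h; clear; lra.
Qed.

Lemma small_sample_numeric (be b2 L lam n kap : R) : 0 < be -> 0 <= b2 -> b2 <= be ->
  2^-1 <= L -> 0 < lam -> 1000 * 1000 <= kap -> n < 20 * L ->
  kap ^+ 2 * (be * L) ^+ 2 <= lam ^+ 2 * n ->
  16 * be <= lam /\ 4 * (32 * be * L * b2) < lam ^+ 2.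
Proof.
move=> be0 b20 b2be L2 lam0 k nL lamE.
have L0 : 0 < L by clear -L2; lra.
have lk : kap ^+ 2 * (be * (be * L)) <= 20 * lam ^+ 2.
  rewrite -(ler_pM2l L0).
  rewrite (_ : L * _ = kap ^+ 2 * (be * L) ^+ 2); last by ring.
  apply: (le_trans lamE); rewrite (_ : L * _ = lam ^+ 2 * (20 * L)); last by ring.
  by rewrite ler_wpM2l ?sqr_ge0 // ltW.
have bb0 : 0 <= be * (be * L) by apply: mulr_ge0; [exact: ltW|apply: mulr_ge0; exact: ltW].
have hk := drop_factor2 k bb0 lk.
have h3 := ler_wpM2l (ltW be0) (le_twice_mul be0 L2).
split.
  apply: le_of_sq; first exact: ltW.
  rewrite (_ : (16 * be) ^+ 2 = 16 * 16 * (be * be)); last by ring.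
  by clear -hk bb0 h3; lra.
have h : be * L * b2 <= be * (be * L).
  by rewrite [leRHS]mulrC; apply: ler_wpM2l => //; apply: mulr_ge0; exact: ltW.
have l2 : 0 < lam ^+ 2 by rewrite exprn_gt0.
by clear -h hk l2 bb0; lra.
Qed.

Lemma radius_le_size (be L lam n kap r : R) : 0 < be -> 2^-1 <= L -> 0 < lam ->
  1000 * 1000 <= kap -> kap * (be * L) <= lam * n -> lam * r <= 17 * be -> r <= n.
Proof.
move=> be0 L2 lam0 k kL lr; rewrite -(ler_pM2l lam0).
have bL : 0 <= be * L by apply: mulr_ge0; [exact: ltW|by clear -L2; lra].
have h1 := drop_factor k bL kL; have h2 := le_twice_mul be0 L2.
by clear -h1 h2 lr bL; lra.
Qed.

Lemma truncation_bias_noise (be b2 n eps : R) : 0 < be -> 0 <= b2 -> b2 <= be -> 0 < n ->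
  0 <= eps -> eps <= n ^- 2 -> 2 * Num.sqrt (48 * be * b2 * eps) <= 14 * be / n.
Proof.
move=> be0 b20 b2be n0 e0 en.
rewrite (_ : 14 * be / n = 2 * (7 * be / n)); last by field; rewrite gt_eqF.
have h0 : 0 <= 7 * be / n by rewrite divr_ge0 ?(ltW n0) // mulr_ge0 // ltW.
rewrite ler_wpM2l // -[leRHS]ger0_norm // -sqrtr_sqr ler_wsqrtr //.
have -> : (7 * be / n) ^+ 2 = 49 * (be * be) * n ^- 2 by field; rewrite gt_eqF.
have bb : be * b2 <= be * be by rewrite ler_wpM2l // ltW.
have bb0 : 0 <= be * b2 by rewrite mulr_ge0 // ltW.
by apply: ler_pM => //; clear -bb bb0; lra.
Qed.

(** The arithmetic-geometric inequality splits the root into a fraction of sg and a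
    term of order be / n^2, negligible compared with the penalty. *)
Lemma truncation_bias_gap (be L lam n eps sg kap : R) : 0 < be -> 2^-1 <= L ->
  0 <= lam -> 1 <= n -> 1000 * 1000 <= kap -> kap * (be * L) <= lam * n ->
  0 <= sg -> 0 <= eps -> eps <= n ^- 2 ->
  2 * Num.sqrt (48 * be * eps * sg) <= sg / 32 + lam / 68.
Proof.
move=> be0 L2 lam0 n1 k kL sg0 e0 en.
have n0 : 0 < n by clear -n1; lra.
have bL : 0 <= be * L by apply: mulr_ge0; [exact: ltW|by clear -L2; lra].
have h1 := drop_factor k bL kL; have h2 := le_twice_mul be0 L2.
have ben : 16 * 96 * (be * n ^- 2) <= lam / 68.
  have h3 : be * n ^- 2 <= be / n.
    by rewrite ler_wpM2l ?(ltW be0) // lef_pV2 ?posrE ?exprn_gt0 // expr2 ler_peMr ?(ltW n0).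
  have h4 : 16 * 96 * (be / n) <= lam / 68.
    by rewrite mulrA ler_pdivrMr //; clear -h1 h2 bL; lra.
  by clear -h3 h4; lra.
have ee : be * eps <= be * n ^- 2 by rewrite ler_wpM2l // ltW.
have be_eps : 0 <= be * eps by rewrite mulr_ge0 // ltW.
set s := Num.sqrt _; have s0 : 0 <= s by exact: sqrtr_ge0.
have sE : s ^+ 2 = 48 * be * eps * sg.
  by rewrite sqr_sqrtr // -mulrA -mulrA mulrA -mulrA; apply: mulr_ge0 => //; rewrite mulrA mulr_ge0.
have h5 : (2 * s) ^+ 2 <= (sg / 32 + 16 * 96 * (be * eps)) ^+ 2.
  have -> : (2 * s) ^+ 2 = 4 * s ^+ 2 by ring.
  rewrite sE -subr_ge0 (_ : _ - _ = (sg / 32 - 16 * 96 * (be * eps)) ^+ 2) ?sqr_ge0 //.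
  by field.
have h6 : 2 * s <= sg / 32 + 16 * 96 * (be * eps).
  by apply: le_of_sq h5; clear -sg0 be_eps; lra.
by clear -h6 ee ben; lra.
Qed.

Lemma noise_moments (be b2 K2 L r n P C : R) : 0 <= be -> 0 <= b2 -> b2 <= be -> 0 <= L ->
  0 <= n -> 0 <= P -> K2 = 32 * be * L ->
  64 * P ^+ 2 * (2 * be ^+ 2 * (32 * L + r ^+ 2)) <= C ->
  10 * n * P * (be ^+ 2 * (64 * L + 196)) <= C ->
  64 * P ^+ 2 * (2 * b2 * (K2 + b2 * r ^+ 2)) <= C /\
  10 * n * P * (2 * b2 * (K2 + 98 * be)) <= C.
Proof.
move=> be0 b20 bb L0 n0 P0 -> h1 h2.
have rr := sqr_ge0 r; have PP := sqr_ge0 P; have nP := mulr_ge0 n0 P0.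
have beL := mulr_ge0 be0 L0.
split; [apply: le_trans h1|apply: le_trans h2].
- apply: ler_wpM2l; first by clear -PP; lra.
  rewrite (_ : 2 * be ^+ 2 * _ = 2 * be * (32 * be * L + be * r ^+ 2)); last by ring.
  have w : b2 * r ^+ 2 <= be * r ^+ 2 by rewrite ler_wpM2r.
  have w0 : 0 <= b2 * r ^+ 2 by rewrite mulr_ge0.
  by apply: ler_pM; clear -b20 bb w w0 beL; lra.
- apply: ler_wpM2l; first by clear -nP; lra.
  rewrite (_ : be ^+ 2 * _ = 2 * be * (32 * be * L + 98 * be)); last by ring.
  by apply: ler_wpM2r; clear -be0 bb beL; lra.
Qed.

Lemma gap_moments (be b2 K2 L r n P C sg : R) : 0 <= be -> 0 <= b2 -> b2 <= be -> 0 <= L ->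
  0 <= n -> 0 <= P -> K2 = 32 * be * L -> 0 <= sg ->
  64 * P ^+ 2 * (24 * be ^+ 2 * r ^+ 2 * (r ^+ 2 + 64 * L)) <= C ->
  10 * n * P * (6 * be * (r ^+ 2 + 64 * L) * sg) <= C ->
  64 * P ^+ 2 * (b2 * (3 * r ^+ 2) * (2 * (b2 * (3 * r ^+ 2) + 4 * K2))) <= C /\
  10 * n * P * (2 * (b2 * (3 * r ^+ 2) + 4 * K2) * sg) <= C.
Proof.
move=> be0 b20 bb L0 n0 P0 -> sg0 h1 h2.
have rr := sqr_ge0 r; have PP := sqr_ge0 P; have nP := mulr_ge0 n0 P0.
have beL := mulr_ge0 be0 L0.
have w : b2 * r ^+ 2 <= be * r ^+ 2 by rewrite ler_wpM2r.
have w0 : 0 <= b2 * r ^+ 2 by rewrite mulr_ge0.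
split; [apply: le_trans h1|apply: le_trans h2].
- apply: ler_wpM2l; first by clear -PP; lra.
  rewrite (_ : 24 * be ^+ 2 * _ * _ = (3 * (be * r ^+ 2)) * (8 * (be * r ^+ 2) + 8 * 64 * (be * L))); last by ring.
  by apply: ler_pM; clear -b20 bb w w0 beL; lra.
- apply: ler_wpM2l; first by clear -nP; lra.
  rewrite (_ : 6 * be * _ * _ = (6 * (be * r ^+ 2) + 6 * 64 * (be * L)) * sg); last by ring.
  by apply: ler_wpM2r => //; clear -w w0 beL; lra.
Qed.

(** The exceptional events: the clipping of n responses, the covariance, the noise at
    the nearly optimal point, and the noise and the gap at n further comparators. *)
Lemma failure_budget (n X E4 EP : R) : 2 <= n -> 0 <= X -> EP <= E4 ->
  E4 <= X / n ^+ 4 ->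
  n * (3 * E4) + X / 64 + EP + n * (EP + EP) <= X.
Proof.
move=> n2 X0 PE E4X.
have n0 : 0 < n by clear -n2; lra.
have h : n * E4 <= X / 8.
  apply: (@le_trans _ _ (n * (X / n ^+ 4))); first by rewrite ler_wpM2l // ltW.
  rewrite (_ : n * _ = X / n ^+ 3); last by field; rewrite gt_eqF.
  rewrite ler_wpM2l // lef_pV2 ?posrE ?exprn_gt0 //.
  by rewrite (_ : 8 = 2 ^+ 3) ?lerXn2r ?nnegrE ?(ltW n0) // -natrX.
have h2 : n * EP <= n * E4 by rewrite ler_wpM2l // ltW.
have h3 : EP <= X / 16.
  apply: (le_trans PE); apply: (le_trans E4X).
  rewrite ler_wpM2l // lef_pV2 ?posrE ?exprn_gt0 //.
  by rewrite (_ : 16 = 2 ^+ 4) ?lerXn2r ?nnegrE ?(ltW n0) // -natrX.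
by clear -h h2 h3 X0; lra.
Qed.

End Analytic.

Section SmallSample.
Context (R : realType) (D : nat) (N : 'rV[R]_D -> R).
Context (rhon : R) (vn : 'rV[R]_D) (Sn : 'M[R]_D) (lam g : R) (ah : 'rV[R]_D).

(** When the penalty exceeds the norm 2 g of the gradient at the origin, the origin is
    the only minimizer. *)
Lemma penalized_minimizer_eq0 :
  (forall a, 0 <= N a) -> (forall a, dot a a <= N a ^+ 2) -> N 0 = 0 ->
  (forall u, 0 <= dot (u *m Sn) u) -> (forall u, dot vn u ^+ 2 <= g ^+ 2 * dot u u) ->
  0 <= g -> 2 * g < lam ->
  qrisk rhon vn Sn ah + lam * N ah <= qrisk rhon vn Sn 0 + lam * N 0 ->
  ah = 0.
Proof.
move=> N0 N2 N00 S0 vb g0 gl; rewrite N00 /qrisk mul0mx !dot0r.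
have h : `|dot vn ah| <= g * N ah.
  rewrite -(ler_pXn2r (n := 2)) // ?nnegrE ?mulr_ge0 //.
  rewrite real_normK ?num_real // exprMn (le_trans (vb _)) // ler_wpM2l ?sqr_ge0 //.
have h2 := ler_norm (dot vn ah); have h3 := S0 ah; have h4 := N0 ah.
move=> h5; have h6 : (lam - 2 * g) * N ah <= 0 by lra.
have Nah : N ah = 0.
  apply/eqP; rewrite eq_le h4 andbT -(pmulr_rle0 _ (_ : 0 < lam - 2 * g)) //; lra.
apply/eqP; rewrite -dot_eq0 eq_le dot_ge0 andbT; apply: le_trans (N2 _) _.
by rewrite Nah expr0n.
Qed.

End SmallSample.

Section HighProbability.
Context d (T : measurableType d) (R : realType) (P : probability T R).
Context d' (V : measurableType d') (n : nat) (Z : option 'I_n -> T -> V).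
Hypothesis mZ : forall i, measurable_fun setT (Z i).
Hypothesis iidZ : iid P Z.
Local Notation "'E f" := (Rintegral P setT f) (at level 10, f at level 9).
Local Notation mostly := (mostly P Z).
Context (D : nat) (f : V -> 'rV[R]_D) (b2 : R) (y : V -> R) (be K : R).
Hypothesis mf : forall j, measurable_fun setT (fun v => f v 0 j).
Hypothesis fb : forall v, dot (f v) (f v) <= b2.
Hypothesis b20 : 0 < b2.
Hypothesis my : measurable_fun setT y.
Hypothesis be0 : 0 < be.
Hypothesis iU : intg P (fun w => expR (y (Z None w) ^+ 2 / (8 * be))).
Hypothesis EU : 'E (fun w => expR (y (Z None w) ^+ 2 / (8 * be))) <= 3.
Hypothesis K0 : 0 <= K.
Context (N : 'rV[R]_D -> R) (lam x kap : R).
Hypothesis N0 : forall a, 0 <= N a.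
Hypothesis N00 : N 0 = 0.
Hypothesis N2 : forall a, dot a a <= N a ^+ 2.
Hypothesis Nmid : forall a b, N (2^-1 *: a + 2^-1 *: b) <= (N a + N b) / 2.
Hypothesis b2be : b2 <= be.
Hypothesis n2 : (2 <= n)%N.
Hypothesis x0 : 0 < x.
Let L := x + ln n%:R.
Hypothesis KE : K ^+ 2 = 32 * be * L.
Hypothesis kap_large : 1000 * 1000 <= kap.
Hypothesis lam0 : 0 < lam.
Hypothesis lamE : kap ^+ 2 * (be * L) ^+ 2 <= lam ^+ 2 * n%:R.

Local Notation S := (second_moment P Z f).
Local Notation v := (pop_v P Z f y).
Local Notation rho := (pop_rho P Z y).
Local Notation vn := (emp_v Z f y K).
Local Notation Sn := (emp_S Z f).
Local Notation rhon := (emp_rho Z y K).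
Let q := qrisk rho v S.
Let F a := q a + lam * N a.
Let Fs := inf (range F).

Let n0 : (0 < n)%N. Proof. exact: ltn_trans n2. Qed.
Let nR : 1 <= n%:R :> R. Proof. by rewrite ler1n. Qed.
Let nR0 : 0 < n%:R :> R. Proof. by rewrite ltr0n. Qed.
Let L2 : 2^-1 <= L.
Proof. by have := ln_ge_half R n2; have := x0; rewrite /L; lra. Qed.
Let L0 : 0 <= L. Proof. by have := L2; lra. Qed.

Let expL : expR (- L) = expR (- x) / n%:R.
Proof. by rewrite /L opprD expRD [expR (- ln _)]expRN lnK // posrE. Qed.

Let exp_small k : expR (- (k.+1%:R * L)) <= expR (- x) / n%:R ^+ k.+1.
Proof.
rewrite -mulrN expRM_natl expL exprMn exprVn ler_wpM2r ?invr_ge0 ?exprn_ge0 //.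
rewrite exprS ler_piMr ?expR_ge0 // exprn_ile1 ?expR_ge0 //.
by rewrite -expR0 ler_expR oppr_le0 ltW.
Qed.

Let S0 u : 0 <= dot (u *m S) u.
Proof.
by rewrite (second_moment_quad P mZ mf fb); apply: Ex_ge0 => w; exact: sqr_ge0.
Qed.

Let Ssym : S^T = S. Proof. exact: second_moment_sym. Qed.

Let q_ge0 a : 0 <= q a.
Proof. exact: (qrisk_ge0 mZ mf fb my be0 iU). Qed.

Let F_ge0 a : 0 <= F a.
Proof. by rewrite addr_ge0 // mulr_ge0 // ltW. Qed.

Let hasF : has_inf (range F).
Proof. by split; [exists (F 0), 0|exists 0 => _ [a _ <-]]. Qed.

Lemma penalized_risk_inf_le a : Fs <= q a + lam * N a.
Proof. by apply: (ge_inf hasF.2); exists a. Qed.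

Let Fs_ge0 : 0 <= Fs.
Proof. by apply: lb_le_inf; [exact: hasF.1|move=> _ [a _ <-]]. Qed.

Let rho_le : rho <= 16 * be.
Proof. exact: (pop_rho_le mZ my be0 iU EU). Qed.

Let F00 : F 0 = rho.
Proof. by rewrite /F N00 /q /qrisk mul0mx !dot0r; ring. Qed.

Let quad_le a : dot (a *m S) a <= 2 * q a + 2 * rho.
Proof.
have := q_ge0 (2^-1 *: a); rewrite /q /qrisk -scalemxAl dotZl !dotZr; lra.
Qed.

Lemma covariance_event : 20 * L <= n%:R -> mostly (expR (- x) / 64) (fun w => forall u,
  15 / 16 * dot (u *m S) u <= dot (u *m Sn w) u + 640 * L * b2 / n%:R * dot u u).
Proof.
move=> Ln; pose t := 20 * L / n%:R.
have t0 : 0 <= t by rewrite divr_ge0 ?(ltW nR0) // mulr_ge0.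
have t1 : t <= 1 by rewrite ler_pdivrMr // mul1r.
have nt : n%:R * t = 20 * L by rewrite mulrC divfK // gt_eqF.
have g := expR_power_gap L2 t0 t1 nt.
have a0 : 0 < expR L / 8 by rewrite divr_gt0 ?expR_gt0.
have sB : sig_fun Z (past n n) (cov_gap P Z f b2) by exact: sig_cov_gap.
exists [set w | (32 * n%:R * b2) ^+ n * (expR L / 8) <= cov_gap P Z f b2 w]; split.
- exact: sig_superlevel.
- apply: le_trans (cov_gap_tail mZ iidZ mf b20 fb n0 a0) _.
  rewrite lee_fin le_eqVlt; apply/orP; left; apply/eqP.
  rewrite invfM invrK -expRN expL; field; rewrite gt_eqF //.
- move=> w /= /negP; rewrite -ltNge => hw u.
  have h : cov_gap P Z f b2 w < (32 * n%:R * b2) ^+ n * ((1 + t) ^+ n - 1 - n%:R * t).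
    apply: lt_le_trans hw _; rewrite ler_wpM2l // exprn_ge0 //.
    by rewrite mulr_ge0 ?(ltW b20) // mulr_ge0.
  have := cov_lower_tail mZ mf b20 fb n0 t0 h u.
  rewrite emp_S_quad (_ : 32 * t * b2 = 640 * L * b2 / n%:R) // /t.
  by field; rewrite gt_eqF.
Qed.

Definition penalized_minimizer w ah := forall b,
  n%:R^-1 * \sum_(i < n) (y (Z (Some i) w) - dot (f (Z (Some i) w)) ah) ^+ 2 + lam * N ah <=
  n%:R^-1 * \sum_(i < n) (y (Z (Some i) w) - dot (f (Z (Some i) w)) b) ^+ 2 + lam * N b.

Let Good w := forall i : 'I_n, `|y (Z (Some i) w)| <= K.

Let qn w := qrisk (rhon w) (vn w) (Sn w).

Let qnE w b : Good w ->
  n%:R^-1 * \sum_(i < n) (y (Z (Some i) w) - dot (f (Z (Some i) w)) b) ^+ 2 = qn w b.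
Proof.
move=> gw; rewrite /qn emp_qrisk; congr (_ * _); apply: eq_bigr => i _.
by rewrite /clip gw.
Qed.

Let minE w ah : Good w -> penalized_minimizer w ah ->
  forall b, qn w ah + lam * N ah <= qn w b + lam * N b.
Proof. by move=> gw h b; rewrite -!qnE. Qed.

Let rhon_le w : rhon w <= K ^+ 2.
Proof.
rewrite /emp_rho ler_pdivrMl // mulr_natl -[n in leRHS](card_ord n) -sumr_const.
apply: ler_sum => i _.
by rewrite -[_ ^+ 2]real_normK ?num_real // lerXn2r ?nnegrE //; exact: clip_le.
Qed.

Let qn0 w : qn w 0 = rhon w.
Proof. by rewrite /qn /qrisk mul0mx !dot0r; ring. Qed.

Let Sn0 w u : 0 <= dot (u *m Sn w) u.
Proof.
by rewrite emp_S_quad mulr_ge0 ?invr_ge0 ?(ltW nR0) // sumr_ge0 // => i _; exact: sqr_ge0.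
Qed.

Let pen_le w ah : Good w -> penalized_minimizer w ah -> lam * N ah <= K ^+ 2.
Proof.
move=> gw h; have := minE gw h 0; rewrite qn0 N00 mulr0 addr0.
have : 0 <= qn w ah.
  rewrite /qn emp_qrisk mulr_ge0 ?invr_ge0 ?(ltW nR0) // sumr_ge0 // => i _.
  exact: sqr_ge0.
by have := rhon_le w; lra.
Qed.

Let vn_le w u : dot (vn w) u ^+ 2 <= (K ^+ 2 * b2) * dot u u.
Proof.
have h i : `|dot (clip K (y (Z (Some i) w)) *: f (Z (Some i) w)) u| <= K * Num.sqrt (b2 * dot u u).
  rewrite dotZl normrM; apply: ler_pM => //; first exact: clip_le.
  rewrite -sqrtr_sqr ler_wsqrtr // (le_trans (dot_CS _ _)) // ler_wpM2r ?dot_ge0 //.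
have : `|dot (vn w) u| <= K * Num.sqrt (b2 * dot u u).
  rewrite /emp_v dotZl dotC dot_sumr normrM ger0_norm ?invr_ge0 ?(ltW nR0) //.
  rewrite ler_pdivrMl // mulr_natl -[n in leRHS](card_ord n) -sumr_const.
  apply: (le_trans (ler_norm_sum _ _ _)); apply: ler_sum => i _.
  by rewrite dotC.
have k0 : 0 <= K * Num.sqrt (b2 * dot u u) by rewrite mulr_ge0 ?sqrtr_ge0.
move=> h2; rewrite -[leLHS]real_normK ?num_real //.
have : `|dot (vn w) u| ^+ 2 <= (K * Num.sqrt (b2 * dot u u)) ^+ 2.
  by rewrite lerXn2r ?nnegrE.
by rewrite exprMn sqr_sqrtr ?mulrA // mulr_ge0 ?dot_ge0 // ltW.
Qed.

Let kapL : kap * (be * L) <= lam * n%:R.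
Proof. exact: (scale_le lam0 nR lamE). Qed.

Let beL : be <= 2 * (be * L).
Proof. exact: le_twice_mul. Qed.

(** For n < 20 L the penalty is so large that the estimator vanishes, and the risk
    of 0 is at most lam. *)
Lemma small_sample_oracle : n%:R < 20 * L ->
  forall w ah, Good w -> penalized_minimizer w ah -> q ah <= Fs + lam.
Proof.
move=> nL w ah gw hah.
have [b_lam kb] := small_sample_numeric be0 (ltW b20) b2be L2 lam0 kap_large nL lamE.
suff -> : ah = 0.
  have := Fs_ge0; have := rho_le; have := F00; rewrite /F N00; rewrite mulr0 addr0 => -> h1 h2; apply: (le_trans h1); apply: (le_trans b_lam).
  by rewrite lerDr.
apply: (penalized_minimizer_eq0 (g := Num.sqrt (K ^+ 2 * b2)) N0 N2 N00 (Sn0 w) _ _ _ (minE gw hah 0)).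
- by move=> u; rewrite sqr_sqrtr ?vn_le // mulr_ge0 ?sqr_ge0 ?ltW.
- exact: sqrtr_ge0.
- rewrite -(ltr_pXn2r (n := 2)) // ?nnegrE ?(ltW lam0) ?mulr_ge0 ?sqrtr_ge0 //.
  rewrite exprMn sqr_sqrtr; last by rewrite mulr_ge0 ?sqr_ge0 ?ltW.
  by rewrite KE -natrX.
Qed.

Let eps := expR (- (K ^+ 2 / (16 * be))).

Let epsE : eps = expR (- (2%:R * L)).
Proof. by rewrite /eps KE; congr (expR (- _)); field; rewrite gt_eqF. Qed.

Let eps_le : eps <= n%:R ^- 2.
Proof.
rewrite epsE; apply: (le_trans (exp_small 1)).
by rewrite ler_piMl ?invr_ge0 ?exprn_ge0 ?(ltW nR0) // -expR0 ler_expR oppr_le0 ltW.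
Qed.

Let eps0 : 0 <= eps. Proof. exact: expR_ge0. Qed.

Let tailE : 3 * expR (- (K ^+ 2 / (8 * be))) = 3 * expR (- (4%:R * L)).
Proof. by rewrite KE; congr (_ * expR (- _)); field; rewrite gt_eqF. Qed.

Let clip_good : mostly (n%:R * (3 * expR (- (4%:R * L)))) Good.
Proof. by rewrite -tailE; exact: (clip_event mZ iidZ my be0 iU EU K0). Qed.

Let zeta := Num.min (lam / 34) be.

Let zeta0 : 0 < zeta.
Proof. by rewrite lt_min be0 divr_gt0. Qed.

Let near_oracle : exists a0, F a0 <= Fs + zeta.
Proof.
have [a0 [_ h]] := @near_infimum R _ (fun=> True) F 0 zeta I F_ge0 zeta0.
exists a0; rewrite -lerBlDr; apply: lb_le_inf; first exact: hasF.1.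
by move=> _ [a _ <-]; rewrite lerBlDr; exact: h.
Qed.

Let level k a := F a - Fs <= k.+1%:R * lam /\ F a - Fs <= 17 * be.

Let near_min_norm a0 : F a0 <= Fs + zeta -> exists B : nat -> 'rV[R]_D,
  forall k, level k (B k) /\ forall a, level k a -> N (B k) <= N a + 1.
Proof.
move=> Fa0; suff /choice[B hB] : forall k, exists b,
    level k b /\ forall a, level k a -> N b <= N a + 1 by exists B.
move=> k; apply: (@near_infimum R _ (level k) N a0 1) => //.
have h : F a0 - Fs <= zeta by rewrite lerBlDl.
split; apply: (le_trans h); rewrite /zeta ge_min; apply/orP.
  left; apply: (@le_trans _ _ lam); last by rewrite ler_peMl ?ler1n // ltW.
  by rewrite ler_pdivrMr ?ltr0n // ler_peMr ?ler1n // ltW.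
by right; rewrite ler_peMl ?ler1n // ltW.
Qed.

(** A bound for the gradient of the estimation error: a deviation term and the bias
    of clipping. *)
Let nu := lam / 136 + 14 * be / n%:R.

Let noise_good p b r : p.+1%:R <= 6 * L -> 20 * L <= n%:R -> 0 <= r -> N b <= r ->
  lam * r <= 17 * be -> q b <= 33 * be ->
  mostly (expR (- p.+1%:R)) (fun w => forall u,
    `|2 * dot ((v - b *m S) - (vn w - b *m Sn w)) u| <= nu * Num.sqrt (dot u u)).
Proof.
move=> pL Ln r0 Nb lamr qb.
have P0 : 0 <= p.+1%:R :> R by [].
have [h1 h2] := noise_numeric be0 L2 lam0 r0 nR Ln kap_large lamE lamr P0 pL.
have [g1 g2] := noise_moments (ltW be0) (ltW b20) b2be L0 (ltW nR0) P0 KE h1 h2.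
(* The deviation c = lam n / 1088 is chosen so that 8 c / n is the first term
   lam / 136 of nu. *)
have c0 : 0 < lam * n%:R / 1088 by rewrite divr_gt0 ?ltr0n // mulr_gt0.
have br : dot b b <= r ^+ 2 by apply: le_trans (N2 b) _; rewrite lerXn2r ?nnegrE.
have bs : dot (b *m S) b <= 98 * be.
  by have h3 := quad_le b; have h4 := rho_le; have h5 := qb; lra.
apply: mostlyW (noise_event mZ iidZ mf fb b20 my be0 iU EU K0 n0 c0 br bs g1 g2) => //.
move=> w h u; apply: (le_trans (h u)); rewrite ler_wpM2r ?sqrtr_ge0 // lerD //.
  rewrite le_eqVlt; apply/orP; left; apply/eqP; field.
  by rewrite gt_eqF // gt_eqF.
exact: (truncation_bias_noise be0 (ltW b20) b2be nR0 eps0 eps_le).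
Qed.

Let gap_good p a0 b : p.+1%:R <= 6 * L -> F a0 <= Fs + zeta ->
  16 < N a0 -> N b <= N a0 / 16 -> lam * N a0 <= 17 * be -> q a0 <= 17 * be ->
  mostly (expR (- p.+1%:R)) (fun w => (q b - qn w b) - (q a0 - qn w a0) <=
     dot ((b - a0) *m S) (b - a0) / 16 + 34^-1 * lam).
Proof.
move=> pL Fa0 r16 Nb lamr qa0.
have P0 : 0 <= p.+1%:R :> R by [].
have r0 : 0 <= N a0 by exact: N0.
have r1 : 1 < N a0 by apply: lt_trans r16; rewrite ltr1n.
pose sg := dot ((b - a0) *m S) (b - a0); have sg0 : 0 <= sg by exact: S0.
have qbE : q b = q a0 - 2 * dot (v - a0 *m S) (b - a0) + sg.
  by rewrite -[in LHS](subrK a0 b) addrC /q qriskD.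
have signal : (lam * N a0) ^+ 2 <= 600 * be * sg.
  apply: (signal_numeric (dd := dot (v - a0 *m S) (b - a0)) (q0 := q a0) (qb := q b) (Nb := N b) (zeta := zeta)) => //.
  - exact: qrisk_signal.
  - by rewrite /zeta ge_min lexx.
  - by have := penalized_risk_inf_le b; have := Fa0; rewrite /F => h1 h2; lra.
have [h1 h2] := gap_numeric be0 L2 lam0 r16 nR kap_large lamE lamr signal sg0 P0 pL.
have [g1 g2] := gap_moments (ltW be0) (ltW b20) b2be L0 (ltW nR0) P0 KE sg0 h1 h2.
set c := n%:R * (sg / 32 + lam / 68) / 4 in h1 h2 g1 g2.
have c0 : 0 < c.
  rewrite divr_gt0 ?ltr0n // mulr_gt0 // ltr_wpDl ?divr_gt0 ?ltr0n //.
  by rewrite divr_ge0.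
have Na0 := N2 a0; have Nb2 : dot b b <= N a0 ^+ 2 / 256.
  apply: le_trans (N2 b) _; rewrite (_ : N a0 ^+ 2 / 256 = (N a0 / 16) ^+ 2); last by field.
  by rewrite lerXn2r ?nnegrE ?divr_ge0.
have dm : dot (b - a0) (b - a0) <= 3 * N a0 ^+ 2.
  have := dot_ge0 (b + a0); rewrite !(dotDl, dotDr, dotNl, dotNr) (dotC a0 b) => h3.
  have h4 := sqr_ge0 (N a0); lra.
have dp : dot (b + a0) (b + a0) <= 3 * N a0 ^+ 2.
  have := dot_ge0 (b - a0); rewrite !(dotDl, dotDr, dotNl, dotNr) (dotC a0 b) => h3.
  have h4 := sqr_ge0 (N a0); lra.
apply: mostlyW (gap_event mZ iidZ mf fb b20 my be0 iU EU K0 n0 c0 dm dp g1 g2 (erefl _)) => //.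
move=> w; rewrite -/(q _) -/(q _) -/(qn w _) -/(qn w _) => h; apply: (le_trans h).
have h3 := truncation_bias_gap be0 L2 (ltW lam0) nR kap_large kapL sg0 eps0 eps_le.
have -> : 4 * c / n%:R = sg / 32 + lam / 68 by rewrite /c; field; rewrite gt_eqF.
by move: h3; rewrite /eps -/sg => h3; lra.
Qed.

(** On the intersection of the events above, [oracle_deterministic] applies. The
    comparators B k are needed only when the nearly optimal point a0 has large norm
    and B k has small norm; for the other indices the event is the whole space. The
    exponent p + 1 is an integer between 4 L and 6 L: the lower bound makes n
    exceptional events affordable. *)
Lemma oracle_event : mostly (expR (- x)) (fun w => forall ah,
  penalized_minimizer w ah -> q ah <= Fs + lam /\ lam * N ah <= K ^+ 2).
Proof.
have X0 := expR_ge0 (- x).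
have n2R : 2 <= n%:R :> R by rewrite (ler_nat R 2).
have E4 := exp_small 3.
have [nL|Ln] := ltP n%:R (20 * L).
  apply: mostlyW clip_good; last first.
    by move=> w gw ah h; split; [exact: (small_sample_oracle nL gw h)|exact: (pen_le gw h)].
  have b0 := failure_budget n2R X0 (lexx _) E4.
  have h := expR_ge0 (- (4%:R * L)).
  have h2 : 0 <= n%:R * (expR (- (4%:R * L)) + expR (- (4%:R * L))) by rewrite mulr_ge0 // addr_ge0.
  by move: b0 h h2 X0; lra.
have [p [pl pu]] : exists p : nat, 4%:R * L <= p.+1%:R /\ p.+1%:R <= 6 * L.
  have h4 : 0 <= 4%:R * L by rewrite mulr_ge0.
  have /andP[t1 t2] := truncn_itv h4; exists (Num.truncn (4%:R * L)); split; first exact: ltW.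
  by rewrite -natr1; have := L2; move: t1; lra.
have [a0 Fa0] := near_oracle.
have [B hB] := near_min_norm Fa0.
have Fs16 : Fs <= 16 * be by apply: le_trans (penalized_risk_inf_le 0) _; rewrite -/(F 0) F00.
have zb : zeta <= be by rewrite /zeta ge_min lexx orbT.
have r0 := N0 a0; have lr0 : 0 <= lam * N a0 by rewrite mulr_ge0 // ltW.
have Fa : q a0 + lam * N a0 <= 17 * be.
  by move: Fa0 Fs16 zb; rewrite /F; lra.
have qa0 : q a0 <= 17 * be by move: Fa lr0; lra.
have lamr : lam * N a0 <= 17 * be by have := q_ge0 a0; move: Fa; lra.
have qa33 : q a0 <= 33 * be by have := be0; move: qa0; lra.
have qB k : q (B k) <= 33 * be.
  have [_ h] := (hB k).1; have h2 : 0 <= lam * N (B k) by rewrite mulr_ge0 // ltW.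
  by move: h h2 Fs16; rewrite /F; lra.
have ev_noise := noise_good pu Ln r0 (lexx _) lamr qa33.
have ev_cov := covariance_event Ln.
have ev_B : mostly (n%:R * (expR (- p.+1%:R) + expR (- p.+1%:R))) (fun w =>
    {in index_enum 'I_n, forall i : 'I_n, 16 < N a0 -> N (B i) <= N a0 / 16 ->
    (forall u, `|2 * dot ((v - B i *m S) - (vn w - B i *m Sn w)) u| <= nu * Num.sqrt (dot u u)) /\
    (q (B i) - qn w (B i)) - (q a0 - qn w a0) <=
       dot ((B i - a0) *m S) (B i - a0) / 16 + 34^-1 * lam}).
  apply: mostlyW (mostly_all mZ (s := index_enum 'I_n)
    (p := expR (- p.+1%:R) + expR (- p.+1%:R)) _) => [||i _].
  - by rewrite /index_enum -enumT -cardE card_ord.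
  - by move=> w; exact.
  case/orP: (orbN (16 < N a0)) => r16; last first.
    apply: mostlyW (mostlyT P Z (Q := fun=> True) (fun=> I)) => [|w _].
      by rewrite addr_ge0 ?expR_ge0.
    by move=> h; rewrite h in r16.
  case/orP: (orbN (N (B i) <= N a0 / 16)) => Nb; last first.
    apply: mostlyW (mostlyT P Z (Q := fun=> True) (fun=> I)) => [|w _].
      by rewrite addr_ge0 ?expR_ge0.
    by move=> _ h; rewrite h in Nb.
  have Nb' : N (B i) <= N a0 by apply: (le_trans Nb); move: r0; lra.
  apply: mostlyW (mostlyI mZ (noise_good pu Ln r0 Nb' lamr (qB i))
    (gap_good pu Fa0 r16 Nb lamr qa0)) => //.
have EP : expR (- p.+1%:R) <= expR (- (4%:R * L)) by rewrite ler_expR lerN2.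
apply: mostlyW (mostlyI mZ (mostlyI mZ (mostlyI mZ clip_good ev_cov) ev_noise) ev_B).
  exact: failure_budget.
move=> w [[[gw REL] noise0] noiseB] ah hah.
have pen := pen_le gw hah; split => //.
have rn := radius_le_size be0 L2 lam0 kap_large kapL lamr.
rewrite KE in pen.
have sz := size_numeric be0 (ltW b20) b2be L2 lam0 nR r0 (N0 ah) kap_large lamE lamr pen (erefl nu).
have nR' : 0 < n%:R :> R by exact: nR0.
apply: (@oracle_deterministic R D n N rho v S (rhon w) (vn w) (Sn w) lam zeta
  (640 * L * b2 / n%:R) nu (17 * be) Fs ah a0 B).
- exact: Ssym.
- exact: emp_S_sym.
- exact: S0.
- exact: N0.
- exact: N2.
- exact: Nmid.
- exact: lam0.
- by rewrite mulrC /zeta ge_min lexx.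
- apply: divr_ge0; last exact: ltW.
  by apply: mulr_ge0; [apply: mulr_ge0; [exact: ler0n|exact: L0]|exact: ltW].
- apply: addr_ge0; apply: divr_ge0; [exact: ltW|exact: ler0n| |exact: ltW].
  by apply: mulr_ge0; [exact: ler0n|exact: ltW].
- exact: penalized_risk_inf_le.
- by rewrite lerBlDl.
- exact: (minE gw hah).
- by move=> k; exact: (hB k).1.1.
- by move=> k a h1 h2; exact: ((hB k).2 a (conj h1 h2)).
- exact: lamr.
- exact: rn.
- exact: REL.
- exact: noise0.
- by move=> k kn r16 Nb; exact: (noiseB (Ordinal kn) (mem_index_enum _) r16 Nb).
- by rewrite [34^-1 * _]mulrC.
Qed.

End HighProbability.

(** * The risk of a plug-in estimator given the sample *)

Section Indicators.
Context d (T : measurableType d) (R : realType) (P : probability T R).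
Local Notation "'E f" := (Rintegral P setT f) (at level 10, f at level 9).

Lemma bm_indic (A : set T) : measurable A -> bm (\1_A : T -> R).
Proof.
move=> mA; split; first exact: measurable_indic.
by exists 1 => w; rewrite indicE; case: (_ \in _) => /=; rewrite ?normr0 ?normr1.
Qed.

Lemma intg_indicM (A : set T) (f : T -> R) : measurable A -> intg P f ->
  intg P (fun w => \1_A w * f w).
Proof.
move=> mA fi; apply: (intg_le _ fi) => [|w].
  by apply: measurable_funM; [exact: measurable_indic|exact: intg_meas fi].
by rewrite indicE; case: (_ \in _); rewrite ?mul1r // mul0r normr0.
Qed.

Lemma integral_indicM (A : set T) (f : T -> R) : measurable A -> intg P f ->
  (\int[P]_(w in A) (f w)%:E = ('E (fun w => \1_A w * f w))%:E)%E.
Proof.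
move=> mA fi; rewrite EFin_Ex; last exact: intg_indicM.
rewrite integral_mkcond; apply: eq_integral => w _.
by rewrite patchE indicE; case: (_ \in _); rewrite ?mul1r ?mul0r.
Qed.

Lemma negligible_pos (A : set T) (f : T -> R) : measurable A -> intg P f ->
  (forall w, A w -> 0 < f w) -> 'E (fun w => \1_A w * f w) <= 0 -> P A = 0%E.
Proof.
move=> mA fi f0 E0.
have g0 w : 0 <= \1_A w * f w.
  rewrite indicE; case: (boolP (w \in A)) => [|_]; last by rewrite mul0r.
  by rewrite inE => /f0 /ltW ?; rewrite mul1r.
have gi := intg_indicM mA fi; have gm := intg_meas gi.
have I0 : (\int[P]_w `|(\1_A w * f w)%:E| = 0)%E.
  rewrite (_ : (fun w => `|_|%E) = (fun w => (\1_A w * f w)%:E)); last first.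
    by apply/funext => w; rewrite /= ger0_norm.
  by rewrite -EFin_Ex //; congr (_%:E); apply/eqP; rewrite eq_le E0 Ex_ge0.
have /(ae_eq_integral_abs P measurableT (meas_EFin gm)) [N [mN PN hN]] := I0.
apply: (subset_measure0 mA mN _ PN) => w Aw; apply: hN => /= h.
have := h I; rewrite indicE mem_set // mul1r => -[h0].
by have := f0 w Aw; rewrite h0 ltxx.
Qed.

End Indicators.

Section PlugIn.
Context d (T : measurableType d) (R : realType) (P : probability T R).
Context d' (V : measurableType d') (n : nat) (Z : option 'I_n -> T -> V).
Hypothesis mZ : forall i, measurable_fun setT (Z i).
Hypothesis iidZ : iid P Z.
Local Notation "'E f" := (Rintegral P setT f) (at level 10, f at level 9).
Context (D : nat) (f : V -> 'rV[R]_D) (b2 : R) (y : V -> R) (be : R).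
Hypothesis mf : forall j, measurable_fun setT (fun v => f v 0 j).
Hypothesis fb : forall v, dot (f v) (f v) <= b2.
Hypothesis my : measurable_fun setT y.
Hypothesis be0 : 0 < be.
Hypothesis iU : intg P (fun w => expR (y (Z None w) ^+ 2 / (8 * be))).
Let x0 w := f (Z None w).
Let y0 w := y (Z None w).
Local Notation S := (second_moment P Z f).
Local Notation v := (pop_v P Z f y).
Local Notation rho := (pop_rho P Z y).

Let f_bound j x : `|f x 0 j| <= 1 + b2. Proof. exact: entry_le. Qed.

Let bmx j : bm (fun w => x0 w 0 j).
Proof.
by apply: (@bm_comp _ _ _ _ _ _ _ mZ (fun x => f x 0 j) None) => //; exists (1 + b2).
Qed.

(** After expansion of the square the fresh observation enters only through y^2, y x_j
    and x_j x_k, each multiplied by a function of the sample; [sample_Ex] replaces them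
    by their means, the coefficients of the risk. *)
Lemma plug_in_risk (B : set T) (a : T -> 'rV[R]_D) (M : R) :
  sig_sample Z (past n n) B ->
  (forall j, sig_fun Z (past n n) (fun w => a w 0 j)) ->
  (forall j w, `|a w 0 j| <= M) ->
  intg P (fun w => \1_B w * (y0 w - dot (x0 w) (a w)) ^+ 2) /\
  'E (fun w => \1_B w * (y0 w - dot (x0 w) (a w)) ^+ 2) =
  'E (fun w => \1_B w * qrisk rho v S (a w)).
Proof.
move=> sB sa aM; have [indZ _] := iidZ.
have nN : None \notin past n n by rewrite inE.
have s1 : sig_fun Z (past n n) (\1_B : T -> R).
  exact: (@measurable_indic _ (g_sigma_algebraType (gen_sample Z (past n n)))).
have b1 : bm (\1_B : T -> R).
  split; first exact: (sig_fun_measurable mZ s1).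
  by exists 1 => w; rewrite /indic; case: (_ \in _) => /=; rewrite ?normr0 ?normr1.
have ba j : bm (fun w => a w 0 j).
  by split; [exact: (sig_fun_measurable mZ (sa j))|exists M].
have s2 j : sig_fun Z (past n n) (fun w => \1_B w * a w 0 j).
  by apply: measurable_funM; [exact: s1|exact: sa].
have s3 j k : sig_fun Z (past n n) (fun w => \1_B w * a w 0 j * a w 0 k).
  by apply: measurable_funM; [exact: s2|exact: sa].
have iy2 := intg_y2 mZ my be0 iU.
have iy := intg_y mZ my be0 iU.
have [i1 e1] := sample_Ex mZ indZ nN s1 (bm_intg P b1) (measurable_funX 2 my) iy2.
have f2 j := sample_Ex mZ indZ nN (s2 j) (bm_intg P (bmM b1 (ba j)))
   (measurable_funM my (mf j)) (intgMbm iy (bmx j)).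
have f3 j k := sample_Ex mZ indZ nN (s3 j k) (bm_intg P (bmM (bmM b1 (ba j)) (ba k)))
   (measurable_funM (mf j) (mf k)) (bm_intg P (bmM (bmx j) (bmx k))).
pose g w := \1_B w * y0 w ^+ 2 + (-2 * (\sum_j (\1_B w * a w 0 j * (y0 w * x0 w 0 j))) +
  \sum_j \sum_k \1_B w * a w 0 j * a w 0 k * (x0 w 0 j * x0 w 0 k)).
have gE : (fun w => \1_B w * (y0 w - dot (x0 w) (a w)) ^+ 2) = g.
  apply/funext => w; rewrite /g.
  have -> : \sum_j (\1_B w * a w 0 j * (y0 w * x0 w 0 j)) = \1_B w * y0 w * dot (x0 w) (a w).
    by rewrite /dot mulr_sumr; apply: eq_bigr => j _; ring.
  have -> : \sum_j \sum_k \1_B w * a w 0 j * a w 0 k * (x0 w 0 j * x0 w 0 k) =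
     \1_B w * (dot (x0 w) (a w) * dot (x0 w) (a w)).
    rewrite {1}/dot mulr_suml mulr_sumr; apply: eq_bigr => j _.
    by rewrite /dot mulr_sumr mulr_sumr; apply: eq_bigr => k _; ring.
  by ring.
have iA : intg P (fun w => \sum_j (\1_B w * a w 0 j * (y0 w * x0 w 0 j))).
  by apply: intg_sum => j; exact: (f2 j).1.
have iB : intg P (fun w => \sum_j \sum_k \1_B w * a w 0 j * a w 0 k * (x0 w 0 j * x0 w 0 k)).
  by apply: intg_sum => j; apply: intg_sum => k; exact: (f3 j k).1.
rewrite gE; split.
  by apply: intgD => //; apply: intgD => //; exact: intgZ.
rewrite /g ExD //; last by apply: intgD => //; exact: intgZ.
rewrite ExD //; last exact: intgZ.
rewrite ExZ // Ex_sum => [|j]; last exact: (f2 j).1.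
rewrite Ex_sum => [|j]; last by apply: intg_sum => k; exact: (f3 j k).1.
pose h w := \1_B w * rho + (-2 * (\sum_j v 0 j * (\1_B w * a w 0 j)) +
  \sum_j \sum_k S j k * (\1_B w * a w 0 j * a w 0 k)).
have -> : (fun w => \1_B w * qrisk rho v S (a w)) = h.
  apply/funext => w; rewrite /h /qrisk.
  have -> : \sum_j v 0 j * (\1_B w * a w 0 j) = \1_B w * dot v (a w).
    by rewrite /dot mulr_sumr; apply: eq_bigr => j _; ring.
  have -> : \sum_j \sum_k S j k * (\1_B w * a w 0 j * a w 0 k) = \1_B w * dot (a w *m S) (a w).
    rewrite /dot mulr_sumr exchange_big /=; apply: eq_bigr => k _.
    by rewrite mxE mulr_suml mulr_sumr; apply: eq_bigr => j _; ring.
  by ring.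
have b2' j : bm (fun w => \1_B w * a w 0 j) by exact: bmM.
have b3 j k : bm (fun w => \1_B w * a w 0 j * a w 0 k) by exact: bmM.
rewrite /h ExD; last 2 first.
- by under eq_fun do rewrite mulrC; apply: intgZ; exact: bm_intg.
- apply: bm_intg; apply: bmD; first by apply: bmZ; apply: bm_sum => j; exact: bmZ.
  by apply: bm_sum => j; apply: bm_sum => k; exact: bmZ.
rewrite ExD; last 2 first.
- by apply: bm_intg; apply: bmZ; apply: bm_sum => j; exact: bmZ.
- by apply: bm_intg; apply: bm_sum => j; apply: bm_sum => k; exact: bmZ.
rewrite ExZ; last by apply: bm_intg; apply: bm_sum => j; exact: bmZ.
rewrite Ex_sum => [|j]; last by apply: bm_intg; exact: bmZ.
rewrite Ex_sum => [|j]; last by apply: bm_intg; apply: bm_sum => k; exact: bmZ.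
congr (_ + (_ * _ + _)).
- rewrite e1 (_ : (fun w => \1_B w * rho) = fun w => rho * \1_B w); last by apply/funext => w; rewrite mulrC.
  by rewrite ExZ; [exact: mulrC|exact: bm_intg].
- apply: eq_bigr => j _; rewrite (f2 j).2 ExZ; last exact: bm_intg.
  by rewrite mxE; exact: mulrC.
- apply: eq_bigr => j _; rewrite !Ex_sum => [|k|k]; [|by apply: bm_intg; exact: bmZ|exact: (f3 j k).1].
  apply: eq_bigr => k _; rewrite (f3 j k).2 ExZ; last exact: bm_intg.
  by rewrite mxE; exact: mulrC.
Qed.

(** A version r of the conditional risk satisfies r <= thr almost surely wherever the
    risk of the estimator, seen as a fixed matrix, is at most thr: on the exceptional set
    r - thr is positive and, by [plug_in_risk], has nonpositive integral. The estimator
    is bounded on G, which gives integrability. *)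
Lemma conditional_risk_le (G : set T) (ah : T -> 'rV[R]_D) (r : T -> R) (thr M : R) :
  sig_sample Z (past n n) G ->
  (forall j, sig_fun Z (past n n) (fun w => ah w 0 j)) ->
  (forall w, G w -> qrisk rho v S (ah w) <= thr) ->
  (forall w j, G w -> `|ah w 0 j| <= M) ->
  intg P r -> sig_fun Z (past n n) r ->
  (forall A, sig_sample Z (past n n) A -> A `<=` G ->
    'E (fun w => \1_A w * r w) = 'E (fun w => \1_A w * (y0 w - dot (x0 w) (ah w)) ^+ 2)) ->
  P (G `&` [set w | thr < r w]) = 0%E.
Proof.
move=> sG sa qa aM ri sr rE; set A := G `&` _.
have sA : sig_sample Z (past n n) A.
  apply: (@measurableI _ (g_sigma_algebraType (gen_sample Z (past n n)))) => //.
  exact: sig_strict_superlevel.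
have mA := sig_sample_measurable mZ sA.
have M0 : 0 <= `|M| by [].
have s1 : sig_fun Z (past n n) (\1_A : T -> R).
  exact: (@measurable_indic _ (g_sigma_algebraType (gen_sample Z (past n n)))).
pose a w := \1_A w *: ah w.
have sa' j : sig_fun Z (past n n) (fun w => a w 0 j).
  rewrite /sig_fun; under eq_fun do rewrite mxE.
  by apply: measurable_funM; [exact: s1|exact: sa].
have aM' j w : `|a w 0 j| <= `|M|.
  rewrite mxE indicE; case: (boolP (w \in A)) => [|_]; last by rewrite mul0r normr0.
  by rewrite inE mul1r => -[Gw _]; rewrite (le_trans (aM _ _ Gw)) // ler_norm.
have [i1 e1] := plug_in_risk sA sa' aM'.
have aE w : \1_A w * (y0 w - dot (x0 w) (ah w)) ^+ 2 = \1_A w * (y0 w - dot (x0 w) (a w)) ^+ 2.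
  by rewrite /a indicE; case: (_ \in _); rewrite ?mul0r // scale1r.
have bq : bm (fun w => \1_A w * qrisk rho v S (a w)).
  have ba j : bm (fun w => a w 0 j).
    by split; [exact: (sig_fun_measurable mZ (sa' j))|exists `|M|].
  apply: bmM; first exact: bm_indic.
  rewrite /qrisk; apply: bmD; first apply: bmB; first exact: bm_cst.
    by apply: bmZ; apply: bm_sum => j; apply: bmM => //; exact: bm_cst.
  apply: bm_sum => j; apply: bmM => //; under eq_fun do rewrite mxE.
  by apply: bm_sum => k; apply: bmM => //; exact: bm_cst.
apply: (@negligible_pos _ _ _ _ A (fun w => r w - thr)) => //.
- by apply: intgB => //; exact: intg_cst.
- by move=> w [_ /=]; rewrite subr_gt0.
rewrite (_ : (fun w => _) = fun w => \1_A w * r w - \1_A w * thr); last first.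
  by apply/funext => w; rewrite mulrBr.
have it : intg P (fun w => \1_A w * thr) by apply: intg_indicM => //; exact: intg_cst.
rewrite ExB //; last exact: intg_indicM.
rewrite subr_le0 rE //; last by move=> w [].
under eq_Rintegral do rewrite aE.
rewrite e1; apply: Ex_le => //; first exact: bm_intg.
move=> w; rewrite /a indicE; case: (boolP (w \in A)) => [|_]; last by rewrite !mul0r.
by rewrite inE !mul1r scale1r => -[Gw _]; exact: qa.
Qed.

End PlugIn.

(** * Random matrices and sub-Gaussian responses *)

Section BorelMatrices.
Context (R : realType) (m T : nat).

Lemma measurable_entry i k :
  measurable_fun setT (fun A : borel_mx R m T => (A : 'M[R]_(m, T)) i k).
Proof.
apply: (@measurability _ _ _ _ _ _ (@RGenOInfty.G R)).
  exact: RGenOInfty.measurableE.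
move=> _ [_ [x ->] <-]; rewrite setTI; apply: sub_sigma_algebra.
have /continuousP h := @coord_continuous R m T i k.
by apply: (h `]x, +oo[%classic); exact: interval_open.
Qed.

(** The bound on the Frobenius norm holds almost surely; truncation makes it hold
    everywhere without changing the law. *)
Definition truncated_row (b2 : R) (v : borel_mx R m T * R) : 'rV[R]_(m * T) :=
  if dot (mxvec v.1) (mxvec v.1) <= b2 then mxvec v.1 else 0.

Lemma measurable_mxvec j :
  measurable_fun setT (fun v : borel_mx R m T * R => mxvec (v.1 : 'M[R]_(m, T)) 0 j).
Proof.
have [i k] := mxvec_indexP j; under eq_fun do rewrite mxvecE.
by apply: measurableT_comp (measurable_entry i k) _; exact: measurable_fst.
Qed.

Lemma measurable_mxvec_dot :
  measurable_fun setT (fun v : borel_mx R m T * R => dot (mxvec (v.1 : 'M[R]_(m, T))) (mxvec v.1)).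
Proof. by apply: measurable_sum => j; apply: measurable_funM; exact: measurable_mxvec. Qed.

Lemma measurable_truncated_row b2 j :
  measurable_fun setT (fun v => truncated_row b2 v 0 j).
Proof.
rewrite (_ : (fun v => _) = fun v : borel_mx R m T * R =>
   if dot (mxvec v.1) (mxvec v.1) <= b2 then mxvec v.1 0 j else 0); last first.
  by apply/funext => v; rewrite /truncated_row; case: ifP => // _; rewrite mxE.
apply: measurable_fun_ifT => //; last exact: measurable_mxvec.
by apply: measurable_fun_ler => //; exact: measurable_mxvec_dot.
Qed.

Lemma truncated_row_le b2 v : 0 <= b2 -> dot (truncated_row b2 v) (truncated_row b2 v) <= b2.
Proof. by move=> b0; rewrite /truncated_row; case: ifP => // _; rewrite dot0l. Qed.

End BorelMatrices.

Section SubGaussian.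
Context d (T : measurableType d) (R : realType) (P : probability T R).
Local Notation "'E f" := (Rintegral P setT f) (at level 10, f at level 9).

(** The infimum in the definition of the norm need not be attained, whence the
    factor 2. *)
Lemma psi2_norm_lt (W : T -> R) (b : R) : (psi2_norm P W <= b%:E)%E -> 0 < b ->
  exists c, [/\ 0 < c, c < 2 * b &
    (\int[P]_w (expR (`|W w| ^+ 2 / c ^+ 2))%:E <= 2%:E)%E].
Proof.
move=> h b0; have : (psi2_norm P W < (2 * b)%:E)%E.
  by apply: le_lt_trans h _; rewrite lte_fin; lra.
move=> /ereal_inf_lt [_ [c [c0 hc] <-]]; rewrite lte_fin => cb.
by exists c; split => //; move: hc; rewrite unlock.
Qed.

Lemma expR_quarter : expR 4^-1 <= 3 / 2 :> R.
Proof.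
have h := @exp_half_le R 2^-1; apply: le_trans (le_trans _ (h _ _)) _; try lra.
by rewrite ler_expR; lra.
Qed.

(** Y^2 <= 2 (Y - eta)^2 + 2 eta^2: after division by 8 be the first term is at most
    the exponent in the definition of the psi_2 norm, with exponential moment at most 2,
    and the second one at most 1/4, with e^(1/4) <= 3/2. *)
Lemma exp_moment_le (Y eta : T -> R) (bpsi beta be : R) :
  measurable_fun setT Y -> measurable_fun setT eta -> 0 < bpsi -> 0 < be ->
  bpsi ^+ 2 <= be -> beta ^+ 2 <= be ->
  (psi2_norm P (fun w => (Y w - eta w)%R) <= bpsi%:E)%E ->
  {ae P, forall w, `|eta w| <= beta} ->
  intg P (fun w => expR (Y w ^+ 2 / (8 * be))) /\
  'E (fun w => expR (Y w ^+ 2 / (8 * be))) <= 3.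
Proof.
move=> mY meta bpsi0 be0 bb1 bb2 /psi2_norm_lt/(_ bpsi0)[c [c0 cb hc]] hae.
have c2 : c ^+ 2 <= 4 * be.
  apply: (@le_trans _ _ ((2 * bpsi) ^+ 2)); last by rewrite exprMn; lra.
  by rewrite lerXn2r ?nnegrE ?(ltW c0) ?(ltW cb) // ltW // mulr_gt0.
have c20 : 0 < c ^+ 2 by rewrite exprn_gt0.
pose G w := 3 / 2 * expR (`|Y w - eta w| ^+ 2 / c ^+ 2).
have mU : measurable_fun setT (fun w => expR (Y w ^+ 2 / (8 * be))).
  apply: measurableT_comp => //; apply: measurable_funM => //; exact: measurable_funX.
have mG : measurable_fun setT G.
  apply: measurable_funM => //; apply: measurableT_comp => //; apply: measurable_funM => //.
  by apply: measurable_funX; apply: measurableT_comp => //; exact: measurable_funB.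
have ptw w : `|eta w| <= beta -> expR (Y w ^+ 2 / (8 * be)) <= G w.
  move=> eb; apply: (@le_trans _ _ (expR (4^-1 + `|Y w - eta w| ^+ 2 / c ^+ 2))); last first.
    by rewrite expRD ler_wpM2r ?expR_ge0 // expR_quarter.
  rewrite ler_expR real_normK ?num_real //.
  have e2 : eta w ^+ 2 <= be.
    apply: le_trans bb2; rewrite -[leLHS]real_normK ?num_real //.
    by rewrite lerXn2r ?nnegrE // (le_trans _ eb).
  have h1 : Y w ^+ 2 <= 2 * (Y w - eta w) ^+ 2 + 2 * eta w ^+ 2.
    by have := sqr_ge0 (Y w - 2 * eta w); rewrite !expr2; lra.
  have h2 : (Y w - eta w) ^+ 2 / (4 * be) <= (Y w - eta w) ^+ 2 / c ^+ 2.
    by rewrite ler_wpM2l ?sqr_ge0 // lef_pV2 ?posrE //; lra.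
  apply: (@le_trans _ _ ((Y w - eta w) ^+ 2 / (4 * be) + 4^-1)); last by rewrite addrC lerD2l.
  rewrite ler_pdivrMr; last lra.
  rewrite mulrDl (_ : _ / (4 * be) * (8 * be) = 2 * (Y w - eta w) ^+ 2); last by field; rewrite gt_eqF.
  by lra.
have IG : (\int[P]_w (G w)%:E <= 3%:E)%E.
  rewrite /G; under eq_integral do rewrite EFinM.
  rewrite ge0_integralZl_EFin //; last by apply: meas_EFin; apply: measurableT_comp => //; apply: measurable_funM => //; apply: measurable_funX; apply: measurableT_comp => //; exact: measurable_funB.
  apply: (@le_trans _ _ ((3 / 2)%:E * 2%:E)%E); first by rewrite lee_wpmul2l // lee_fin.
  by rewrite -EFinM lee_fin; lra.
have IU : (\int[P]_w (expR (Y w ^+ 2 / (8 * be)))%:E <= 3%:E)%E.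
  apply: le_trans IG; apply: ae_ge0_le_integral => //.
  - exact: meas_EFin.
  - by move=> w _; rewrite lee_fin /G mulr_ge0 ?expR_ge0.
  - exact: meas_EFin.
  - by apply: filterS hae => w eb _; rewrite lee_fin; exact: ptw.
have iU : intg P (fun w => expR (Y w ^+ 2 / (8 * be))).
  apply/integrableP; split; first exact: meas_EFin.
  apply: le_lt_trans (ltry 3); apply: le_trans IU.
  by rewrite le_eqVlt; apply/orP; left; apply/eqP; apply: eq_integral => w _; rewrite /= ger0_norm ?expR_ge0.
by split => //; rewrite -lee_fin EFin_Ex.
Qed.

Lemma Lnorm_oo_ae (eta : T -> R) (b : R) : (Lnorm P +oo (EFin \o eta) <= b%:E)%E ->
  {ae P, forall w, `|eta w| <= b}.
Proof.
rewrite Lnorm.unlock /= probability_setT lte01 => /ess_supP.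
by apply: filterS => w; rewrite /= lee_fin.
Qed.

End SubGaussian.

(** * Trace regression with nuclear norm penalty *)

Section TraceRegression.
Context (R : realType) (n m T : nat) d (Omega : measurableType d) (P : probability Omega R).
Context (X : {mfun Omega >-> borel_mx R m T}) (Y : {RV P >-> R}).
Context (Xs : 'I_n -> {mfun Omega >-> borel_mx R m T}) (Ys : 'I_n -> {RV P >-> R}).
Local Notation V := (borel_mx R m T * R)%type.
Local Notation "'E f" := (Rintegral P setT f) (at level 10, f at level 9).

Let D (i : 'I_n) (w : Omega) : V := (Xs i w, Ys i w).
Let Z (o : option 'I_n) (w : Omega) : V := if o is Some i then D i w else (X w, Y w).

Hypothesis iidZ : iid P Z.

Lemma measurable_observation o : measurable_fun setT (Z o).
Proof.
by case: o => [i|]; apply: measurable_fun_pair.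
Qed.
Let mZ := measurable_observation.

Lemma sample_sigmaE : g_sigma_preimage D = sig_sample Z (past n n).
Proof.
apply/seteqP; split; apply: smallest_sub; try exact: smallest_sigma_algebra.
- apply: (big_ind (fun S => S `<=` sig_sample Z (past n n))) => [//|S S' hS hS'|i _].
    by move=> A [/hS|/hS'].
  move=> _ [B mB <-]; rewrite setTI; apply: sub_sigma_algebra.
  by exists (Some i), B; split => //; rewrite inE.
- move=> _ [[i|] [B [iJ mB ->]]]; last by rewrite inE in iJ.
  apply: sub_sigma_algebra; rewrite (bigD1 i) //=; left.
  by exists B => //; rewrite setTI.
Qed.

Context (b2 : R).
Hypothesis b20 : 0 < b2.
Hypothesis aeX : {ae P, forall w, dot (mxvec (X w : 'M[R]_(m, T))) (mxvec (X w)) <= b2}.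
Let f := @truncated_row R m T b2.
Let y (v : V) := v.2.

Let mf j : measurable_fun setT (fun v => f v 0 j). Proof. exact: measurable_truncated_row. Qed.
Let fb v : dot (f v) (f v) <= b2. Proof. exact: truncated_row_le (ltW b20). Qed.
Let my : measurable_fun setT y. Proof. exact: measurable_snd. Qed.

Let big := [set v : V | b2 < dot (mxvec (v.1 : 'M[R]_(m, T))) (mxvec v.1)].

Let mbig : measurable big.
Proof. exact: strict_superlevel_measurable (@measurable_mxvec_dot R m T). Qed.

Let Pbig o : P (Z o @^-1` big) = 0%E.
Proof.
rewrite (iidZ.2 o None) //; have [N [mN PN hN]] := aeX.
apply: (subset_measure0 (measurable_preimage (mZ None) mbig) mN _ PN) => w /= h.
by apply: hN => /=; apply/negP; rewrite -ltNge.
Qed.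

Let fE v : ~ big v -> f v = mxvec v.1.
Proof. by move/negP; rewrite -leNgt /f /truncated_row => ->. Qed.

Lemma sample_not_truncated : mostly P Z 0 (fun w => forall i, f (D i w) = mxvec (Xs i w : 'M[R]_(m, T))).
Proof.
have h : {in index_enum 'I_n, forall i, mostly P Z 0 (fun w => f (D i w) = mxvec (Xs i w : 'M[R]_(m, T)))}.
  move=> i _; exists (Z (Some i) @^-1` big); split.
  - by apply: sub_sigma_algebra; exists (Some i), big; split => //; rewrite inE.
  - by rewrite Pbig.
  - by move=> w /fE.
apply: mostlyW (mostly_all mZ h); first by rewrite mulr0.
by move=> w hw i; apply: hw; exact: mem_index_enum.
Qed.

(** The truncation of the design changes the loss on a null set only, even for a
    random A. *)
Lemma loss_ae (A : Omega -> 'M[R]_(m, T)) : {ae P, forall w,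
  (Y w - mx_inner (X w) (A w)) ^+ 2 = (y (Z None w) - dot (f (Z None w)) (mxvec (A w))) ^+ 2}.
Proof.
exists (Z None @^-1` big); split; [exact: measurable_preimage|exact: Pbig|].
move=> w /= h; apply: contrapT => hw; apply: h.
by rewrite mx_inner_dot (fE hw).
Qed.

Context (be : R).
Hypothesis be0 : 0 < be.
Hypothesis b2be : b2 <= be.
Hypothesis iU : intg P (fun w => expR (Y w ^+ 2 / (8 * be))).
Hypothesis EU : 'E (fun w => expR (Y w ^+ 2 / (8 * be))) <= 3.
Local Notation q := (qrisk (pop_rho P Z y) (pop_v P Z f y) (second_moment P Z f)).

Let mloss (A : 'M[R]_(m, T)) :
  measurable_fun setT (fun w => (Y w - mx_inner (X w) A) ^+ 2).
Proof.
apply: measurable_funX; apply: measurable_funB => //.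
under eq_fun do rewrite mx_inner_dot; apply: measurable_sum => j.
apply: measurable_funM => //.
have := measurableT_comp (@measurable_mxvec R m T j) (mZ None); exact.
Qed.

Lemma risk_qrisk (A : 'M[R]_(m, T)) : risk X Y A = (q (mxvec A))%:E.
Proof.
have i2 := intg_sq_res mZ mf fb my be0 iU (mxvec A).
rewrite /risk unlock (qrisk_Ex mZ mf fb my be0 iU) EFin_Ex //.
apply: ae_eq_integral => //; [exact/meas_EFin/mloss|exact/meas_EFin/(intg_meas i2)|].
by apply: filterS (loss_ae (fun=> A)) => w /= -> .
Qed.

Context (lam x kap : R).
Hypothesis n2 : (2 <= n)%N.
Hypothesis x0 : 0 < x.
Hypothesis kap_large : 1000 * 1000 <= kap.
Hypothesis lam0 : 0 < lam.
Hypothesis lamE : kap ^+ 2 * (be * (x + ln n%:R)) ^+ 2 <= lam ^+ 2 * n%:R.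
Context (Ahat : Omega -> borel_mx R m T).
Hypothesis mAhat : forall B : set (borel_mx R m T),
    measurable B -> g_sigma_preimage D (Ahat @^-1` B).
Hypothesis Ahat_min : forall w : Omega,
    is_argmin (fun A : 'M[R]_(m, T) =>
      empirical_risk (D^~ w) A + lam * schatten 1%:E A) (Ahat w).
Context (rA : Omega -> R).
Hypothesis rA_cond : is_cond_exp P (g_sigma_preimage D)
    (fun w => (Y w - mx_inner (X w) (Ahat w)) ^+ 2) rA.

Let N (u : 'rV[R]_(m * T)) := schatten 1%:E (vec_mx u : 'M[R]_(m, T)).
Let N0 u : 0 <= N u. Proof. exact: schatten1_ge0. Qed.
Let N00 : N 0 = 0. Proof. by rewrite /N linear0 schatten1_0. Qed.
Let N2 u : dot u u <= N u ^+ 2.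
Proof. by rewrite -[u in dot u u]vec_mxK -mx_inner_dot; exact: frobenius_le_schatten1. Qed.
Let Nmid a b : N (2^-1 *: a + 2^-1 *: b) <= (N a + N b) / 2.
Proof.
rewrite /N linearD !linearZ /=; apply: le_trans (schatten1_convex _ _ _ _) _; rewrite ?invr_ge0 //.
by rewrite -mulrDr mulrC.
Qed.

Let K := Num.sqrt (32 * be * (x + ln n%:R)).
Let K0 : 0 <= K. Proof. exact: sqrtr_ge0. Qed.
Let KE : K ^+ 2 = 32 * be * (x + ln n%:R).
Proof.
rewrite sqr_sqrtr // mulr_ge0 ?mulr_ge0 ?(ltW be0) //.
by apply: addr_ge0; [exact: ltW|apply: ln_ge0; rewrite ler1n ltnW].
Qed.
Let Fs := inf (range (fun a => q a + lam * N a)).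

Let minimizer w : (forall i, f (D i w) = mxvec (Xs i w : 'M[R]_(m, T))) ->
  penalized_minimizer Z f y N lam w (mxvec (Ahat w : 'M[R]_(m, T))).
Proof.
move=> fw b; have := Ahat_min w (vec_mx b); rewrite /empirical_risk /N mxvecK.
have e (B : 'M[R]_(m, T)) : \sum_(i < n) ((D i w).2 - mx_inner (D i w).1 B) ^+ 2 =
   \sum_(i < n) (y (Z (Some i) w) - dot (f (Z (Some i) w)) (mxvec B)) ^+ 2.
  by apply: eq_bigr => i _; rewrite fw mx_inner_dot.
by rewrite !e vec_mxK.
Qed.

Let sA j : sig_fun Z (past n n) (fun w => mxvec (Ahat w : 'M[R]_(m, T)) 0 j).
Proof.
apply/sig_funP => B mB; rewrite -sample_sigmaE.
have [i k] := mxvec_indexP j.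
have := mAhat (measurable_preimage (@measurable_entry R m T i k) mB).
by congr (g_sigma_preimage _ _); apply/funext => w /=; rewrite mxvecE.
Qed.

Let G_event : mostly P Z (expR (- x)) (fun w =>
  let a := mxvec (Ahat w : 'M[R]_(m, T)) in q a <= Fs + lam /\ lam * N a <= K ^+ 2).
Proof.
have h := oracle_event mZ iidZ mf fb b20 my be0 iU EU K0 N0 N00 N2 Nmid b2be n2 x0 KE
  kap_large lam0 lamE.
apply: mostlyW (mostlyI mZ h sample_not_truncated); first by rewrite addr0.
by move=> w [hw fw]; apply: hw; exact: minimizer.
Qed.

(** The threshold is the infimum of the penalized risk plus lam. The estimator
    minimizes the penalized empirical risk of the truncated observations, because no
    point of the sample is truncated almost surely; [oracle_event] bounds its risk as a
    fixed matrix, and [conditional_risk_le] transfers the bound to the conditional risk. *)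
Lemma oracle_risk : exists thr : R,
  (forall A, (thr%:E <= risk X Y A + (lam * (1 + schatten 1%:E A))%:E)%E) /\
  ((1 - expR (- x))%:E <= P [set w | (rA w <= thr)%R])%E.
Proof.
exists (Fs + lam); split.
  move=> A; rewrite risk_qrisk lee_fin mulrDr mulr1 [lam + _]addrC addrA lerD2r.
  have := penalized_risk_inf_le mZ mf fb my be0 iU N0 lam0 (mxvec A).
  by rewrite /N mxvecK.
have [A [sAA PA GA]] := G_event; have mA := sig_sample_measurable mZ sAA.
have [ih ir sr er] := rA_cond.
have sG : sig_sample Z (past n n) (~` A).
  exact: (@measurableC _ (g_sigma_algebraType (gen_sample Z (past n n)))).
have Z0 : P (~` A `&` [set w | Fs + lam < rA w]) = 0%E.
  apply: (conditional_risk_le mZ iidZ mf fb my be0 iU (M := K ^+ 2 / lam) sG sA) => //.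
  - by move=> w /GA [].
  - move=> w j /GA [_ h].
    apply: (@le_trans _ _ (N (mxvec (Ahat w : 'M[R]_(m, T))))); last by rewrite ler_pdivlMr // mulrC.
    rewrite -(ler_pXn2r (n := 2)) // ?nnegrE //; apply: le_trans (N2 _).
    by rewrite real_normK ?num_real // sqr_entry_le.
  - by apply/sig_funP => B mB; rewrite -sample_sigmaE; exact: sr.
  - move=> B sB BG; have mB := sig_sample_measurable mZ sB.
    have := er B; rewrite sample_sigmaE => /(_ sB).
    rewrite !integral_indicM // => -[->].
    apply: Ex_ae.
    + exact: intg_meas (intg_indicM mB ih).
    + apply: measurable_funM; first exact: measurable_indic.
      apply: measurable_funX; apply: measurable_funB.
        exact: (measurableT_comp my (mZ None)).
      apply: measurable_sum => j; apply: measurable_funM.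
        exact: (measurableT_comp (mf j) (mZ None)).
      exact: (sig_fun_measurable mZ (sA j)).
    + by apply: filterS (loss_ae Ahat) => w /= -> .
have mE : measurable [set w | rA w <= Fs + lam].
  have mr : measurable_fun setT rA := intg_meas ir.
  have := mr measurableT `]-oo, Fs + lam]%classic (measurable_itv _).
  by rewrite setTI; congr (measurable _); apply/funext => w /=; rewrite in_itv.
have mB : measurable (~` A `&` [set w | Fs + lam < rA w]).
  apply: measurableI; first exact: measurableC.
  rewrite (_ : [set w | _] = ~` [set w | rA w <= Fs + lam]); first exact: measurableC.
  by apply/funext => w; apply/propext; split => /=; rewrite ltNge => /negP.
have sub : ~` [set w | rA w <= Fs + lam] `<=` A `|` (~` A `&` [set w | Fs + lam < rA w]).
  move=> w /negP; rewrite -ltNge => h; have [Aw|nAw] := EM (A w); first by left.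
  by right.
have PC : (P (~` [set w | (rA w <= Fs + lam)%R]) <= (expR (- x))%:E)%E.
  apply: (@le_trans _ _ (P (A `|` (~` A `&` [set w | (Fs + lam < rA w)%R])))).
    by apply: le_measure => //; rewrite inE; [exact: measurableC|exact: measurableU].
  by apply: le_trans (measureU2 _ mA mB) _; rewrite -[leRHS]adde0; apply: leeD PA _; rewrite le_eqVlt; apply/orP; left; apply/eqP; exact: Z0.
have Pf : P [set w | rA w <= Fs + lam] \is a fin_num by exact: fin_num_measure.
move: PC; rewrite probability_setC // -(fineK Pf) -!EFinB !lee_fin; lra.
Qed.

End TraceRegression.

Unset Implicit Arguments.
Set Printing Implicit Defensive.

Theorem theorem1 (R : realType) :
  exists c : R, 0 < c /\
  forall (n m T : nat), (2 <= n)%N -> (1 <= m)%N -> (1 <= T)%N ->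
  forall (d : measure_display) (Omega : measurableType d)
    (P : probability Omega R)
    (X : {mfun Omega >-> borel_mx R m T}) (Y : {RV P >-> R})
    (Xs : 'I_n -> {mfun Omega >-> borel_mx R m T}) (Ys : 'I_n -> {RV P >-> R})
    (bXinf bXlinf bX2 bY bYinf bYpsi2 bY2 : R),
  let D (i : 'I_n) (w : Omega) : borel_mx R m T * R := (Xs i w, Ys i w) in
  iid P (fun (o : option 'I_n) (w : Omega) =>
    if o is Some i then D i w else (X w, Y w)) ->
  assumption_X P X bXinf bXlinf bX2 ->
  assumption_Y X Y bY bYinf bYpsi2 bY2 ->
  forall x : R, 0 < x ->
  let lambda := lambda_nx (c_XY c bXinf bX2 bY bYinf bYpsi2 bY2) n x in
  forall Ahat : Omega -> borel_mx R m T,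
  (forall B : set (borel_mx R m T),
    measurable B -> g_sigma_preimage D (Ahat @^-1` B)) ->
  (forall w : Omega,
    is_argmin (fun A : 'M[R]_(m, T) =>
      empirical_risk (D^~ w) A + lambda * schatten 1%:E A) (Ahat w)) ->
  forall risk_Ahat : Omega -> R,
  is_cond_exp P (g_sigma_preimage D)
    (fun w => (Y w - mx_inner (X w) (Ahat w)) ^+ 2) risk_Ahat ->
  ((1 - 5 * expR (- x))%:E <
   P [set w | (risk_Ahat w)%:E <=
      ereal_inf (range (fun A : 'M[R]_(m, T) =>
        risk X Y A + (lambda * (1 + schatten 1%:E A))%:E))])%E.
Proof.
have [kap [k0 hk]] : exists kap : R, 0 < kap /\ 1000 * 1000 <= kap.
  by exists (1000 * 1000); split; [lra|exact: lexx].
exists (2 * kap); split; first by rewrite mulr_gt0 // ltr0n.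
move=> n m T n2 m1 T1 d Omega P X Y Xs Ys bXinf bXlinf bX2 bY bYinf bYpsi2 bY2 D iidZ.
move=> [[bXinf0 bXlinf0 bX20] [_ _ aeX _]].
move=> [[bY0 bYinf0 bYpsi20 bY20] [eta [v [[iY ieta _ _] [_ [psi eta_le _ _]]]]]].
move=> x x0 lambda Ahat mAhat Amin rA rA_cond.
pose be := 1 + bX2 ^+ 2 + bY * bX2 + bYpsi2 ^+ 2 + bYinf ^+ 2 + bY2 ^+ 2 + bXinf ^+ 2.
have [[s1 s2] s3] := (sqr_ge0 bX2, sqr_ge0 bYpsi2, sqr_ge0 bYinf).
have [s4 s5] := (sqr_ge0 bY2, sqr_ge0 bXinf).
have s6 : 0 <= bY * bX2 by rewrite mulr_ge0 // ltW.
have be0 : 0 < be by rewrite /be; lra.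
have b2be : bX2 ^+ 2 <= be by rewrite /be; lra.
have pbe : bYpsi2 ^+ 2 <= be by rewrite /be; lra.
have ybe : bYinf ^+ 2 <= be by rewrite /be; lra.
have b20 : 0 < bX2 ^+ 2 by rewrite exprn_gt0.
have ae2 : {ae P, forall w, dot (mxvec (X w : 'M[R]_(m, T))) (mxvec (X w)) <= bX2 ^+ 2}.
  apply: filterS aeX => w; rewrite schatten2E mx_inner_dot => h.
  rewrite -[leLHS]sqr_sqrtr ?dot_ge0 // lerXn2r ?nnegrE ?sqrtr_ge0 // ltW //.
have [iU EU] := exp_moment_le (intg_meas iY) (intg_meas ieta) bYpsi20 be0 pbe ybe psi
  (Lnorm_oo_ae eta_le).
have n1 : 1 <= n%:R :> R by rewrite ler1n ltnW.
have ln2 := ln_ge_half R n2.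
have L0 : 0 < x + ln n%:R by lra.
have sn0 : 0 < Num.sqrt n%:R :> R by rewrite sqrtr_gt0; lra.
have sqE : Num.sqrt n%:R ^+ 2 = n%:R :> R by rewrite sqr_sqrtr; lra.
have bL0 : 0 < be * (x + ln n%:R) by rewrite mulr_gt0.
(* 2 log n >= 1 allows one to drop the second logarithm of the penalty. *)
have lamE : lambda * Num.sqrt n%:R = kap * (be * (x + ln n%:R)) * (2 * ln n%:R).
  by rewrite /lambda /lambda_nx /c_XY -/be; field; rewrite gt_eqF.
have kb0 : 0 < kap * (be * (x + ln n%:R)) by rewrite mulr_gt0.
have lam0 : 0 < lambda.
  by rewrite -(pmulr_lgt0 _ sn0) lamE mulr_gt0 //; lra.
have lam_ge : kap ^+ 2 * (be * (x + ln n%:R)) ^+ 2 <= lambda ^+ 2 * n%:R.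
  rewrite -[X in _ <= _ * X]sqE -!exprMn lamE lerXn2r ?nnegrE ?(ltW kb0) //.
    by apply: mulr_ge0; [exact: ltW|lra].
  by rewrite ler_peMr ?(ltW kb0) //; lra.
have [thr [thr_le main]] := oracle_risk iidZ b20 ae2 be0 b2be iU EU n2 x0 hk lam0 lam_ge
  mAhat Amin rA_cond.
set M := ereal_inf _.
have hM : (thr%:E <= M)%E by apply: le_ereal_inf_tmp => _ [A _ <-]; exact: thr_le.
have [_ ir _ _] := rA_cond.
have mr : measurable_fun setT (EFin \o rA) := meas_EFin (intg_meas ir).
have mM : measurable [set w | ((rA w)%:E <= M)%E].
  have := mr measurableT `]-oo, M]%classic (emeasurable_itv _).
  by rewrite setTI; congr (measurable _); apply/funext => w /=; rewrite in_itv.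
have mt : measurable [set w | (rA w <= thr)%R].
  have mr2 : measurable_fun setT rA := intg_meas ir.
  have := mr2 measurableT `]-oo, thr]%classic (measurable_itv _).
  by rewrite setTI; congr (measurable _); apply/funext => w /=; rewrite in_itv.
apply: (@lt_le_trans _ _ (1 - expR (- x))%:E).
  by rewrite lte_fin; have := expR_gt0 (- x); lra.
apply: (le_trans main); apply: le_measure; rewrite ?inE //.
by move=> w /= h; apply: le_trans hM; rewrite lee_fin.
Qed.
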